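(* There is an algorithm which, given a signed tree model $\mathcal T=(T,A,B)$ of an $n$-vertex graph $G$ with $p=|A|+|B|$ transversal pairs, computes in time $O(p\log n)$ each of the following: (1) an interval biclique partition of $G$ with $O(p)$ bicliques; (2) a DAG compression of $G$ of size $O(p\log n)$; and (3), with additional $O(p\log^2 n)$ time, a positive tree model of $G$ with $O(p\log^2 n)$ transversal edges.
   Context: All trees are rooted; $u\preceq_T v$ means $u$ is an ancestor of $v$ (possibly $u=v$), $\prec_T$ strict ancestor. A transversal pair of a rooted tree $T$ is an unordered pair $uv$ of distinct nodes of $T$ such that neither is an ancestor of the other. Two transversal pairs $u_1v_1,u_2v_2$ cross if one of $u_1,v_1$ is a strict ancestor of one of $u_2,v_2$ and one of $u_2,v_2$ is a strict ancestor of one of $u_1,v_1$. A signed tree model is a triple $\mathcal T=(T,A,B)$ where $T$ is a full binary rooted tree (every internal node has exactly two children) and $A,B$ are disjoint sets of transversal pairs of $T$ (anti-edges and edges, respectively) such that no two pairs of $A\cup B$ cross. A transversal pair $u'v'$ covers a pair of nodes $u,v$ if $u'\preceq_T u$, $v'\preceq_T v$, and there is no transversal pair $u''v''\neq u'v'$ in $A\cup B$ with $u'\preceq_T u''\preceq_T u$ and $v'\preceq_T v''\preceq_T v$. The graph of $\mathcal T$ has vertex set the leaves of $T$, two leaves being adjacent iff the pair is covered by a pair of $B$; $\mathcal T$ is a signed tree model of $G$ if its graph is $G$. A positive tree model is a signed tree model with $A=\emptyset$; its pairs are called transversal edges. An interval biclique partition of $G$ is a linear order $<$ on $V(G)$ together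 with a partition $\mathcal B$ of $E(G)$ into bicliques, each of the form $\{xy: x\in X, y\in Y\}$ for two disjoint intervals $X,Y$ of $(V(G),<)$; its number of bicliques is $|\mathcal B|$. A DAG compression $(D,B)$ of $G$ is a directed acyclic graph $D$ whose sinks are exactly the vertices of $G$ together with a set $B$ of pairs of vertices of $D$ (compressed edges) such that $uv\in E(G)$ iff there is $xy\in B$ with directed paths from $x$ to $u$ and from $y$ to $v$ in $D$. Its size is $|V(D)|+|E(D)|+|B|$.
   Formalization: The time for (1),(2) and the DAG size are bounded by O(n + p log n) instead of O(p log n), since the n sinks and the order already need size n (K_{n/2,n/2} has p = 1); the additional time for (3) is O(p log² n + 1), the +1 mattering only for p = 0. *)

(* Defs.v *)
From mathcomp Require Import all_boot.

Set Implicit Arguments.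
Unset Strict Implicit.
Unset Printing Implicit Defensive.

Section Trees.

Variable T : finType.

(* A rooted tree is given by its parent function; the root is its own parent. *)
Implicit Types (par : T -> T) (u v : T).

Definition rooted_tree par : Prop :=
  exists2 r, par r = r & forall v, fconnect par v r.

Definition anc par u v : bool := fconnect par v u.

Definition sanc par u v : bool := anc par u v && (u != v).

Definition children par u : {set T} := [set v | (par v == u) && (v != u)].

Definition is_leaf par u : bool := children par u == set0.

Definition full_binary_tree par : Prop :=
  rooted_tree par /\ forall u, is_leaf par u \/ #|children par u| = 2.

(* An unordered pair uv is the set [set u; v]. *)
Definition transversal par (P : {set T}) : Prop :=
  exists u v, [/\ P = [set u; v], ~~ anc par u v & ~~ anc par v u].

Definition cross par (P Q : {set T}) : bool :=
  [exists u in P, exists v in Q, sanc par u v] &&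
  [exists v in Q, exists u in P, sanc par v u].

Definition signed_tree_model par (A B : {set {set T}}) : Prop :=
  [/\ full_binary_tree par,
      [disjoint A & B],
      forall P, P \in A :|: B -> transversal par P
    & forall P Q, P \in A :|: B -> Q \in A :|: B -> ~~ cross par P Q].

(* Both orderings of u' and v' have to be tried to know whether the unordered
   pair u'v' covers u, v: [stm_graph] quantifies over ordered (u', v'). *)
Definition covers par (A B : {set {set T}}) (u' v' u v : T) : Prop :=
  [/\ anc par u' u, anc par v' v
    & ~ exists u'' v'',
        [/\ [set u''; v''] \in A :|: B, [set u''; v''] != [set u'; v'],
            anc par u' u'' && anc par u'' u
          & anc par v' v'' && anc par v'' v]].

Definition stm_graph par (A B : {set {set T}}) (u v : T) : Prop :=
  exists u' v', [set u'; v'] \in B /\ covers par A B u' v' u v.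

(* [lf] identifies the vertices of the graph with the leaves of the tree. *)
Definition signed_tree_model_of (V : finType) (e : rel V)
    par (A B : {set {set T}}) (lf : V -> T) : Prop :=
  [/\ signed_tree_model par A B,
      injective lf,
      forall u, is_leaf par u <-> exists x, u = lf x
    & forall x y, e x y <-> stm_graph par A B (lf x) (lf y)].

Definition positive_tree_model_of (V : finType) (e : rel V)
    par (B : {set {set T}}) (lf : V -> T) : Prop :=
  signed_tree_model_of e par set0 B lf.

End Trees.

Section Graphs.

Variables (V : finType) (e : rel V).

Definition simple_graph : Prop := symmetric e /\ irreflexive e.

Definition edges : {set {set V}} :=
  [set [set xy.1; xy.2] | xy : V * V & e xy.1 xy.2].

Definition linear_order (lt : rel V) : Prop :=
  [/\ irreflexive lt, transitive lt & forall x y, x != y -> lt x y || lt y x].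

Definition order_interval (lt : rel V) (X : {set V}) : Prop :=
  forall x y z, x \in X -> z \in X -> lt x y -> lt y z -> y \in X.

Definition biclique (X Y : {set V}) : {set {set V}} :=
  [set [set x; y] | x in X, y in Y].

Definition interval_biclique_partition
    (lt : rel V) (Bs : {set {set {set V}}}) : Prop :=
  [/\ linear_order lt, partition Bs edges
    & forall K, K \in Bs -> exists X Y,
        [/\ order_interval lt X, order_interval lt Y, [disjoint X & Y]
          & K = biclique X Y]].

Definition acyclic (D : finType) (arc : rel D) : Prop :=
  forall x y, arc x y -> ~~ connect arc y x.

Definition is_sink (D : finType) (arc : rel D) (x : D) : bool :=
  [forall y, ~~ arc x y].

(* [snk] identifies the vertices of the graph with the sinks of the DAG. *)
Definition dag_compression (D : finType) (arc : rel D) (snk : V -> D)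
    (B : {set {set D}}) : Prop :=
  [/\ acyclic arc,
      injective snk,
      forall x, is_sink arc x <-> exists u, x = snk u,
      forall P, P \in B -> #|P| = 2
    & forall u v, e u v <-> exists x y,
        [/\ [set x; y] \in B, connect arc x (snk u) & connect arc y (snk v)]].

Definition dag_arcs (D : finType) (arc : rel D) : {set D * D} :=
  [set a | arc a.1 a.2].

Definition dag_size (D : finType) (arc : rel D) (B : {set {set D}}) : nat :=
  #|D| + #|dag_arcs arc| + #|B|.

End Graphs.

(* Model of computation: a word RAM with word size w. Memory consists of
   registers and of finitely many arrays (the array accessed is a literal of the
   program), all holding words; arithmetic is modulo 2 ^ w. The running time
   charges one unit per elementary operation, including those inside
   expressions. *)

Inductive wop := OAdd | OSub | OMul | ODiv | OMod | OLt | OEq.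

Inductive expr :=
| ELit of nat
| EReg of nat
| EArr of nat & expr
| EOp of wop & expr & expr.

Inductive prog :=
| PSkip
| PReg of nat & expr
| PArr of nat & expr & expr
| PSeq of prog & prog
| PIf of expr & prog & prog
| PWhile of expr & prog.

Record state := State { regs : nat -> nat; arrs : nat -> nat -> nat }.

Definition upd (X : Type) (f : nat -> X) (i : nat) (x : X) : nat -> X :=
  fun j => if j == i then x else f j.

Definition set_reg (s : state) (r x : nat) : state :=
  State (upd (regs s) r x) (arrs s).

Definition set_arr (s : state) (a i x : nat) : state :=
  State (regs s) (upd (arrs s) a (upd (arrs s a) i x)).

Definition wop_eval (w : nat) (o : wop) (x y : nat) : nat :=
  match o with
  | OAdd => (x + y) %% 2 ^ w
  | OSub => (x + (2 ^ w - y)) %% 2 ^ w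
  | OMul => (x * y) %% 2 ^ w
  | ODiv => (x %/ y) %% 2 ^ w
  | OMod => (x %% y) %% 2 ^ w
  | OLt => (x < y) %% 2 ^ w
  | OEq => (x == y) %% 2 ^ w
  end.

Fixpoint eval (w : nat) (s : state) (t : expr) : nat :=
  match t with
  | ELit k => k %% 2 ^ w
  | EReg r => regs s r
  | EArr a i => arrs s a (eval w s i)
  | EOp o t1 t2 => wop_eval w o (eval w s t1) (eval w s t2)
  end.

Fixpoint ecost (t : expr) : nat :=
  match t with
  | ELit _ | EReg _ => 1
  | EArr _ i => (ecost i).+1
  | EOp _ t1 t2 => (ecost t1 + ecost t2).+1
  end.

(* [exec w c s k s']: started in s, the program c halts in s' after time k. *)
Inductive exec (w : nat) : prog -> state -> nat -> state -> Prop :=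
| XSkip s : exec w PSkip s 1 s
| XReg s r t : exec w (PReg r t) s (ecost t).+1 (set_reg s r (eval w s t))
| XArr s a i t :
    exec w (PArr a i t) s (ecost i + ecost t).+1
      (set_arr s a (eval w s i) (eval w s t))
| XSeq s1 s2 s3 c1 c2 k1 k2 :
    exec w c1 s1 k1 s2 -> exec w c2 s2 k2 s3 ->
    exec w (PSeq c1 c2) s1 (k1 + k2) s3
| XIf s s' t c1 c2 k :
    exec w (if eval w s t != 0 then c1 else c2) s k s' ->
    exec w (PIf t c1 c2) s ((ecost t).+1 + k) s'
| XWhileF s t c :
    eval w s t = 0 -> exec w (PWhile t c) s (ecost t).+1 s
| XWhileT s1 s2 s3 t c k1 k2 :
    eval w s1 t != 0 -> exec w c s1 k1 s2 -> exec w (PWhile t c) s2 k2 s3 ->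
    exec w (PWhile t c) s1 ((ecost t).+1 + k1 + k2) s3.

(* The input is the content of array 0; the rest of the memory is null. *)
Definition init (x : seq nat) : state :=
  State (fun=> 0) (fun a i => if a == 0 then nth 0 x i else 0).

Definition stored (s : state) (a : nat) (x : seq nat) : Prop :=
  forall i, i < size x -> arrs s a i = nth 0 x i.

(* Encodings as sequences of words. Vertices and nodes are numbered arbitrarily
   from 0; sets are listed in arbitrary order, without repetition, each
   unordered pair once with its endpoints in either order. *)

Definition lists_pairs (T : finType) (s : seq (T * T)) (S : {set {set T}}) :=
  uniq [seq [set a.1; a.2] | a <- s] /\
  forall P, (P \in S) = (P \in [seq [set a.1; a.2] | a <- s]).

Definition words_fun (n m : nat) (f : 'I_n -> 'I_m) : seq nat :=
  [seq val (f i) | i <- enum 'I_n].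

Definition words_pairs (m : nat) (s : seq ('I_m * 'I_m)) : seq nat :=
  flatten [seq [:: val a.1; val a.2] | a <- s].

Definition encodes_stm (x : seq nat) (n m : nat) (par : 'I_m -> 'I_m)
    (A B : {set {set 'I_m}}) (lf : 'I_n -> 'I_m) : Prop :=
  exists sA sB, [/\ lists_pairs sA A, lists_pairs sB B &
    x = [:: n; m; size sA; size sB] ++ words_fun par ++ words_fun lf
        ++ words_pairs sA ++ words_pairs sB].

(* The order is output as the increasing list of all the vertices, and a
   biclique as ((a, b), (c, d)), where a, b are the least and greatest vertices
   of one of its sides and c, d those of the other. *)
Definition closed_interval (V : finType) (lt : rel V) (a b : V) : {set V} :=
  [set z | ~~ lt z a && ~~ lt b z].

Definition biclique_of (V : finType) (lt : rel V)
    (q : (V * V) * (V * V)) : {set {set V}} :=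
  biclique (closed_interval lt q.1.1 q.1.2) (closed_interval lt q.2.1 q.2.2).

Definition encodes_ibp (x : seq nat) (n : nat)
    (lt : rel 'I_n) (Bs : {set {set {set 'I_n}}}) : Prop :=
  exists (s : seq 'I_n) (q : seq (('I_n * 'I_n) * ('I_n * 'I_n))),
  [/\ perm_eq s (enum 'I_n),
      forall u v, lt u v = (index u s < index v s),
      uniq [seq biclique_of lt b | b <- q],
      forall K, (K \in Bs) = (K \in [seq biclique_of lt b | b <- q])
    & x = size q :: [seq val v | v <- s]
          ++ flatten [seq words_pairs [:: b.1; b.2] | b <- q]].

Definition encodes_dag (x : seq nat) (n d : nat) (arc : rel 'I_d)
    (snk : 'I_n -> 'I_d) (B : {set {set 'I_d}}) : Prop :=
  exists sE sB,
  [/\ uniq sE, forall a, (a \in sE) = arc a.1 a.2, lists_pairs sB B &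
    x = [:: d; size sE; size sB] ++ words_fun snk
        ++ words_pairs sE ++ words_pairs sB].

(* Main.v *)
Require Import Defs.
From mathcomp Require Import all_boot zify.

Set Implicit Arguments.
Unset Strict Implicit.
Unset Printing Implicit Defensive.

(** The order of the events keeps them cheap: at one abscissa ends precede starts, inner rectangles
    end first and outer ones start first. When a rectangle starts or ends, the other active
    rectangles that meet its interval are then exactly those that contain it. So the colour
    underneath is constant on the interval, and one saved word per rectangle is enough to restore
    it. Starts are ordered by a bucket sort on half perimeters; ends come out in order because each
    starting rectangle is pushed in front of its end list.

    The bound 6p is a potential argument over 2p events. An event splits at most two segments, and
    repainting trades every segment that it removes for at most one box, up to one unit; so boxes
    plus segments grow by at most 3. The segment present at the beginning is offset by one that is
    present at the end. The same potential, weighted with the price of a heap operation, bounds the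
    time.

    Only half of the adjacency matrix is swept: the two leaf intervals of a pair are disjoint, so
    ordering its sides puts the rectangle above the diagonal.

    Programs are analysed over exact naturals; overflow is excluded by side conditions that reduce
    to one polynomial bound on the word size. *)

(* Number the leaves of T from left to right, so that the leaves below a node form
   an interval. A transversal pair uv then becomes the rectangle of the leaf
   intervals of u and v, and because pairs do not cross, these rectangles form a
   laminar family: two of them are disjoint or nested. Two leaves are adjacent iff
   the innermost rectangle containing them comes from B.

   A sweep over the first coordinate maintains a partition of the second one into
   segments of constant colour (the sign of the innermost active rectangle). Starting
   or ending a rectangle creates O(1) new segments, and every segment that disappears
   emits at most one box; hence at most 6p boxes in total, which partition the edges.
   A heap of breakpoints locates the segments in time O(log n).

   The leaf intervals of a complete binary tree over the n positions decompose any
   interval into O(log n) nodes. Arcs from each side of a box to its nodes give the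
   DAG; the products of the two lists of nodes give the positive tree model, whose
   pairs do not cross because their rectangles are pairwise disjoint. *)

(** * Reasoning about RAM programs *)

(** Exact arithmetic of [nat], in which all programs are analysed; [eval_evn] is the bridge to words
    modulo [2 ^ w]. *)
Definition wopn (o : wop) (x y : nat) : nat :=
  match o with
  | OAdd => x + y
  | OSub => x - y
  | OMul => x * y
  | ODiv => x %/ y
  | OMod => x %% y
  | OLt => x < y
  | OEq => x == y
  end.

Fixpoint evn (s : state) (t : expr) : nat :=
  match t with
  | ELit k => k
  | EReg r => regs s r
  | EArr a i => arrs s a (evn s i)
  | EOp o t1 t2 => wopn o (evn s t1) (evn s t2)
  end.

(** Excludes overflow, and also borrow for [OSub], where the truncated difference would disagree
    with the modular one. *)
Definition wop_ok (W : nat) (o : wop) (x y : nat) : Prop :=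
  match o with
  | OAdd => x + y < W
  | OSub => y <= x < W
  | OMul => x * y < W
  | ODiv | OMod => x < W
  | OLt | OEq => True
  end.

Fixpoint ok (W : nat) (s : state) (t : expr) : Prop :=
  match t with
  | ELit k => k < W
  | EReg _ => True
  | EArr _ i => ok W s i
  | EOp o t1 t2 =>
      [/\ ok W s t1, ok W s t2 & wop_ok W o (evn s t1) (evn s t2)]
  end.

Lemma eval_evn w s t : 1 < 2 ^ w -> ok (2 ^ w) s t -> eval w s t = evn s t.
Proof.
move=> w1; elim: t => //= [k|a i IH|o t1 IH1 t2 IH2].
- by move=> kw; rewrite modn_small.
- by move/IH->.
case=> /IH1-> /IH2->; move: (evn s t1) (evn s t2) => x y.
case: o => /= h.
- by rewrite modn_small.
- have -> : x + (2 ^ w - y) = (x - y) + 2 ^ w by lia.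
  by rewrite modnDr modn_small //; lia.
- by rewrite modn_small.
- by rewrite modn_small //; apply: leq_ltn_trans (leq_div _ _) h.
- by rewrite modn_small //; apply: leq_ltn_trans (leq_mod _ _) h.
- by rewrite modn_small //; case: (x < y); lia.
- by rewrite modn_small //; case: (x == y); lia.
Qed.

Fixpoint wregs (c : prog) : seq nat :=
  match c with
  | PSkip | PArr _ _ _ => [::]
  | PReg r _ => [:: r]
  | PSeq c1 c2 | PIf _ c1 c2 => wregs c1 ++ wregs c2
  | PWhile _ c => wregs c
  end.

Fixpoint warrs (c : prog) : seq nat :=
  match c with
  | PSkip | PReg _ _ => [::]
  | PArr a _ _ => [:: a]
  | PSeq c1 c2 | PIf _ c1 c2 => warrs c1 ++ warrs c2
  | PWhile _ c => warrs c
  end.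

(** The cells that a program may write are read off its text, so specifications only mention what
    changes. The granularity is a register or an entire array. *)
Definition frame (c : prog) (s s' : state) : Prop :=
  (forall r, r \notin wregs c -> regs s' r = regs s r) /\
  (forall a, a \notin warrs c -> arrs s' a = arrs s a).

Lemma exec_frame w c s k s' : exec w c s k s' -> frame c s s'.
Proof.
elim=> {c s k s'}.
- by [].
- move=> s r t; split=> //= r'; rewrite inE /upd => /negbTE->//.
- move=> s a i t; split=> //= a'; rewrite inE /upd => /negbTE->//.
- move=> s1 s2 s3 c1 c2 k1 k2 _ [r1 a1] _ [r2 a2].
  split=> r /=; rewrite mem_cat negb_or => /andP[n1 n2].
    by rewrite r2 // r1.
  by rewrite a2 // a1.
- move=> s s' t c1 c2 k _; case: ifP => _ [r1 a1];
    split=> r /=; rewrite mem_cat negb_or => /andP[n1 n2]; by rewrite ?r1 ?a1.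
- by [].
- move=> s1 s2 s3 t c k1 k2 _ _ [r1 a1] _ [r2 a2].
  by split=> r /= nr; rewrite ?r2 ?r1 ?a2 ?a1.
Qed.

Definition wp (w : nat) (c : prog) (s : state) (Q : nat -> state -> Prop) :=
  exists k s', exec w c s k s' /\ Q k s'.

Lemma wp_mono w c s (P Q : nat -> state -> Prop) :
  wp w c s P -> (forall k s', frame c s s' -> P k s' -> Q k s') -> wp w c s Q.
Proof.
move=> [k [s' [ex p]]] pq; exists k, s'; split=> //.
by apply: pq p; apply: exec_frame ex.
Qed.

Lemma wp_skip w s (Q : nat -> state -> Prop) : Q 1 s -> wp w PSkip s Q.
Proof. by move=> q; exists 1, s; split=> //; constructor. Qed.

Lemma wp_reg w s r t (Q : nat -> state -> Prop) :
  1 < 2 ^ w -> ok (2 ^ w) s t ->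
  Q (ecost t).+1 (set_reg s r (evn s t)) -> wp w (PReg r t) s Q.
Proof.
move=> w1 o q; exists (ecost t).+1, (set_reg s r (evn s t)); split=> //.
rewrite -(eval_evn w1 o); exact: XReg.
Qed.

Lemma wp_arr w s a i t (Q : nat -> state -> Prop) :
  1 < 2 ^ w -> ok (2 ^ w) s i -> ok (2 ^ w) s t ->
  Q (ecost i + ecost t).+1 (set_arr s a (evn s i) (evn s t)) ->
  wp w (PArr a i t) s Q.
Proof.
move=> w1 oi o q.
exists (ecost i + ecost t).+1, (set_arr s a (evn s i) (evn s t)); split=> //.
rewrite -(eval_evn w1 oi) -(eval_evn w1 o); exact: XArr.
Qed.

Lemma wp_seq w c1 c2 s (Q : nat -> state -> Prop) :
  wp w c1 s (fun k1 s1 => wp w c2 s1 (fun k2 s2 => Q (k1 + k2) s2)) ->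
  wp w (PSeq c1 c2) s Q.
Proof.
move=> [k1 [s1 [e1 [k2 [s2 [e2 q]]]]]]; exists (k1 + k2), s2.
by split=> //; apply: XSeq e1 e2.
Qed.

Lemma wp_if w t c1 c2 s (Q : nat -> state -> Prop) :
  1 < 2 ^ w -> ok (2 ^ w) s t ->
  (evn s t != 0 -> wp w c1 s (fun k s' => Q ((ecost t).+1 + k) s')) ->
  (evn s t = 0 -> wp w c2 s (fun k s' => Q ((ecost t).+1 + k) s')) ->
  wp w (PIf t c1 c2) s Q.
Proof.
move=> w1 o h1 h2.
have [k [s' [ex q]]] : wp w (if eval w s t != 0 then c1 else c2) s
    (fun k s' => Q ((ecost t).+1 + k) s').
  rewrite (eval_evn w1 o); case: eqP => /= [/h2 //|/eqP /h1 //].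
by exists ((ecost t).+1 + k), s'; split=> //; constructor.
Qed.

(* The invariant is indexed by a time budget that pays for the remaining
   iterations, so that amortised costs can be carried by ghost potentials. *)
Lemma wp_while w t c (I : nat -> state -> Prop) b s (Q : nat -> state -> Prop) :
  1 < 2 ^ w ->
  (forall b s, I b s -> ok (2 ^ w) s t) ->
  (forall b s, I b s -> evn s t != 0 ->
     wp w c s (fun k s' => exists b', I b' s' /\ k + (ecost t).+1 + b' <= b)) ->
  I b s ->
  (forall k b' s', I b' s' -> evn s' t = 0 -> k + b' <= b + (ecost t).+1 ->
     frame c s s' -> Q k s') ->
  wp w (PWhile t c) s Q.
Proof.
move=> w1 hok step i0 post.
suff [k [s' [ex [b' [i' e' le]]]]] : wp w (PWhile t c) s (fun k s' =>
    exists b', [/\ I b' s', evn s' t = 0 & k + b' <= b + (ecost t).+1]).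
  by exists k, s'; split=> //; apply: post i' e' le (exec_frame ex).
(* Each round costs at least its guard, so the budget drops strictly: induction on it yields
   termination together with the time bound. *)
move: {post} i0; have [B] := ubnP b; elim: B b s => // B IH b s bB i0.
have [e0|ne0] := eqVneq (evn s t) 0.
  exists (ecost t).+1, s; split; last by exists b; split=> //; lia.
  by apply: XWhileF; rewrite (eval_evn w1) //; apply: hok i0.
have [k1 [s1 [ex1 [b1 [i1 le1]]]]] := step _ _ i0 ne0.
have [|k2 [s2 [ex2 [b2 [i2 e2 le2]]]]] := IH b1 s1 _ i1; first by lia.
exists ((ecost t).+1 + k1 + k2), s2; split; last by exists b2; split=> //; lia.
by apply: XWhileT ex1 ex2; rewrite (eval_evn w1) //; apply: hok i0.
Qed.

Definition PFor (r b : nat) (c : prog) : prog :=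
  PWhile (EOp OLt (EReg r) (EReg b))
    (PSeq c (PReg r (EOp OAdd (EReg r) (ELit 1)))).

(** A round pays 4 for the guard and 4 for the increment, hence [K + 8]; the last 4 is the failing
    guard. The budget [bg] carries costs that are not uniform over the rounds. *)
Lemma wp_for w r b c (I : nat -> nat -> state -> Prop) K hi bg s
    (Q : nat -> state -> Prop) :
  1 < 2 ^ w -> r \notin wregs c -> b \notin wregs c -> b != r ->
  regs s b = hi -> regs s r <= hi < 2 ^ w ->
  I (regs s r) bg s ->
  (forall i bg s', regs s r <= i < hi -> regs s' r = i -> regs s' b = hi ->
     frame (PFor r b c) s s' -> I i bg s' ->
     wp w c s' (fun k s'' => exists bg',
       k + bg' <= bg + K /\ I i.+1 bg' (set_reg s'' r i.+1))) ->
  (forall k bg' s', I hi bg' s' -> regs s' r = hi -> regs s' b = hi ->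
     k + bg' <= bg + (K + 8) * (hi - regs s r) + 4 ->
     frame (PFor r b c) s s' -> Q k s') ->
  wp w (PFor r b c) s Q.
Proof.
move=> w1 nr nb br sb hiw i0 step post.
pose J B s' := exists i bg', [/\ regs s r <= i <= hi, regs s' r = i,
  regs s' b = hi, I i bg' s' & frame (PFor r b c) s s' /\
  B = bg' + (K + 8) * (hi - i)].
apply: (@wp_while _ _ _ J (bg + (K + 8) * (hi - regs s r))) => //.
- move=> B s' [i [bg' [hi1 hr hb hI [F ->]]]] ne.
  apply: wp_seq; rewrite /= hr hb in ne.
  have ih : i < hi by move: ne; case: ltnP.
  apply: wp_mono (step i bg' s' _ hr hb F hI) _; first lia.
  move=> k s'' F' [bg'' [le hI']].
  have r'' : regs s'' r = i by rewrite F'.1.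
  apply: wp_reg => //=; first by rewrite r''; split=> //; lia.
  rewrite r'' addn1.
  exists (bg'' + (K + 8) * (hi - i.+1)); split; last first.
    have -> : hi - i = (hi - i.+1).+1 by lia.
    by rewrite mulnS; lia.
  exists i.+1, bg''; split=> //; rewrite /= /upd ?eqxx //; first lia.
    by rewrite (negbTE br) F'.1.
  split=> //; split=> [r1|a] /= n1; last by rewrite F'.2 ?F.2 //; move: n1; rewrite /= cats0.
  move: (n1); rewrite /upd mem_cat inE negb_or => /andP[n2 /negbTE ->].
  by rewrite F'.1 // F.1 //=.
- exists (regs s r), bg; split=> //; lia.
move=> k B s' [i [bg' [hi1 hr hb hI [F ->]]]] /= e le _.
have ei : i = hi by move: e; rewrite hr hb; case: ltnP => //; lia.
apply: (post k bg') => //; rewrite -?ei //.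
by move: le; rewrite ei subnn muln0; lia.
Qed.

Definition at_ (f : nat -> nat) (o : nat) (y : seq nat) : Prop :=
  forall i, i < size y -> f (o + i) = nth 0 y i.

Lemma at_cat f o y1 y2 :
  at_ f o (y1 ++ y2) <-> at_ f o y1 /\ at_ f (o + size y1) y2.
Proof.
split=> [h|[h1 h2] i].
  split=> i hi.
    by rewrite h ?nth_cat ?hi // size_cat; lia.
  rewrite -addnA h ?size_cat ?ltn_add2l // nth_cat ltnNge leq_addr /=.
  by congr nth; lia.
rewrite size_cat nth_cat => hi; case: ltnP => h; first exact: h1.
by rewrite -h2; [congr f|]; lia.
Qed.

Lemma at_cons f o a y : at_ f o (a :: y) <-> f o = a /\ at_ f o.+1 y.
Proof.
rewrite -cat1s at_cat addn1; split=> -[h1 h2]; split=> //.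
  by rewrite -[o]addn0 h1.
by case=> //; rewrite addn0.
Qed.

Lemma eq_at f g o y :
  (forall i, o <= i < o + size y -> f i = g i) -> at_ f o y -> at_ g o y.
Proof. by move=> e a i hi; rewrite -e ?a //; lia. Qed.

Ltac wreg := apply: wp_reg => //=.
Ltac warr := apply: wp_arr => //=.

Notation "c1 ;; c2" := (PSeq c1 c2) (at level 90, right associativity).
Notation "r <~ t" := (PReg r t) (at level 80, no associativity).
Notation "a @{ i } <~ t" := (PArr a i t)
  (at level 80, i at level 200, no associativity).
Notation "a @[ i ]" := (EArr a i) (at level 10, i at level 200).
Notation "'R r" := (EReg r) (at level 8, r at level 2, format "''R' r").
Notation "'# k" := (ELit k) (at level 8, k at level 2, format "''#' k").
Notation "t1 +! t2" := (EOp OAdd t1 t2) (at level 50, left associativity).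
Notation "t1 -: t2" := (EOp OSub t1 t2) (at level 50, left associativity).
Notation "t1 *! t2" := (EOp OMul t1 t2) (at level 40, left associativity).
Notation "t1 /! t2" := (EOp ODiv t1 t2) (at level 40, left associativity).
Notation "t1 %! t2" := (EOp OMod t1 t2) (at level 40, left associativity).
Notation "t1 <! t2" := (EOp OLt t1 t2) (at level 70, no associativity).
Notation "t1 =! t2" := (EOp OEq t1 t2) (at level 70, no associativity).

Lemma neqF (i j : nat) : i <> j -> (i == j) = false.
Proof. by move/eqP/negbTE. Qed.

(** Number of binary digits. Unlike [trunc_log] it drops by exactly one under halving for every
    positive argument, so it can serve as the budget of a loop that halves a counter. *)
Definition lg (i : nat) : nat := if i == 0 then 0 else (trunc_log 2 i).+1.

Lemma lg_half i : 0 < i -> lg i = (lg (i %/ 2)).+1.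
Proof.
rewrite /lg divn2; case: i => [|[|i]] // _.
by rewrite trunc_log2S.
Qed.

Lemma leq_lg i j : i <= j -> lg i <= lg j.
Proof.
rewrite /lg; case: eqP => // i0; case: eqP => [->|_ h]; first lia.
by rewrite ltnS leq_trunc_log.
Qed.

Lemma lg_double i : 0 < i -> lg (2 * i) = (lg i).+1.
Proof. by move=> i0; rewrite lg_half ?mulKn //; lia. Qed.

Lemma lg_leq i : lg i <= i.
Proof.
have [b] := ubnP i; elim: b i => // b IH [|i] // le.
by rewrite lg_half //; have := IH (i.+1 %/ 2); lia.
Qed.

(** * A max-heap answering prefix queries *)

Definition heap (N : nat) (f : nat -> nat) : Prop :=
  forall i, 0 < i < N -> f i = maxn (f (2 * i)) (f (2 * i + 1)).

(** Register 21 is the number of leaves, 10 the leaf, 11 its new value; 12 climbs towards the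
    root. *)
Definition heap_update : prog :=
  22 @{'R 21 +! 'R 10} <~ 'R 11 ;;
  12 <~ ('R 21 +! 'R 10) /! '#2 ;;
  PWhile ('R 12)
    (PIf (22 @['#2 *! 'R 12] <! 22 @['#2 *! 'R 12 +! '#1])
       (22 @{'R 12} <~ 22 @['#2 *! 'R 12 +! '#1])
       (22 @{'R 12} <~ 22 @['#2 *! 'R 12]) ;;
     12 <~ 'R 12 /! '#2).

Lemma heap_updateP w s N y v :
  regs s 21 = N -> regs s 10 = y -> regs s 11 = v -> y < N ->
  2 * N + 2 < 2 ^ w -> heap N (arrs s 22) ->
  wp w heap_update s (fun k s' => [/\ k <= 30 * lg (2 * N) + 20,
    heap N (arrs s' 22) &
    forall z, z < N ->
      arrs s' 22 (N + z) = if z == y then v else arrs s 22 (N + z)]).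
Proof.
move=> hN hy hv yN W hp.
have w1 : 1 < 2 ^ w by lia.
apply: wp_seq; warr; first by rewrite hN hy; split=> //; lia.
apply: wp_seq; wreg; first by rewrite hN hy; split=> //=; [split=> //; lia|lia|lia].
rewrite /= /upd /= hN hy hv.
(* The heap equation may fail at the current node only; once [i] is 0 no exception is left. *)
pose I b s' := exists i, [/\ regs s' 12 = i, i < N, b = 30 * lg i,
  forall j, 0 < j < N -> j != i ->
    arrs s' 22 j = maxn (arrs s' 22 (2 * j)) (arrs s' 22 (2 * j + 1)) &
  forall z, z < N ->
      arrs s' 22 (N + z) = if z == y then v else arrs s 22 (N + z)].
apply: (@wp_while _ _ _ I (30 * lg ((N + y) %/ 2))) => //.
- move=> b s' [i [h12 iN -> hh lv]] /= i0; rewrite h12 in i0.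
  apply: wp_seq; apply: (@wp_mono _ _ _ (fun k s'' => k <= 20 /\
     forall j, arrs s'' 22 j = if j == i then
       maxn (arrs s' 22 (2 * i)) (arrs s' 22 (2 * i + 1)) else arrs s' 22 j)).
    apply: wp_if => //=.
      by rewrite h12; do !split=> //; lia.
      rewrite h12 => c; warr; first by rewrite h12; do !split=> //; lia.
      rewrite h12; split=> // j; rewrite /= /upd /=; case: eqP => // _.
      move: c; case: ltnP => //; lia.
    rewrite h12 => c; warr; first by rewrite h12; do !split=> //; lia.
    rewrite h12; split=> // j; rewrite /= /upd /=; case: eqP => // _.
    move: c; case: ltnP => //; lia.
  move=> k s'' F [hk e].
  have e12 : regs s'' 12 = i by rewrite F.1.
  wreg; first by rewrite e12; do !split=> //; lia.
  exists (30 * lg (i %/ 2)); split; last by rewrite (@lg_half i); lia.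
  exists (i %/ 2); rewrite /= /upd /= e12; split=> //; first lia.
    move=> j hj ji; rewrite !e.
    have n1 : 2 * j <> i by lia.
    have n2 : 2 * j + 1 <> i by lia.
    rewrite (neqF n1) (neqF n2).
    by have [->|nij] := eqVneq j i; rewrite // hh.
  by move=> z zN; rewrite e neqF ?lv //; lia.
- exists ((N + y) %/ 2); rewrite /= /upd /=; split=> //; first lia.
    move=> j hj ji; rewrite !neqF; first (by apply: hp); lia.
  by move=> z zN; rewrite eqn_add2l.
move=> k b' s' [i [h12 iN -> hh lv]] /= i0 le F; rewrite h12 in i0; split=> //.
  have : lg ((N + y) %/ 2) <= lg (2 * N) by apply: leq_lg; lia.
  lia.
move=> j hj; apply: hh => //; lia.
Qed.

(** Bottom-up maximum over the cells from 12 up to but excluding 13. An odd left end, and the last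
    cell below an odd right end, have their sibling outside the range; they are taken into register
    14 before both ends move up one level. *)
Definition heap_query : prog :=
  12 <~ 'R 21 ;; 13 <~ 'R 21 +! 'R 10 +! '#1 ;; 14 <~ '#0 ;;
  PWhile ('R 12 <! 'R 13)
    (PIf ('R 12 %! '#2)
       (PIf ('R 14 <! 22 @['R 12]) (14 <~ 22 @['R 12]) PSkip ;;
        12 <~ 'R 12 +! '#1)
       PSkip ;;
     PIf ('R 13 %! '#2)
       (13 <~ 'R 13 -: '#1 ;;
        PIf ('R 14 <! 22 @['R 13]) (14 <~ 22 @['R 13]) PSkip)
       PSkip ;;
     12 <~ 'R 12 /! '#2 ;; 13 <~ 'R 13 /! '#2).

Lemma wp_if_lt_max w s r (t : expr) :
  1 < 2 ^ w -> ok (2 ^ w) s t ->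
  wp w (PIf ('R r <! t) (r <~ t) PSkip) s
    (fun k s' => k <= 2 * ecost t + 4 /\ regs s' r = maxn (regs s r) (evn s t)).
Proof.
move=> w1 o; apply: wp_if => //=.
  move=> c; wreg; rewrite /upd eqxx; split; first lia.
  by move: c; case: ltnP => //; lia.
move=> c; apply: wp_skip; split; first lia.
by move: c; case: ltnP => //; lia.
Qed.

(** The maximum is described by its upper bounds, because these combine by conjunction along the
    loop. *)
Lemma heap_queryP w s N y :
  regs s 21 = N -> regs s 10 = y -> y < N ->
  2 * N + 2 < 2 ^ w -> heap N (arrs s 22) ->
  wp w heap_query s (fun k s' => k <= 60 * lg (2 * N) + 20 /\
    forall B, (regs s' 14 <= B <->
               forall z, z <= y -> arrs s 22 (N + z) <= B)).
Proof.
move=> hN hy yN W hp.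
have w1 : 1 < 2 ^ w by lia.
apply: wp_seq; wreg; apply: wp_seq; wreg.
  by rewrite /= /upd /= hN hy; do !split=> //; lia.
apply: wp_seq; wreg; first lia.
rewrite /= /upd /= hN hy.
pose f := arrs s 22; have hpf : heap N f by [].
pose I b s' := exists l r, [/\ regs s' 12 = l /\ regs s' 13 = r,
  0 < l /\ r <= 2 * N, b = 60 * lg r, arrs s' 22 = f &
  forall B, (regs s' 14 <= B /\ (forall i, l <= i < r -> f i <= B)) <->
    (forall z, z <= y -> f (N + z) <= B)].
apply: (@wp_while _ _ _ I (60 * lg (N + y + 1))) => //.
- move=> b s' [l [r [[h12 h13] [l0 rN] -> fE inv]]] /=.
  rewrite h12 h13 => lr'; have lr : l < r by move: lr'; case: ltnP.
  apply: wp_seq; apply: (@wp_mono _ _ _ (fun k s'' => [/\ k <= 22,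
     regs s'' 12 = l + l %% 2 & forall B, regs s'' 14 <= B <-> regs s' 14 <= B /\
       (odd l -> f l <= B)])).
    apply: wp_if => //=; first by rewrite h12; do !split=> //; lia.
      rewrite h12 => ol; apply: wp_seq.
      apply: wp_mono (wp_if_lt_max _ w1 _) _ => //= k s1 F [hk e].
      wreg; first by rewrite F.1 // h12; do !split=> //; lia.
      rewrite /= /upd /= e F.1 // h12 fE; split; [lia|lia|].
      by move=> B; rewrite geq_max; split=> [/andP[]|[->]] // ->//; lia.
    rewrite h12 => ol; apply: wp_skip; split=> //; first lia.
    by move=> B; split=> [|[]] // h; split=> //; lia.
  move=> k1 s1 F1 [hk1 e12 max1].
  have e13 : regs s1 13 = r by rewrite F1.1.
  have f1 : arrs s1 22 = f by rewrite F1.2.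
  apply: wp_seq; apply: (@wp_mono _ _ _ (fun k s'' => [/\ k <= 22,
     regs s'' 13 = r - r %% 2 & forall B, regs s'' 14 <= B <-> regs s1 14 <= B /\
       (odd r -> f (r - 1) <= B)])).
    apply: wp_if => //=; first by rewrite e13; do !split=> //; lia.
      rewrite e13 => ol; apply: wp_seq; wreg.
        by rewrite e13; do !split=> //; lia.
      rewrite e13; apply: wp_mono (wp_if_lt_max _ w1 _) _ => //= k s2 F [hk e].
      rewrite e F.1 //= /upd /= f1; split; [lia|lia|].
      by move=> B; rewrite geq_max; split=> [/andP[]|[->]] // ->//; lia.
    rewrite e13 => ol; apply: wp_skip; split=> //; first lia.
    by move=> B; split=> [|[]] // h; split=> //; lia.
  move=> k2 s2 F2 [hk2 e13' max2].
  have e12' : regs s2 12 = l + l %% 2 by rewrite F2.1.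
  apply: wp_seq; wreg; first by rewrite e12'; do !split=> //; lia.
  wreg; first by rewrite /= /upd /= e13'; do !split=> //; lia.
  rewrite /= /upd /= e12' e13'.
  exists (60 * lg (r %/ 2)); split; last by rewrite (@lg_half r); lia.
  exists ((l + l %% 2) %/ 2), ((r - r %% 2) %/ 2); split=> //=; [lia| | |].
  - by congr (60 * lg _); lia.
  - by rewrite F2.2 // F1.2.
  move=> B; rewrite -inv max2 max1; split.
    case=> -[[m1 m2] m3] h; split=> // i hi.
    (* An index of the old range is one of the two cells just taken, or its parent lies in the new
       range and dominates it by the heap equation. *)
    have [[-> /m2]|[[-> /m3]|hi2]] : (i = l /\ odd l) \/
      (i = r - 1 /\ odd r) \/ ((l + l %% 2) %/ 2 <= i %/ 2 < (r - r %% 2) %/ 2).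
      lia.
    - by [].
    - by [].
    have := h _ hi2; rewrite hpf; last lia.
    rewrite geq_max => /andP[].
    have [ei|ei] : 2 * (i %/ 2) = i \/ 2 * (i %/ 2) + 1 = i by lia.
      by rewrite ei.
    by rewrite ei.
  case=> m1 h; split.
    by split; [split=> //|] => o; apply: h; lia.
  by move=> i hi; rewrite hpf ?geq_max; [rewrite !h //; lia|lia].
- exists N, (N + y + 1); split=> //; [lia|].
  move=> B; split=> [[_ h] z zy|h]; first by apply: h; lia.
  split=> // i hi; have -> : i = N + (i - N) by lia.
  by apply: h; lia.
move=> k b' s' [l [r [[h12 h13] [l0 rN] -> fE inv]]] /=.
rewrite h12 h13 => lr' le F; have lr : r <= l by move: lr'; case: ltnP.
split.
  have : lg (N + y + 1) <= lg (2 * N) by apply: leq_lg; lia.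
  lia.
move=> B; rewrite -/f -inv; split=> [h|[]//]; split=> // i; lia.
Qed.

(** * Segments of the sweep line *)

Definition box : Type := ((nat * nat) * (nat * nat))%type.

Definition inbox (b : box) (x y : nat) : bool :=
  (b.1.1 <= x < b.1.2) && (b.2.1 <= y < b.2.2).

Definition wbox (b : box) : seq nat := [:: b.1.1; b.1.2; b.2.1; b.2.2].

Definition cover_count (bs : seq box) (x y : nat) : nat :=
  count (fun b => inbox b x y) bs.

(** Over the range from 0 to [n] this is the number of segments: each is counted at its start, and
    the sentinel breakpoint [n] falls outside the half-open range. *)
Definition cn (bp : pred nat) (a b : nat) : nat := \sum_(a <= z < b) bp z.

Lemma cn_cat bp a b c : a <= b <= c -> cn bp a c = cn bp a b + cn bp b c.
Proof. by case/andP=> ab bc; rewrite /cn (big_cat_nat ab bc). Qed.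

Lemma eq_cn (bp bp' : pred nat) a b :
  (forall z, a <= z < b -> bp z = bp' z) -> cn bp a b = cn bp' a b.
Proof. by move=> e; apply: eq_big_nat => z hz; rewrite e. Qed.

Lemma leq_cn (bp bp' : pred nat) a b :
  (forall z, a <= z < b -> bp z -> bp' z) -> cn bp a b <= cn bp' a b.
Proof.
move=> e; rewrite /cn !big_seq; apply: leq_sum => z; rewrite mem_index_iota => /e.
by case: (bp z) => // ->.
Qed.

Lemma cn1 (bp : pred nat) s e : s < e -> bp s -> (forall z, s < z < e -> ~~ bp z) ->
  cn bp s e = 1.
Proof.
move=> se bs h; rewrite /cn big_ltn // bs big_nat big1 // => z hz.
by rewrite (negbTE (h z _)) //; lia.
Qed.

Lemma cn_add1 (bp : pred nat) y a b : cn (fun z => bp z || (z == y)) a b <= cn bp a b + 1.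
Proof.
have [ab|ba] := leqP a b; last first.
  by rewrite /cn !big_geq //; lia.
have le : cn (fun z => bp z || (z == y)) a b <= cn bp a b + cn (pred1 y) a b.
  rewrite /cn -big_split /=; apply: leq_sum => z _.
  by case: (bp z); case: (z == y).
apply: leq_trans le _; rewrite leq_add2l.
have [hy|hy] := boolP (a <= y < b); last first.
  rewrite /cn big_nat big1 // => z hz /=; case: eqP => // e; lia.
rewrite (@cn_cat _ a y) ?(@cn_cat _ y y.+1 b); try lia.
have z0 c d : (d <= y) || (y < c) -> cn (pred1 y) c d = 0.
  by move=> h; rewrite /cn big_nat big1 // => z hz /=; case: eqP => // e; lia.
rewrite (z0 a y) ?(z0 y.+1 b); try lia.
by rewrite cn1 //= ?eqxx // => z; lia.
Qed.

(* Arrays: 22 is the heap of breakpoints, 23 maps the start of a segment to its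
   end, 24 to its colour and 25 to the abscissa since which it has it. *)
Definition seg_ok (n : nat) (bp : pred nat) (cf sf : nat -> nat) (s : state) :=
  [/\ regs s 21 = n.+1, heap n.+1 (arrs s 22),
      forall z, z <= n -> arrs s 22 (n.+1 + z) = if bp z then z else 0,
      bp 0 /\ bp n &
      forall a, a < n -> bp a ->
        [/\ a < arrs s 23 a <= n, bp (arrs s 23 a),
            forall z, a < z < arrs s 23 a -> ~~ bp z &
            forall z, a <= z < arrs s 23 a ->
              cf z = arrs s 24 a /\ sf z = arrs s 25 a]].

(** The leaf of a breakpoint holds its own index, so the prefix maximum in register 14 is the start
    of the segment that contains register 10. The record of that segment is duplicated; the colour
    and date of each point stay the same. *)
Definition split_seg : prog :=
  heap_query ;;
  PIf ('R 14 <! 'R 10)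
    (23 @{'R 10} <~ 23 @['R 14] ;; 24 @{'R 10} <~ 24 @['R 14] ;;
     25 @{'R 10} <~ 25 @['R 14] ;; 23 @{'R 14} <~ 'R 10 ;;
     11 <~ 'R 10 ;; heap_update)
    PSkip.

Lemma split_segP w n bp cf sf s y :
  seg_ok n bp cf sf s -> regs s 10 = y -> y <= n -> 2 * n + 10 < 2 ^ w ->
  wp w split_seg s (fun k s' => k <= 90 * lg (2 * n.+1) + 90 /\
    seg_ok n (fun z => bp z || (z == y)) cf sf s').
Proof.
move=> [h21 hp lv [b0 bn] sg] h10 yn W.
have w1 : 1 < 2 ^ w by lia.
apply: wp_seq; apply: wp_mono (heap_queryP h21 h10 _ _ hp) _; try lia.
move=> k1 s1 F1 [hk1 mx].
set a := regs s1 14 in mx *.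
have mx' B : a <= B <-> (forall z, z <= y -> bp z -> z <= B).
  rewrite mx; split=> h z zy.
    by move=> bz; have := h z zy; rewrite lv ?bz //; lia.
  by rewrite lv; [case: ifP => // /(h z zy)|lia].
(* If the maximum were not a breakpoint, one less would still bound all breakpoints up to [y]. The
   default 0 stored by the other leaves is itself a breakpoint. *)
have ba : bp a.
  apply/negPn/negP => nb.
  have [a0|a0] := posnP a; first by move: nb; rewrite a0 b0.
  have : a <= a - 1.
    apply/mx' => z zy bz; have za := (mx' a).1 (leqnn a) z zy bz.
    have nz : z <> a by move=> e; rewrite -e bz in nb.
    lia.
  lia.
have ay : a <= y by apply/mx' => z.
have gap z : a < z <= y -> ~~ bp z.
  move=> /andP[az zy]; apply/negP => bz.
  by have := (mx' a).1 (leqnn a) z zy bz; lia.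
have e10 : regs s1 10 = y by rewrite F1.1.
have A1 b : b \notin warrs heap_query -> arrs s1 b = arrs s b by move=> ?; rewrite F1.2.
have R1 r : r \notin wregs heap_query -> regs s1 r = regs s r by move=> ?; rewrite F1.1.
apply: wp_if => //=; last first.
  rewrite -/a e10 => c; have ea : a = y by move: c; case: ltnP => //; lia.
  apply: wp_skip; split; first lia.
  have eb z : bp z || (z == y) = bp z.
    by case: eqP => [->|_]; rewrite ?orbF // -ea ba.
  split; rewrite ?R1 ?A1 //.
  - by move=> z zn; rewrite lv // eb.
  - by rewrite !eb.
  move=> i lin; rewrite eb => /(sg i lin)[h1 h2 h3 h4]; split=> //.
    by rewrite eb.
  by move=> z /h3; rewrite eb.
rewrite -/a e10 => c; have lt : a < y by move: c; case: ltnP.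
do 4 (apply: wp_seq; warr).
apply: wp_seq; wreg; rewrite /= /upd /= -/a e10 !A1 //.
have [sg1 sg2 sg3 sg4] := sg a (leq_trans lt yn) ba.
(* The end of the segment is a breakpoint, and there is none after [a] up to [y]. *)
have ye : y < arrs s 23 a.
  rewrite ltnNge; apply/negP => le.
  have : ~~ bp (arrs s 23 a) by apply: gap; lia.
  by rewrite sg2.
set s2 := set_reg _ _ _.
apply: wp_mono (heap_updateP (N := n.+1) (y := y) (v := y) _ _ _ _ _ _) _;
  rewrite ?/s2 /= /upd /= ?R1 ?A1 //; try lia.
move=> k3 s3 F3 [hk3 hp3 lv3]; split; first lia.
have e23 : arrs s3 23 = arrs s2 23 by rewrite F3.2.
have e24 : arrs s3 24 = arrs s2 24 by rewrite F3.2.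
have e25 : arrs s3 25 = arrs s2 25 by rewrite F3.2.
split=> //.
- by rewrite F3.1 //= /upd /= R1.
- move=> z zn; rewrite lv3 //.
  by have [->|_] := eqVneq z y; rewrite ?orbT ?orbF // lv.
- by rewrite b0 bn.
have a0y : (a == y) = false by apply: neqF; lia.
move=> i lin; rewrite e23 e24 e25 /s2 /= /upd /= !A1 //.
have [-> _|nia] := eqVneq i a.
  rewrite a0y ?eqxx orbT; split=> //; first lia.
    by move=> z hz; rewrite negb_or gap ?andTb; [apply/eqP; lia|lia].
  by move=> z hz; apply: sg4; lia.
have [-> _|niy] := eqVneq i y.
  split=> //.
  - by rewrite ye; move: sg1; lia.
  - by rewrite sg2.
  - by move=> z hz; rewrite negb_or sg3 ?andTb; [apply/eqP; lia|lia].
  by move=> z hz; apply: sg4; lia.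
rewrite orbF => bi; have [h1 h2 h3 h4] := sg i lin bi; split=> //.
  by rewrite h2.
move=> z hz; rewrite negb_or h3 //=; apply/eqP => ezy; subst z.
have [ai|ai] := ltnP a i.
  have : ~~ bp i by apply: gap; lia.
  by rewrite bi.
have : ~~ bp a by apply: h3; lia.
by rewrite ba.
Qed.

Definition split_both : prog :=
  10 <~ 'R 15 ;; split_seg ;; 10 <~ 'R 16 ;; split_seg.

Lemma split_bothP w n bp cf sf s c d :
  seg_ok n bp cf sf s -> regs s 15 = c -> regs s 16 = d -> c < d <= n ->
  2 * n + 10 < 2 ^ w ->
  wp w split_both s (fun k s' => k <= 180 * lg (2 * n.+1) + 190 /\
    exists bp', [/\ seg_ok n bp' cf sf s', bp' c, bp' d &
                    cn bp' 0 n <= cn bp 0 n + 2]).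
Proof.
move=> sg h15 h16 cd W; have w1 : 1 < 2 ^ w by lia.
apply: wp_seq; wreg; rewrite h15.
apply: wp_seq; apply: wp_mono (@split_segP _ n bp cf sf _ c _ _ _ _) _ => //.
  lia.
move=> k1 s1 F1 [hk1 sg1].
apply: wp_seq; wreg; rewrite F1.1 //= /upd /= h16.
apply: wp_mono (@split_segP _ n (fun z => bp z || (z == c)) cf sf _ d _ _ _ _) _ => //.
  lia.
move=> k2 s2 F2 [hk2 sg2]; split; first lia.
exists (fun z => bp z || (z == c) || (z == d)); split=> //; rewrite ?eqxx ?orbT //.
have h1 := cn_add1 (fun z => bp z || (z == c)) d 0 n.
have h2 := cn_add1 bp c 0 n; lia.
Qed.

(* Array 27 receives the finished boxes, register 20 counts them. *)
Definition emit_box : prog :=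
  27 @{'#4 *! 'R 20} <~ 25 @['R 19] ;;
  27 @{'#4 *! 'R 20 +! '#1} <~ 'R 18 ;;
  27 @{'#4 *! 'R 20 +! '#2} <~ 'R 19 ;;
  27 @{'#4 *! 'R 20 +! '#3} <~ 23 @['R 19] ;;
  20 <~ 'R 20 +! '#1.

(** Gives the interval from 15 to 16 the colour 17 as of abscissa 18. A segment met on the way emits
    a box only if it has colour 1 and has lasted over a positive width. All of them are merged into
    one by clearing every breakpoint but the first in the heap. *)
Definition paint_seg : prog :=
  19 <~ 'R 15 ;;
  PWhile ('R 19 <! 'R 16)
    (PIf ((24 @['R 19] =! '#1) *! (25 @['R 19] <! 'R 18)) emit_box PSkip ;;
     PIf ('R 15 <! 'R 19) (10 <~ 'R 19 ;; 11 <~ '#0 ;; heap_update) PSkip ;;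
     19 <~ 23 @['R 19]) ;;
  23 @{'R 15} <~ 'R 16 ;; 24 @{'R 15} <~ 'R 17 ;; 25 @{'R 15} <~ 'R 18.

Definition outb (bs : seq box) (s : state) : Prop :=
  regs s 20 = size bs /\ at_ (arrs s 27) 0 (flatten (map wbox bs)).

Lemma size_wboxes bs : size (flatten (map wbox bs)) = 4 * size bs.
Proof. by elim: bs => //= b bs ->; lia. Qed.

Lemma emit_boxP w s bs :
  outb bs s -> 4 * size bs + 10 < 2 ^ w ->
  wp w emit_box s (fun k s' => k <= 60 /\
    outb (rcons bs ((arrs s 25 (regs s 19), regs s 18),
                    (regs s 19, arrs s 23 (regs s 19)))) s').
Proof.
move=> [h20 hat] W; have w1 : 1 < 2 ^ w by lia.
apply: wp_seq; warr; first by rewrite h20; do !split=> //; lia.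
apply: wp_seq; warr; first by rewrite h20; do !split=> //; lia.
apply: wp_seq; warr; first by rewrite h20; do !split=> //; lia.
apply: wp_seq; warr; first by rewrite h20; do !split=> //; lia.
wreg; first by rewrite h20; do !split=> //; lia.
split=> //; rewrite /outb /= /upd /= size_rcons h20 addn1; split=> //.
rewrite map_rcons flatten_rcons at_cat size_wboxes add0n; split.
  move=> i hi; have := hat i hi; rewrite size_wboxes in hi.
  by rewrite /upd !neqF //; lia.
rewrite /wbox !at_cons; split; [|split; [|split; [|split=> //]]];
  repeat (case: eqP => //; try lia).
Qed.

(** If [j] segments are visited, at most [j] boxes come out while [j - 1] segments vanish, so the
    two counts together grow by at most one. Vanishing segments also pay for the time. The emitted
    boxes account for exactly the points left of [x] that were pending in the repainted interval. *)
Lemma paint_segP w n bp cf sf s c d x col bs :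
  seg_ok n bp cf sf s -> outb bs s ->
  regs s 15 = c -> regs s 16 = d -> regs s 17 = col -> regs s 18 = x ->
  c < d <= n -> bp c -> bp d ->
  2 * n + 4 * (size bs + n) + 20 < 2 ^ w ->
  wp w paint_seg s (fun k s' => exists bp' bs',
    [/\ seg_ok n bp' (fun z => if c <= z < d then col else cf z)
                     (fun z => if c <= z < d then x else sf z) s',
        outb (bs ++ bs') s',
        forall b, b \in bs' -> [&& b.1.1 < b.1.2 <= x & b.2.1 < b.2.2 <= n],
        forall x' y', x' < x -> y' < n -> cover_count bs' x' y' =
          ((c <= y' < d) && ((sf y' <= x') && (cf y' == 1))) &
        size bs' + cn bp' 0 n <= cn bp 0 n + 1 /\
        k + (30 * lg (2 * n.+1) + 150) * cn bp' 0 n <=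
          (30 * lg (2 * n.+1) + 150) * (cn bp 0 n + 1) + 30]).
Proof.
move=> [h21 hp lv [b0 bn] sg] ob h15 h16 h17 h18 cd bc bd W.
have w1 : 1 < 2 ^ w by lia.
set K := 30 * _ + 150.
apply: wp_seq; wreg; rewrite h15.
(* During the walk only the heap loses breakpoints; arrays 23 to 25 still describe the old segments
   and are rewritten at [c] afterwards. The budget pays for the segments still ahead. *)
pose I b s' := exists e bs',
  [/\ [/\ regs s' 19 = e, c <= e <= d, bp e & b = K * cn bp e d],
      [/\ regs s' 15 = c /\ regs s' 16 = d, regs s' 17 = col /\ regs s' 18 = x,
          regs s' 21 = n.+1, heap n.+1 (arrs s' 22) &
          forall z, z <= n -> arrs s' 22 (n.+1 + z) =
             if bp z && ~~ (c < z < e) then z else 0],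
      [/\ arrs s' 23 = arrs s 23, arrs s' 24 = arrs s 24 &
          arrs s' 25 = arrs s 25],
      outb (bs ++ bs') s' /\ size bs' <= cn bp c e &
      (forall b, b \in bs' -> [&& b.1.1 < b.1.2 <= x & b.2.1 < b.2.2 <= n]) /\
      forall x' y', x' < x -> y' < n -> cover_count bs' x' y' =
          ((c <= y' < e) && ((sf y' <= x') && (cf y' == 1)))].
have cn_le e : c <= e <= d -> cn bp c e <= n.
  move=> he; apply: leq_trans (_ : \sum_(c <= z < e) 1 <= n).
    by apply: leq_sum => z _; case: (bp z).
  by rewrite sum_nat_const_nat; lia.
apply: wp_seq; apply: (@wp_while _ _ _ I (K * cn bp c d)) => //.
- move=> b s' [e [bs' [[h19 ce be ->] [[e15 e16] [e17 e18] e21 hp' lv'] [a23 a24 a25]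
    [ob' sz] [wf cv]]]] /=; rewrite h19 e16 => lt'.
  have lt : e < d by move: lt'; case: ltnP.
  have en : e < n by lia.
  have [sg1 sg2 sg3 sg4] := sg e en be; set f := arrs s 23 e in sg1 sg2 sg3 sg4.
  (* Being a breakpoint, [d] cannot be jumped over, so the walk stops exactly there. *)
  have fd : f <= d.
    rewrite leqNgt; apply/negP => h; have : ~~ bp d by apply: sg3; lia.
    by rewrite bd.
  have cnf : cn bp e f = 1 by apply: cn1 => //; lia.
  have szb : size bs' <= n by apply: leq_trans sz (cn_le _ _); lia.
  apply: wp_seq; apply: (@wp_mono _ _ _ (fun k s1 => k <= 80 /\ exists bs1,
    [/\ outb (bs ++ bs1) s1 /\ size bs1 <= cn bp c f,
      (forall b, b \in bs1 -> [&& b.1.1 < b.1.2 <= x & b.2.1 < b.2.2 <= n]) &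
      forall x' y', x' < x -> y' < n -> cover_count bs1 x' y' =
          ((c <= y' < f) && ((sf y' <= x') && (cf y' == 1)))])).
    apply: wp_if => //=.
    + by do !split=> //; lia.
    + rewrite h19 a24 a25 e18 => cond.
      have [c1 sx] : arrs s 24 e = 1 /\ arrs s 25 e < x.
        by move: cond; rewrite mulnb eqb0 negbK => /andP[/eqP].
      apply: wp_mono (emit_boxP ob' _) _.
        by rewrite size_cat; move: szb W; lia.
      move=> k s1 F1 [hk ob1]; split; first lia.
      rewrite h19 a23 a25 e18 -/f in ob1.
      exists (rcons bs' ((arrs s 25 e, x), (e, f))); split.
      * by rewrite -rcons_cat size_rcons (@cn_cat _ c e f) ?cnf; [split=> //; lia|lia].
      * move=> b1; rewrite mem_rcons inE => /predU1P[->|/wf //] /=; lia.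
      move=> x' y' hx hy; rewrite /cover_count -cats1 count_cat -/(cover_count _ _ _) cv //=.
      rewrite addn0 /inbox /=.
      case: (ltnP y' e) => ye.
        have yf : y' < f by lia.
        by rewrite yf andbF addn0.
      have cy : c <= y' by lia.
      rewrite andbF /= add0n hx andbT cy.
      rewrite /=; case: (ltnP y' f) => yf; last by rewrite andbF.
      have [|-> ->] := sg4 y'; first lia.
      by rewrite c1 eqxx !andbT.
    rewrite h19 a24 a25 e18 => cond.
    have cond' : ~~ ((arrs s 24 e == 1) && (arrs s 25 e < x)).
      by move/eqP: cond; rewrite mulnb eqb0.
    apply: wp_skip; split; first lia.
    exists bs'; split=> //; first by rewrite (@cn_cat _ c e f); [split=> //; lia|lia].
    move=> x' y' hx hy; rewrite cv //; congr (nat_of_bool _).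
    case: (ltnP y' e) => ye.
      have yf : y' < f by lia.
      by rewrite yf.
    rewrite andbF /=; case: (ltnP y' f) => yf; last by rewrite andbF.
    have [|-> ->] := sg4 y'; first lia.
    apply/esym/negbTE; apply: contra cond' => /andP[_ /andP[h ->]] /=; lia.
  move=> k1 s1 F1 [hk1 [bs1 [[ob1 sz1] wf1 cv1]]].
  have G1 r : r != 20 -> regs s1 r = regs s' r.
    by move=> h; rewrite F1.1 // inE.
  have A1 a : a != 27 -> arrs s1 a = arrs s' a.
    by move=> h; rewrite F1.2 // !inE !(negbTE h).
  apply: wp_seq; apply: (@wp_mono _ _ _ (fun k s2 => [/\
      k <= 30 * lg (2 * n.+1) + 40, heap n.+1 (arrs s2 22) &
      forall z, z <= n -> arrs s2 22 (n.+1 + z) =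
             if bp z && ~~ (c < z < f) then z else 0])).
    apply: wp_if => //=.
    + rewrite !G1 // e15 h19 => clt'; have clt : c < e by move: clt'; case: ltnP.
      apply: wp_seq; wreg; apply: wp_seq; wreg; first lia.
      apply: wp_mono (heap_updateP (N := n.+1) (y := e) (v := 0) _ _ _ _ _ _) _;
        rewrite /= /upd /= ?G1 ?A1 //; try lia.
      move=> k2 s2 F2 [hk2 hp2 lv2]; split=> //; first lia.
      move=> z zn; rewrite lv2 //.
      have [->|nz] := eqVneq z e.
        by rewrite ifF //; apply/negbTE; rewrite negb_and negbK; apply/orP; right; lia.
      rewrite /= ?A1 // lv' //; case bz : (bp z) => //=.
      have -> : c < z < f = (c < z < e); last by [].
      have [h|h] := boolP (e < z < f); last by lia.
      by have := sg3 z h; rewrite bz.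
    rewrite !G1 // e15 h19 => clt'; have ec : e = c by move: clt'; case: ltnP => //; lia.
    apply: wp_skip; rewrite A1 //; split=> //; first lia.
    move=> z zn; rewrite lv' //; case bz : (bp z) => //=.
    have -> : c < z < f = (c < z < e); last by [].
    have [h|h] := boolP (e < z < f); last by lia.
    by have := sg3 z h; rewrite bz.
  move=> k2 s2 F2 [hk2 hp2 lv2].
  have G2 r : r \notin [:: 10; 11; 12; 20] -> regs s2 r = regs s' r.
    rewrite !inE !negb_or => /and4P[n1 n2 n3 n4].
    by rewrite F2.1 ?G1 // !inE !negb_or n1 n2 n3.
  have A2 a : a \notin [:: 22; 27] -> arrs s2 a = arrs s' a.
    rewrite !inE !negb_or => /andP[n1 n2].
    by rewrite F2.2 ?A1 // !inE !negb_or !n1.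
  wreg; exists (K * cn bp f d); split; last first.
    by rewrite (@cn_cat _ e f d) ?cnf; lia.
  have E23 : arrs s2 23 = arrs s 23 by rewrite A2.
  have E19 : regs s2 19 = e by rewrite G2.
  exists f, bs1; rewrite /outb /= /upd /= E23 E19 -/f; split.
  + by split=> //; lia.
  + by rewrite !G2.
  + by rewrite !A2.
  + by rewrite F2.1 // F2.2.
  + by [].
- exists c, [::]; rewrite /outb /= /upd /= cats0; split=> //.
  + by split=> //; lia.
  + split=> //.
    move=> z zn; rewrite lv //; have -> : (c < z < c) = false by lia.
    by rewrite andbT.
  split=> // x' y' hx hy; rewrite (_ : c <= y' < c = false) //; lia.
move=> k b s' [e [bs' [[h19 ce be ->] [[e15 e16] [e17 e18] e21 hp' lv'] [a23 a24 a25]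
    [ob' sz] [wf cv]]]] /=; rewrite h19 e16 => lt' le F.
have ed : e = d by move: lt'; case: ltnP => //; lia.
rewrite ed in lv' cv sz le; do 2 (apply: wp_seq; warr); warr.
rewrite /= /upd /= !e15 !e16 !e17 !e18.
pose bp' z := bp z && ~~ (c < z < d).
have cnE : cn bp 0 n = cn bp 0 c + cn bp c d + cn bp d n.
  by rewrite (@cn_cat _ 0 c n) ?(@cn_cat _ c d n); lia.
have cnE' : cn bp' 0 n = cn bp 0 c + 1 + cn bp d n.
  rewrite (@cn_cat _ 0 c n) ?(@cn_cat _ c d n); [|lia|lia].
  have -> : cn bp' c d = 1.
    apply: cn1; [lia|by rewrite /bp' bc ltnn|].
    by move=> z hz; rewrite /bp' hz andbF.
  have out z : (c < z < d = false) -> bp' z = bp z.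
    by rewrite /bp' => ->; rewrite andbT.
  by rewrite addnA; congr (_ + _ + _); apply: eq_cn => z hz; apply: out; lia.
exists bp', bs'; split=> //.
- split; rewrite /= /upd /= ?a23 ?a24 ?a25 //.
  + by rewrite /bp' b0 bn; lia.
  move=> a an; rewrite /bp' => /andP[ba hc].
  have [->|na] := eqVneq a c.
    rewrite bd /=; split; [lia|lia| |].
      by move=> z hz; rewrite hz andbF.
    by move=> z ->.
  have [sg1 sg2 sg3 sg4] := sg a an ba; split=> //.
  + rewrite sg2 /=; apply/negP => h.
    have [ac|ac] : a < c \/ d <= a by lia.
      have : ~~ bp c by apply: sg3; lia.
      by rewrite bc.
    lia.
  + by move=> z /sg3 /negbTE->.
  move=> z hz; suff -> : c <= z < d = false by apply: sg4.
  apply/negbTE/negP => hh.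
  have [ac|ac] : a < c \/ d <= a by lia.
    have : ~~ bp c by apply: sg3; lia.
    by rewrite bc.
  lia.
rewrite cnE cnE'; split; first lia.
rewrite /cn big_geq // muln0 in le.
move: le; rewrite -/(cn _ _ _) !mulnDr; lia.
Qed.

(** * Sweeping over a laminar family of rectangles *)

(** Linked list with successor array [nx]. The end marker is 0, which is why rectangles are numbered
    from 1. *)
Fixpoint chain (nx : nat -> nat) (h : nat) (l : seq nat) : Prop :=
  if l is i :: l' then [/\ h = i, i != 0 & chain nx (nx i) l'] else h = 0.

Lemma chain_upd nx h l i v : i \notin l -> chain nx h l -> chain (upd nx i v) h l.
Proof.
elim: l h => //= j l IH h; rewrite inE negb_or => /andP[ij il] [-> j0 c].
by split=> //; rewrite /upd eq_sym (negbTE ij); apply: IH.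
Qed.

Lemma cn_rem (P : pred nat) i a b : P i -> a <= i < b ->
  cn (fun j => P j && (j != i)) a b + 1 = cn P a b.
Proof.
move=> Pi ib; rewrite !(@cn_cat _ a i b) ?(@cn_cat _ i i.+1 b); try lia.
rewrite /cn !big_nat1 Pi eqxx /=.
have e c d : (d <= i) || (i < c) ->
    \sum_(c <= z < d) (P z && (z != i) : nat) = \sum_(c <= z < d) P z.
  by move=> h; apply: eq_big_nat => z hz; rewrite (_ : z != i) ?andbT //; lia.
by rewrite !e; lia.
Qed.

(** Arrays 13 and 14 bound the second side of a rectangle, 12 is the right end of the first one, 21
    the colour saved from underneath. The end lists have heads in 19 and links in 20, the start
    lists in 17 and 18. Register 6 is the current rectangle, 18 the abscissa. *)
Definition end_body : prog :=
  15 <~ 13 @['R 6] ;; 16 <~ 14 @['R 6] ;; 17 <~ 21 @['R 6] ;;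
  split_both ;; paint_seg ;; 6 <~ 20 @['R 6].

(** Register 3 is the number of anti-edges; these come first in the numbering, so the comparison
    with the index is the colour. One cell of array 24 suffices to save the colour underneath, which
    is constant on the interval. *)
Definition start_body : prog :=
  15 <~ 13 @['R 6] ;; 16 <~ 14 @['R 6] ;; 17 <~ ('R 3 <! 'R 6) ;;
  split_both ;; 21 @{'R 6} <~ 24 @['R 15] ;; paint_seg ;;
  20 @{'R 6} <~ 19 @[12 @['R 6]] ;; 19 @{12 @['R 6]} <~ 'R 6 ;;
  6 <~ 18 @['R 6].

(** Sides are half-open, so what ends at an abscissa must be gone before anything starts there. *)
Definition sweep_body : prog :=
  6 <~ 19 @['R 18] ;; PWhile ('R 6) end_body ;;
  6 <~ 17 @['R 18] ;; PWhile ('R 6) start_body.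

(** Register 21 holds [n + 1]: abscissa [n] is visited too, in order to close the rectangles that
    reach the right border. *)
Definition sweep : prog := 18 <~ '#0 ;; PFor 18 21 sweep_body.

Section Sweep.

Variables (w n p a : nat) (XL XR YL YR : nat -> nat) (lS : nat -> seq nat).
Variable H : nat -> nat -> bool.

Let isr i := 0 < i <= p.
Let sg i : nat := a < i.
Let inY i y := YL i <= y < YR i.
Let sub i j := [&& XL j <= XL i, XR i <= XR j, YL j <= YL i & YR i <= YR j].
Let ins i j := sub i j && (i != j).

(** Colour of the innermost active rectangle over [y], with 0 for none. As a relation, it leaves the
    existence of a least rectangle to the invariant of the sweep. *)
Definition top (act : pred nat) (y c : nat) : Prop :=
  (exists i, [/\ act i, inY i y, sg i = c &
                 forall j, act j -> inY j y -> sub i j]) \/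
  (c = 0 /\ forall i, act i -> ~~ inY i y).

(** The colour that must reappear when [i] ends. It refers to all rectangles rather than to the
    active ones, so it is independent of time. *)
Definition above (i c : nat) : Prop :=
  (exists j, [/\ isr j, ins i j, sg j = c &
                 forall j', isr j' -> ins i j' -> sub j j']) \/
  (c = 0 /\ forall j, isr j -> ~~ ins i j).

Hypothesis xP : forall i, isr i -> XL i < XR i <= n.
Hypothesis yP : forall i, isr i -> YL i < YR i <= n.
Hypothesis laminar : forall i j x y, isr i -> isr j ->
  XL i <= x < XR i -> inY i y -> XL j <= x < XR j -> inY j y ->
  sub i j || sub j i.
Hypothesis lSP : forall x i, (i \in lS x) = isr i && (XL i == x).
Hypothesis lS_uniq : forall x, uniq (lS x).
Hypothesis lS_sorted : forall x, pairwise (fun i j => ~~ ins i j) (lS x).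
Hypothesis HP : forall x y c, x < n -> y < n ->
  top (fun i => isr i && (XL i <= x < XR i)) y c -> (c == 1) = H x y.
Hypothesis n_gt0 : 0 < n.
Hypothesis wP : 26 * n + 24 * p + 50 < 2 ^ w.

Lemma top_ext act act' y c : act =1 act' -> top act y c -> top act' y c.
Proof.
move=> e [[i [ai yi si h]]|[-> h]]; [left|right].
  by exists i; split; rewrite -?e // => j; rewrite -e; apply: h.
by split=> // i; rewrite -e; apply: h.
Qed.

(** * Effect of one start or end on the innermost colours *)

Section Step.

Variables (act : pred nat) (i x : nat).
Hypothesis act_isr : forall j, act j -> isr j.
Hypothesis ri : isr i.
Hypothesis act_x : forall j, act j -> XL j <= x < XR j.
Hypothesis i_x : XL i <= x < XR i.
Hypothesis outer : forall j, isr j -> ins i j -> act j.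
Hypothesis inner : forall j, act j -> ~~ ins j i.

(** Both rectangles contain the point [(x, y)], so they are nested by laminarity, and [inner] leaves
    only one direction. *)
Let act_above y j : act j -> j != i -> inY i y -> inY j y -> ins i j.
Proof.
move=> aj ji yi yj; have rj := act_isr aj.
have := laminar ri rj i_x yi (act_x aj) yj.
have := inner aj; rewrite /ins ji andbT eq_sym ji andbT => /negbTE->.
by rewrite orbF.
Qed.

Let ins_inY y j : ins i j -> inY i y -> inY j y.
Proof. by case/andP => /and4P[_ _ h1 h2] _; rewrite /inY; lia. Qed.

(** The active rectangles over any point of the interval of [i] are precisely those that contain
    [i]; hence the colour read at a single [y] is valid for the entire interval. *)
Lemma top_above y c : ~~ act i -> inY i y -> top act y c -> above i c.
Proof.
move=> ni yi [[j [aj yj sj h]]|[-> h]]; [left|right].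
  exists j; split=> //; first exact: act_isr.
    by apply: act_above yi yj => //; apply: contraNneq ni => <-.
  by move=> j' rj' ij'; apply: h; [apply: outer|apply: ins_inY yi].
split=> // j rj; apply/negP => ij; have := h j (outer rj ij).
by rewrite (ins_inY ij yi).
Qed.

Lemma top_add y c : ~~ act i -> top act y c ->
  top (fun j => act j || (j == i)) y (if inY i y then sg i else c).
Proof.
move=> ni t; case: ifP => yi.
  left; exists i; split=> //; rewrite ?eqxx ?orbT // => j.
  have [-> _ _|ji] := eqVneq j i; first by rewrite /sub !leqnn.
  rewrite orbF => aj yj; by have /andP[] := act_above aj ji yi yj.
case: t => [[j [aj yj sj h]]|[-> h]]; [left|right].
  exists j; split=> //; first by rewrite aj.
  move=> j' /orP[aj'|/eqP->]; first exact: h.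
  by rewrite yi.
by split=> // j /orP[/h //|/eqP->]; rewrite yi.
Qed.

Lemma top_rem y c c' : act i -> above i c' -> top act y c ->
  top (fun j => act j && (j != i)) y (if inY i y then c' else c).
Proof.
move=> ai ab t; case: ifP => yi.
  case: ab => [[j [rj ij sj h]]|[-> h]]; [left|right].
    exists j; split=> //.
    - by rewrite outer //=; case/andP: ij => _; rewrite eq_sym.
    - exact: ins_inY yi.
    move=> j' /andP[aj' ji] yj'; apply: h (act_isr aj') _.
    exact: act_above yi yj'.
  split=> // j /andP[aj ji]; apply/negP => yj.
  have := h j (act_isr aj); rewrite (act_above aj ji yi yj).
  by [].
case: t => [[j [aj yj sj h]]|[-> h]]; [left|right].
  exists j; split=> //; last by move=> j' /andP[aj' _]; apply: h.
  by rewrite aj; apply/eqP => e; rewrite e yi in yj.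
by split=> // j /andP[/h].
Qed.

End Step.

(** [Kc] is the price of one visited segment. [KO] is the price of one event: two splits, the
    potential of the three segments that it may create, and constant work. *)
Let Kc := 30 * lg (2 * n.+1) + 150.
Let KO := 270 * lg (2 * n.+1) + 900.

(** Number of events still to come: a start and an end for an unstarted rectangle, an end for an
    active one. *)
Definition omega (uns act : pred nat) : nat :=
  2 * cn uns 1 p.+1 + cn act 1 p.+1.

(** To the left of [x], the target [H] is the emitted boxes plus what the current segments of colour
    1 will still emit. The final inequality is the potential: initially no box, one segment and
    [2 * p] events worth 3 each. *)
Definition core x (uns act : pred nat) (bs : seq box) bp (cf sf : nat -> nat)
    (s : state) : Prop :=
  [/\ seg_ok n bp cf sf s /\ outb bs s,
      forall y, y < n -> top act y (cf y) /\ sf y <= x,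
      forall i, act i -> isr i /\ above i (arrs s 21 i),
      forall b, b \in bs ->
        [&& b.1.1 < b.1.2, b.1.2 <= minn x n & b.2.1 < b.2.2 <= n] &
      (forall x' y, x' < x -> x' < n -> y < n ->
        cover_count bs x' y + ((sf y <= x') && (cf y == 1)) = H x' y) /\
      size bs + cn bp 0 n + 3 * omega uns act <= 6 * p + 1].

Definition lists x (act : pred nat) (lE : nat -> seq nat) (s : state) : Prop :=
  forall b, x <= b ->
    [/\ chain (arrs s 20) (arrs s 19 b) (lE b), uniq (lE b),
        pairwise (fun i j => ~~ ins j i) (lE b) &
        forall j, (j \in lE b) = act j && (XR j == b)].

Definition static (s : state) : Prop :=
  [/\ regs s 3 = a,
      forall i, isr i -> arrs s 12 i = XR i,
      forall i, isr i -> arrs s 13 i = YL i,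
      forall i, isr i -> arrs s 14 i = YR i &
      forall x, x <= n -> chain (arrs s 18) (arrs s 17 x) (lS x)].

Lemma static_frame c s s' : frame c s s' -> 3 \notin wregs c ->
  all (fun k => k \notin warrs c) [:: 12; 13; 14; 17; 18] ->
  static s -> static s'.
Proof.
move=> F r3 /and5P[a12 a13 a14 a17 /andP[a18 _]].
by rewrite /static F.1 // !F.2.
Qed.

Lemma lists_ext x act act' lE s :
  (forall j, x <= XR j -> act j = act' j) -> lists x act lE s -> lists x act' lE s.
Proof.
move=> e h b xb; have [h1 h2 h3 h4] := h b xb; split=> // j; rewrite h4.
by case: (XR j =P b) => [eb|_]; rewrite ?andbF // !andbT e // eb.
Qed.

Lemma core_ext x uns uns' act act' bs bp cf sf s :
  uns =1 uns' -> act =1 act' ->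
  core x uns act bs bp cf sf s -> core x uns' act' bs bp cf sf s.
Proof.
move=> eu ea [h1 h2 h3 h4 [h5 h6]]; split=> //.
- by move=> y yn; have [t l] := h2 y yn; split=> //; apply: top_ext t.
- by move=> i; rewrite -ea; apply: h3.
split=> //; move: h6; rewrite /omega.
by rewrite (@eq_cn uns uns') ?(@eq_cn act act').
Qed.

(** The part common to starts and ends. The splits add up to two segments and the painting one unit,
    which the three units freed by the decrease of [omega] cover. *)
Lemma repaint x uns act act' uns' bs bp0 bp cf sf s0 s i col :
  core x uns act bs bp0 cf sf s0 -> seg_ok n bp cf sf s -> outb bs s ->
  x <= n -> isr i ->
  regs s 15 = YL i -> regs s 16 = YR i -> regs s 17 = col -> regs s 18 = x ->
  bp (YL i) -> bp (YR i) -> cn bp 0 n <= cn bp0 0 n + 2 ->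
  (forall y, y < n -> top act' y (if inY i y then col else cf y)) ->
  (forall j, act' j -> isr j /\ above j (arrs s 21 j)) ->
  omega uns' act' < omega uns act ->
  wp w paint_seg s (fun k s' => exists bs' bp' cf' sf',
    core x uns' act' bs' bp' cf' sf' s' /\
    k + Kc * cn bp' 0 n <= Kc * (cn bp0 0 n + 3) + 30).
Proof.
move=> [[_ _] tp pv wf [cv sz]] sg1 ob xn ri h15 h16 h17 h18 bc bd cbp tp' pv' om.
have yi := yP ri.
apply: wp_mono (@paint_segP _ _ _ _ _ _ _ _ _ _ _ sg1 ob h15 h16 h17 h18 yi bc bd _) _.
  have : size bs <= 6 * p + 1 by lia.
  lia.
move=> k s' F [bp' [bs' [sg' ob' wf' cv' [sz' le]]]].
exists (bs ++ bs'), bp', (fun z => if inY i z then col else cf z),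
  (fun z => if inY i z then x else sf z); split; last first.
  rewrite -/Kc in le; apply: leq_trans le _; rewrite leq_add2r leq_mul2l.
  by apply/orP; right; lia.
split=> //.
- move=> y yn; split; first exact: tp'.
  by case: ifP => // _; have [] := tp y yn.
- by move=> j /pv'; rewrite F.2.
- move=> b; rewrite mem_cat => /orP[/wf //|/wf']; lia.
split; last by rewrite size_cat; lia.
move=> x' y hx hx' hy; rewrite /cover_count count_cat -/(cover_count bs x' y) -/(cover_count bs' x' y).
rewrite -cv // cv' //; rewrite -/(inY i y); case: (inY i y) => /=; last by rewrite addn0.
by rewrite [x <= x']leqNgt hx /= addn0.
Qed.

(** * One abscissa of the sweep: the end loop, then the start loop *)

Definition actE x (rem : seq nat) : pred nat :=
  fun j => [&& isr j, XL j < x & (x < XR j) || (j \in rem)].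
Definition unsE x : pred nat := fun j => isr j && (x <= XL j).
Definition actS x (rem : seq nat) : pred nat :=
  fun j => [&& isr j, (XL j < x) || ((XL j == x) && (j \notin rem)) & x < XR j].
Definition unsS x (rem : seq nat) : pred nat :=
  fun j => isr j && ((x < XL j) || (j \in rem)).

Lemma end_bodyP x i rem bs bp cf sf lE s :
  core x (unsE x) (actE x (i :: rem)) bs bp cf sf s -> x <= n ->
  static s -> regs s 18 = x -> regs s 6 = i ->
  lists x.+1 (actE x (i :: rem)) lE s -> chain (arrs s 20) (arrs s 20 i) rem ->
  uniq (i :: rem) -> pairwise (fun i j => ~~ ins j i) (i :: rem) ->
  {in i :: rem, forall j, [/\ isr j, XL j < x & XR j = x]} ->
  (forall i' j, i' \in i :: rem -> isr j -> ins i' j -> actE x (i :: rem) j) ->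
  wp w end_body s (fun k s' => exists bs' bp' cf' sf',
    [/\ core x (unsE x) (actE x rem) bs' bp' cf' sf' s',
        static s' /\ regs s' 18 = x,
        lists x.+1 (actE x rem) lE s' /\ chain (arrs s' 20) (regs s' 6) rem,
        (forall i' j, i' \in rem -> isr j -> ins i' j -> actE x rem j) &
        k + Kc * cn bp' 0 n + 10 <= Kc * cn bp 0 n + KO]).
Proof.
move=> co xn st h18 h6 ls ch un pw rm out; have w1 : 1 < 2 ^ w by lia.
have [ri Xi Ri] := rm i (mem_head _ _).
case: (st) => _ _ s13 s14 _; case: (co) => [[sgo ob] tp pv wf [cv sz]].
have ai : actE x (i :: rem) i by rewrite /actE ri Xi mem_head orbT.
have ninr : i \notin rem by case/andP: un.
have aE : (fun j => actE x (i :: rem) j && (j != i)) =1 actE x rem.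
  move=> j; rewrite /actE inE; have [->|ji] := eqVneq j i; last by rewrite andbT.
  by rewrite andbF Ri ltnn /= (negbTE ninr) !andbF.
have [_ ab] := pv i ai.
have om : omega (unsE x) (actE x rem) < omega (unsE x) (actE x (i :: rem)).
  rewrite /omega ltn_add2l -(@cn_rem (actE x (i :: rem)) i) //.
  by rewrite (eq_cn (bp' := actE x rem)) ?addn1 // => z _; rewrite -aE.
apply: wp_seq; wreg; apply: wp_seq; wreg; apply: wp_seq; wreg.
rewrite /= /upd /= h6 s13 // s14 //.
set s1 := set_reg _ _ _.
have sg1 : seg_ok n bp cf sf s1 by [].
apply: wp_seq; apply: wp_mono (split_bothP sg1 _ _ (yP ri) _) _ => //; first lia.
move=> k2 s2 F2 [hk2 [bp2 [sg2 bc bd cbp]]].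
have ob2 : outb bs s2 by rewrite /outb F2.1 // F2.2.
have a21 : arrs s2 21 = arrs s 21 by rewrite F2.2.
apply: wp_seq; apply: wp_mono (repaint (act' := actE x rem) (uns' := unsE x)
  (col := arrs s 21 i) co sg2 ob2 xn ri _ _ _ _ bc bd cbp _ _ om) _.
- by rewrite F2.1 //= /upd /=.
- by rewrite F2.1 //= /upd /=.
- by rewrite F2.1 //= /upd /=.
- by rewrite F2.1 //= /upd /=.
- move=> y yn; have [t _] := tp y yn.
  (* A rectangle that ends at [x] does not contain column [x]; the column common to all active
     rectangles is [x - 1]. *)
  apply: top_ext aE _; apply: (top_rem (x := x.-1)) => //.
  + by move=> j /pv[].
  + move=> j /and3P[rj xj] /orP[|jr]; first by clear - xj; lia.
    by have [_ _ e] := rm j jr; clear - xj e; lia.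
  + by lia.
  + by move=> j; apply: out; rewrite mem_head.
  move=> j; rewrite /actE inE => /and3P[rj xj].
  case: eqP => [->|_]; first by rewrite /ins eqxx andbF.
  case/orP => [xr|jr]; last by move: pw => /= /andP[/allP /(_ j jr)].
  by rewrite /ins /sub; lia.
- move=> j aj; rewrite a21; apply: pv; move: aj; rewrite /actE inE.
  by case/and3P=> -> -> /orP[->|->]; rewrite ?orbT.
move=> k3 s3 F3 [bs' [bp' [cf' [sf' [co' le]]]]].
wreg; exists bs', bp', cf', sf'.
have a20 : arrs s3 20 = arrs s 20 by rewrite F3.2 // F2.2.
have a19 : arrs s3 19 = arrs s 19 by rewrite F3.2 // F2.2.
have r6 : regs s3 6 = i by rewrite F3.1 // F2.1.
split.
- by case: co' => *; split.
- split; last by rewrite /= /upd /= F3.1 // F2.1.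
  apply: (static_frame (s := s3) (c := 6 <~ '#0)) => //; first by split=> //= r;
    rewrite inE /upd => /negbTE->.
  by apply: (static_frame F3) => //; apply: (static_frame F2).
- rewrite /= /upd /= a20 r6; split=> //.
  move=> b xb; rewrite /= a19 a20; apply: (lists_ext _ ls) => // j xj.
  by rewrite -aE andb_idr // => _; apply/eqP => e; rewrite e Ri in xj; lia.
- move=> i' j ii rj ij; have := out i' j; rewrite inE ii orbT => /(_ isT rj ij).
  rewrite -aE => ->; apply/eqP => e; rewrite e in ij.
  by move: pw => /= /andP[/allP /(_ i' ii)]; rewrite ij.
by move: le hk2; rewrite !mulnDr /KO /Kc; lia.
Qed.

(** A rectangle containing [i] is already active: if it starts at [x] as well, the order of the list
    has placed it before [i]. Conversely no active rectangle lies inside [i], for it would start at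
    [x] and have been processed too early. *)
Lemma start_bodyP x i rem bs bp cf sf lE s :
  core x (unsS x (i :: rem)) (actS x (i :: rem)) bs bp cf sf s -> x <= n ->
  static s -> regs s 18 = x -> regs s 6 = i ->
  lists x.+1 (actS x (i :: rem)) lE s -> chain (arrs s 18) (arrs s 18 i) rem ->
  uniq (i :: rem) -> pairwise (fun i j => ~~ ins i j) (i :: rem) ->
  {in i :: rem, forall j, isr j /\ XL j = x} ->
  (forall i' j, i' \in i :: rem -> isr j -> XL j = x -> j \notin i :: rem ->
     ~~ ins j i') ->
  wp w start_body s (fun k s' => exists bs' bp' cf' sf' lE',
    [/\ core x (unsS x rem) (actS x rem) bs' bp' cf' sf' s',
        static s' /\ regs s' 18 = x,
        lists x.+1 (actS x rem) lE' s' /\ chain (arrs s' 18) (regs s' 6) rem,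
        (forall i' j, i' \in rem -> isr j -> XL j = x -> j \notin rem ->
          ~~ ins j i') &
        k + Kc * cn bp' 0 n + 10 <= Kc * cn bp 0 n + KO]).
Proof.
move=> co xn st h18 h6 ls ch un pw rm inn; have w1 : 1 < 2 ^ w by lia.
have [ri Xi] := rm i (mem_head _ _); have xi := xP ri.
case: (st) => s3 s12 s13 s14 _; case: (co) => [[sgo ob] tp pv wf [cv sz]].
have ninr : i \notin rem by case/andP: un.
have nai : ~~ actS x (i :: rem) i by rewrite /actS Xi ltnn mem_head !andbF.
have aE : (fun j => actS x (i :: rem) j || (j == i)) =1 actS x rem.
  move=> j; rewrite /actS inE; have [->|ji] := eqVneq j i; last by rewrite orbF.
  by rewrite orbT ri Xi eqxx ninr orbT; lia.
have uE : (fun j => unsS x (i :: rem) j && (j != i)) =1 unsS x rem.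
  move=> j; rewrite /unsS inE; have [->|ji] := eqVneq j i; last by rewrite andbT.
  by rewrite andbF Xi ltnn (negbTE ninr) andbF.
have om : omega (unsS x rem) (actS x rem) <
          omega (unsS x (i :: rem)) (actS x (i :: rem)).
  rewrite /omega -(@cn_rem (unsS x (i :: rem)) i) //; last first.
    by rewrite /unsS ri mem_head orbT.
  have -> : cn (fun j => unsS x (i :: rem) j && (j != i)) 1 p.+1 =
            cn (unsS x rem) 1 p.+1 by apply: eq_cn => z _; rewrite -uE.
  have := cn_add1 (actS x (i :: rem)) i 1 p.+1.
  have -> : cn (fun z => actS x (i :: rem) z || (z == i)) 1 p.+1 =
            cn (actS x rem) 1 p.+1 by apply: eq_cn => z _; rewrite -aE.
  lia.
have actx j : actS x (i :: rem) j -> XL j <= x < XR j.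
  by rewrite /actS => /and3P[_ h ->]; rewrite andbT; case/orP: h => [|/andP[/eqP]]; lia.
have outr j : isr j -> ins i j -> actS x (i :: rem) j.
  move=> rj ij; rewrite /actS rj /=; have /andP[/and4P[h1 h2 _ _] nij] := ij.
  apply/andP; split; last lia.
  have [->|xj] := eqVneq (XL j) x; last by apply/orP; left; lia.
  rewrite ltnn /= inE negb_or eq_sym nij /=; apply/negP => jr.
  by move: pw => /= /andP[/allP /(_ j jr)]; rewrite ij.
have innr j : actS x (i :: rem) j -> ~~ ins j i.
  rewrite /actS => /and3P[rj h _]; case/orP: h => [lt|/andP[/eqP e nj]].
    by rewrite /ins /sub; lia.
  by apply: inn => //; apply: mem_head.
have isra j : actS x (i :: rem) j -> isr j by case/and3P.
apply: wp_seq; wreg; apply: wp_seq; wreg; apply: wp_seq; wreg.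
rewrite /= /upd /= h6 s13 // s14 // s3.
set s1 := set_reg _ _ _.
have sg1 : seg_ok n bp cf sf s1 by [].
apply: wp_seq; apply: wp_mono (split_bothP sg1 _ _ (yP ri) _) _ => //; first lia.
move=> k2 s2 F2 [hk2 [bp2 [sg2 bc bd cbp]]].
have ob2 : outb bs s2 by rewrite /outb F2.1 // F2.2.
have a21 : arrs s2 21 = arrs s 21 by rewrite F2.2.
have e6 : regs s2 6 = i by rewrite F2.1.
have e15 : regs s2 15 = YL i by rewrite F2.1.
have yi := yP ri.
(* Array 24 is meaningful at starts of segments only; the split has just made [YL i] one. *)
have c24 : arrs s2 24 (YL i) = cf (YL i).
  have [_ _ _ _ sgs] := sg2; have [||h1 h2 _ h] := sgs (YL i) => //; first lia.
  by have [|-> _] := h (YL i); first by lia.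
apply: wp_seq; warr; rewrite e6 e15 c24.
set s2' := set_arr _ _ _ _.
have sg2' : seg_ok n bp2 cf sf s2' by [].
have ob2' : outb bs s2' by [].
apply: wp_seq; apply: wp_mono (repaint (act' := actS x rem) (uns' := unsS x rem)
  (col := sg i) co sg2' ob2' xn ri _ _ _ _ bc bd cbp _ _ om) _.
- by rewrite /= F2.1 //= /upd /=.
- by rewrite /= F2.1 //= /upd /=.
- by rewrite /= F2.1 //= /upd /=.
- by rewrite /= F2.1 //= /upd /=.
- move=> y yn; have [t _] := tp y yn.
  by apply: top_ext aE _; apply: (top_add (x := x)) => //; lia.
- move=> j; rewrite -aE /= /upd /= a21; have [-> _|ji] := eqVneq j i; last first.
    by rewrite orbF; apply: pv.
  split=> //; have [t _] := tp (YL i) (leq_trans (proj1 (andP yi)) (proj2 (andP yi))).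
  apply: (top_above (x := x)) t => //; first lia.
  by rewrite /inY leqnn; lia.
move=> k3 s4 F3 [bs' [bp' [cf' [sf' [co' le]]]]].
have r6 : regs s4 6 = i by rewrite F3.1 //= F2.1.
have a12 : arrs s4 12 i = XR i by rewrite F3.2 //= /upd /= F2.2 // s12.
have a20 : arrs s4 20 = arrs s 20 by rewrite F3.2 //= /upd /= F2.2.
have a19 : arrs s4 19 = arrs s 19 by rewrite F3.2 //= /upd /= F2.2.
have a18 : arrs s4 18 = arrs s 18 by rewrite F3.2 //= /upd /= F2.2.
apply: wp_seq; warr; apply: wp_seq; warr; wreg.
rewrite /= /upd /= !r6 !a12.
exists bs', bp', cf', sf', (fun b => if b == XR i then i :: lE b else lE b); split.
- by case: co' => -[[? ? ? ? ?] ?] *; split.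
- split; last by rewrite /= /upd /= F3.1 //= F2.1.
  apply: (static_frame (s := s4)
    (c := 20 @{'#0} <~ '#0 ;; 19 @{'#0} <~ '#0 ;; 6 <~ '#0)) => //.
    split=> r /=; rewrite /upd !inE.
      by move=> /negbTE->.
    by rewrite negb_or => /andP[/negbTE-> /negbTE->].
  apply: (static_frame F3) => //.
  apply: (static_frame (s := s2) (c := 21 @{'#0} <~ '#0)) => //.
    by split=> r //=; rewrite /upd !inE => /negbTE->.
  by apply: (static_frame F2).
- rewrite /= /upd /= a18; split=> //.
  move=> b xb; rewrite /= /upd /= a19 a20; have [h1 h2 h3 h4] := ls b xb.
  have nil : i \notin lE b by rewrite h4 (negbTE nai).
  have ch' := @chain_upd (arrs s 20) (arrs s 19 b) (lE b) i (arrs s 19 (XR i)) nil h1.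
  have [eb|nb] := eqVneq b (XR i); last first.
    split=> // j; rewrite h4 -aE; have [->|_] := eqVneq j i; last by rewrite orbF.
    by rewrite (negbTE nai) /= eq_sym (negbTE nb).
  split=> //=.
  + split=> //; first by rewrite -lt0n; case/andP: ri.
    by rewrite eqxx; move: ch'; rewrite eb.
  + by rewrite nil h2.
  (* Pushing in front keeps inner before outer, because no active rectangle lies inside the new
     one. *)
  + rewrite h3 andbT; apply/allP => j; rewrite h4 => /andP[aj _]; exact: innr.
  move=> j; rewrite inE h4 -aE; have [->|_] := eqVneq j i; last by rewrite orbF.
  by rewrite orbT eb eqxx.
- move=> i' j ii rj xj nj; have [->|ji] := eqVneq j i.
    by move: pw => /= /andP[/allP /(_ i' ii)].
  by apply: inn => //; rewrite inE ?ii ?orbT // negb_or ji.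
by move: le hk2; rewrite !mulnDr /KO /Kc; lia.
Qed.

Definition act0 x : pred nat := fun j => isr j && (XL j < x <= XR j).

Lemma end_loopP x bs bp cf sf lE s :
  core x (unsE x) (act0 x) bs bp cf sf s -> x <= n ->
  static s -> regs s 18 = x -> regs s 6 = arrs s 19 x ->
  lists x (act0 x) lE s ->
  wp w (PWhile ('R 6) end_body) s (fun k s' => exists bs' bp' cf' sf',
    [/\ core x (unsE x) (actE x [::]) bs' bp' cf' sf' s',
        static s' /\ regs s' 18 = x, lists x.+1 (actE x [::]) lE s' &
        k + (Kc * cn bp' 0 n + KO * omega (unsE x) (actE x [::])) <=
        Kc * cn bp 0 n + KO * omega (unsE x) (act0 x) + 2]).
Proof.
move=> co0 xn st h18 h6 ls0; have w1 : 1 < 2 ^ w by lia.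
have [ch un pw me] := ls0 x (leqnn x).
have aE : act0 x =1 actE x (lE x).
  move=> j; rewrite /actE me /act0; case: (isr j) => //=; case: (XL j < x) => //=.
  by case: (ltngtP x (XR j)).
have co := core_ext (frefl _) aE co0.
have ls : lists x (actE x (lE x)) lE s by apply: lists_ext ls0 => j _; apply: aE.
have oE : omega (unsE x) (act0 x) = omega (unsE x) (actE x (lE x)).
  by congr (_ + _); apply: eq_cn => j _; apply: aE.
rewrite oE.
pose I b s' := exists rem bs' bp' cf' sf',
  [/\ core x (unsE x) (actE x rem) bs' bp' cf' sf' s' /\
        b = Kc * cn bp' 0 n + KO * omega (unsE x) (actE x rem),
      static s' /\ regs s' 18 = x,
      lists x.+1 (actE x rem) lE s' /\ chain (arrs s' 20) (regs s' 6) rem,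
      [/\ uniq rem, pairwise (fun i j => ~~ ins j i) rem &
          {in rem, forall j, [/\ isr j, XL j < x & XR j = x]}] &
      forall i' j, i' \in rem -> isr j -> ins i' j -> actE x rem j].
apply: (@wp_while _ _ _ I
  (Kc * cn bp 0 n + KO * omega (unsE x) (actE x (lE x)))) => //.
- move=> b s1 [rem [bs1 [bp1 [cf1 [sf1 [[co1 ->] [st1 e18] [ls1 ch1] [un1 pw1 rm1] out1]]]]]].
  case: rem ch1 co1 ls1 un1 pw1 rm1 out1 => [|i rem] /=; first by move=> ->.
  move=> [e6 i0 ch1] co1 ls1 un1 pw1 rm1 out1 _.
  apply: wp_mono (end_bodyP co1 xn st1 e18 e6 ls1 ch1 un1 pw1 rm1 out1) _.
  move=> k s2 F [bs2 [bp2 [cf2 [sf2 [co2 st2 ls2 out2 le]]]]].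
  exists (Kc * cn bp2 0 n + KO * omega (unsE x) (actE x rem)); split; last first.
    suff : omega (unsE x) (actE x rem) < omega (unsE x) (actE x (i :: rem)).
      by move=> h; move: le; rewrite -(subnKC h) mulnDr mulnS; lia.
    rewrite /omega ltn_add2l -(@cn_rem (actE x (i :: rem)) i).
    + rewrite addn1 ltnS; apply: leq_cn => z _; rewrite /actE inE.
      case/and3P=> -> -> h /=; apply/andP; split; first by case/orP: h => ->; rewrite ?orbT.
      apply/eqP => e; rewrite e in h; case/andP: un1 => /negbTE nr _.
      have [_ _ ei] := rm1 i (mem_head _ _).
      by rewrite nr ei ltnn in h.
    + by have [ri xi _] := rm1 i (mem_head _ _); rewrite /actE ri xi mem_head orbT.
    by have [ri _ _] := rm1 i (mem_head _ _); exact: ri.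
  exists rem, bs2, bp2, cf2, sf2; split=> //; split.
  + by case/andP: un1.
  + by case/andP: pw1.
  by move=> j jr; apply: rm1; rewrite inE jr orbT.
- exists (lE x), bs, bp, cf, sf; split=> //.
  + split; last by rewrite h6.
    by move=> b xb; apply: ls; apply: ltnW.
  + split=> // j; rewrite me => /andP[/and3P[rj xj _] /eqP e]; by split.
  (* Whatever contains a rectangle that ends at [x] has started before [x] and does not end before
     [x]. *)
  move=> i j; rewrite me => /andP[/and3P[ri xi _] /eqP e] rj ij.
  have /andP[/and4P[h1 h2 _ _] _] := ij.
  have xj := leq_ltn_trans h1 xi; rewrite -aE /act0 rj xj /=.
  by rewrite -e.
move=> k b' s1 [rem [bs1 [bp1 [cf1 [sf1 [[co1 ->] [st1 e18] [ls1 ch1] _ _]]]]]] e0 le F.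
case: rem co1 ls1 ch1 le => [|i rem] co1 ls1 /= => [_|[e6 i0 _]] le; last first.
  by move: e0; rewrite /= e6 => e; rewrite e in i0.
by exists bs1, bp1, cf1, sf1; split.
Qed.

Lemma start_loopP x bs bp cf sf lE s :
  core x (unsS x (lS x)) (actS x (lS x)) bs bp cf sf s -> x <= n ->
  static s -> regs s 18 = x -> regs s 6 = arrs s 17 x ->
  lists x.+1 (actS x (lS x)) lE s ->
  wp w (PWhile ('R 6) start_body) s (fun k s' => exists bs' bp' cf' sf' lE',
    [/\ core x (unsS x [::]) (actS x [::]) bs' bp' cf' sf' s',
        static s' /\ regs s' 18 = x, lists x.+1 (actS x [::]) lE' s' &
        k + (Kc * cn bp' 0 n + KO * omega (unsS x [::]) (actS x [::])) <=
        Kc * cn bp 0 n + KO * omega (unsS x (lS x)) (actS x (lS x)) + 2]).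
Proof.
move=> co xn st h18 h6 ls; have w1 : 1 < 2 ^ w by lia.
pose I b s' := exists rem bs' bp' cf' sf' lE',
  [/\ core x (unsS x rem) (actS x rem) bs' bp' cf' sf' s' /\
        b = Kc * cn bp' 0 n + KO * omega (unsS x rem) (actS x rem),
      static s' /\ regs s' 18 = x,
      lists x.+1 (actS x rem) lE' s' /\ chain (arrs s' 18) (regs s' 6) rem,
      [/\ uniq rem, pairwise (fun i j => ~~ ins i j) rem &
          {in rem, forall j, isr j /\ XL j = x}] &
      forall i' j, i' \in rem -> isr j -> XL j = x -> j \notin rem ->
        ~~ ins j i'].
apply: (@wp_while _ _ _ I
  (Kc * cn bp 0 n + KO * omega (unsS x (lS x)) (actS x (lS x)))) => //.
- move=> b s1 [rem [bs1 [bp1 [cf1 [sf1 [lE1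
    [[co1 ->] [st1 e18] [ls1 ch1] [un1 pw1 rm1] out1]]]]]]].
  case: rem ch1 co1 ls1 un1 pw1 rm1 out1 => [|i rem] /=; first by move=> ->.
  move=> [e6 i0 ch1] co1 ls1 un1 pw1 rm1 out1 _.
  apply: wp_mono (start_bodyP co1 xn st1 e18 e6 ls1 ch1 un1 pw1 rm1 out1) _.
  move=> k s2 F [bs2 [bp2 [cf2 [sf2 [lE2 [co2 st2 ls2 out2 le]]]]]].
  exists (Kc * cn bp2 0 n + KO * omega (unsS x rem) (actS x rem)); split; last first.
    have [ri xi] := rm1 i (mem_head _ _).
    suff : omega (unsS x rem) (actS x rem) < omega (unsS x (i :: rem)) (actS x (i :: rem)).
      by move=> h; move: le; rewrite -(subnKC h) mulnDr mulnS; lia.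
    have nr : i \notin rem by case/andP: un1.
    have h1 : cn (unsS x rem) 1 p.+1 + 1 <= cn (unsS x (i :: rem)) 1 p.+1.
      rewrite -(@cn_rem (unsS x (i :: rem)) i) //; last by rewrite /unsS ri mem_head orbT.
      rewrite leq_add2r; apply: leq_cn => z _; rewrite /unsS inE => /andP[-> h] /=.
      apply/andP; split; first by case/orP: h => ->; rewrite ?orbT.
      by apply: contraTneq h => ->; rewrite xi ltnn.
    have h2 : cn (actS x rem) 1 p.+1 <= cn (actS x (i :: rem)) 1 p.+1 + 1.
      apply: leq_trans (cn_add1 _ i _ _); apply: leq_cn => z _.
      rewrite /actS inE negb_or => /and3P[-> h ->]; case: (z == i) => /=.
        by rewrite orbT.
      by rewrite orbF andbT.
    by rewrite /omega; clear - h1 h2; lia.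
  exists rem, bs2, bp2, cf2, sf2, lE2; split=> //; split.
  + by case/andP: un1.
  + by case/andP: pw1.
  by move=> j jr; apply: rm1; rewrite inE jr orbT.
- exists (lS x), bs, bp, cf, sf, lE; split=> //.
  + by split=> //; rewrite h6; case: st => _ _ _ _; apply.
  + by split=> // j; rewrite lSP => /andP[? /eqP].
  by move=> i j _ rj xj; rewrite lSP rj xj eqxx.
move=> k b' s1 [rem [bs1 [bp1 [cf1 [sf1 [lE1 [[co1 ->] [st1 e18] [ls1 ch1] _ _]]]]]]] e0 le F.
case: rem co1 ls1 ch1 le => [|i rem] co1 ls1 /= => [_|[e6 i0 _]] le; last first.
  by move: e0; rewrite /= e6 => e; rewrite e in i0.
by exists bs1, bp1, cf1, sf1, lE1; split.
Qed.

(** Only column [x] is new in the counting identity. No box emitted so far reaches it and all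
    segments date from [x] or before, so the count there is decided by the current colours. *)
Lemma core_next x uns act bs bp cf sf s :
  core x uns act bs bp cf sf s -> x <= n ->
  act =1 (fun i => isr i && (XL i <= x < XR i)) ->
  core x.+1 uns act bs bp cf sf s.
Proof.
move=> [h1 h2 h3 h4 [h5 h6]] xn e; split=> //.
- by move=> y yn; have [t l] := h2 y yn; split=> //; apply: leqW.
- move=> b /h4 /and3P[-> h ->]; rewrite andbT /=; apply: leq_trans h _.
  by rewrite leq_min geq_minr (leq_trans (geq_minl _ _)).
split=> // x' y; rewrite ltnS leq_eqVlt => /predU1P[->|lt] hx hy; last exact: h5.
have [t l] := h2 y hy; rewrite l -(HP hx hy (top_ext e t)).
suff -> : cover_count bs x y = 0 by rewrite add0n.
apply/eqP; rewrite eqn0Ngt -has_count; apply/hasPn => b /h4 /and3P[_ h _].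
by rewrite /inbox; move: h; rewrite leq_min => /andP[h _]; rewrite [x < _]ltnNge h andbF.
Qed.

Lemma sweepP s :
  static s -> regs s 20 = 0 -> (forall b, arrs s 19 b = 0) ->
  seg_ok n (fun z => (z == 0) || (z == n)) (fun=> 0) (fun=> 0) s ->
  wp w sweep s (fun k s' => exists bs,
    [/\ outb bs s', size bs <= 6 * p,
        forall b, b \in bs ->
          [&& b.1.1 < b.1.2, b.1.2 <= n & b.2.1 < b.2.2 <= n],
        forall x y, x < n -> y < n -> cover_count bs x y = H x y &
        k <= (600 * lg (2 * n.+1) + 2000) * p + 30 * lg (2 * n.+1) + 50 * n + 300]).
Proof.
move=> st h20 h19 sg0; have w1 : 1 < 2 ^ w by lia.
case: (sg0) => h21 _ _ _ _.
apply: wp_seq; wreg; first lia.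
set s0 := set_reg s 18 0.
pose I x b s' := exists bs bp cf sf lE,
  [/\ core x (unsE x) (act0 x) bs bp cf sf s', static s',
      lists x (act0 x) lE s' &
      Kc * cn bp 0 n + KO * omega (unsE x) (act0 x) <= b].
apply: (@wp_for _ _ _ _ I 30 n.+1 (Kc * 1 + KO * (2 * p))) => //.
- rewrite /s0 /= /upd /=; lia.
- exists [::], (fun z => (z == 0) || (z == n)), (fun=> 0), (fun=> 0), (fun=> [::]).
  have cn1' : cn (fun z => (z == 0) || (z == n)) 0 n = 1.
    by rewrite cn1 //= => z; rewrite negb_or; lia.
  have a0 j : act0 0 j = false by rewrite /act0 /= andbF.
  have om : omega (unsE 0) (act0 0) = 2 * p.
    rewrite /omega (_ : cn (act0 0) 1 p.+1 = 0) ?addn0; last first.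
      by rewrite /cn big1 // => j _; rewrite a0.
    congr (2 * _); rewrite /cn (@eq_big_nat _ _ _ _ _ _ (fun=> 1)) => [|j hj].
      by rewrite sum_nat_const_nat muln1 subn1.
    by rewrite /unsE leq0n andbT /isr; move: hj; rewrite ltnS => ->.
  rewrite /s0 /= /upd /= om cn1'; split=> //.
  + split=> //; last by rewrite /= om cn1'; split=> //; lia.
    by move=> y yn; split=> //; right; split=> // j; rewrite a0.
    by move=> j; rewrite a0.
  by move=> b _; split=> //=; rewrite ?h19 // => j; rewrite a0.
- move=> x bg s1 hx e18 e21 F [bs [bp [cf [sf [lE [co st1 ls le]]]]]].
  have xn : x <= n by case/andP: hx => _; rewrite ltnS.
  apply: wp_seq; wreg; rewrite e18.
  apply: wp_seq; apply: wp_mono (@end_loopP x bs bp cf sf lE _ _ xn _ _ _ _) _ => //.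
  move=> k2 s2 F2 [bs2 [bp2 [cf2 [sf2 [co2 [st2 e18'] ls2 le2]]]]].
  have uE : unsE x =1 unsS x (lS x).
    move=> j; rewrite /unsE /unsS lSP; case: (isr j) => //=.
    by rewrite leq_eqVlt orbC eq_sym.
  have aE : actE x [::] =1 actS x (lS x).
    move=> j; rewrite /actE /actS lSP; case: (isr j) => //=.
    by rewrite orbF andbN orbF.
  have co2' := core_ext uE aE co2.
  have oE : omega (unsE x) (actE x [::]) = omega (unsS x (lS x)) (actS x (lS x)).
    by congr (2 * _ + _); apply: eq_cn => j _; rewrite ?uE ?aE.
  have ls2' : lists x.+1 (actS x (lS x)) lE s2 by apply: lists_ext ls2 => j _.
  rewrite oE in le2.
  apply: wp_seq; wreg; rewrite e18'.
  apply: wp_mono (@start_loopP x bs2 bp2 cf2 sf2 lE _ _ xn _ _ _ _) _ => //.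
  move=> k3 s3 F3 [bs3 [bp3 [cf3 [sf3 [lE3 [co3 [st3 e18''] ls3 le3]]]]]].
  have uE3 : unsS x [::] =1 unsE x.+1 by move=> j; rewrite /unsE /unsS orbF.
  have aE3 : actS x [::] =1 act0 x.+1.
    move=> j; rewrite /actS /act0; congr (_ && (_ && _)).
    by rewrite in_nil andbT; clear; lia.
  have oE3 : omega (unsS x [::]) (actS x [::]) = omega (unsE x.+1) (act0 x.+1).
    by congr (2 * _ + _); apply: eq_cn => j _; rewrite ?uE3 ?aE3.
  have co3' := core_ext uE3 aE3 co3.
  have co4 : core x.+1 (unsE x.+1) (act0 x.+1) bs3 bp3 cf3 sf3 s3 by apply: core_next.
  rewrite oE3 in le3.
  exists (Kc * cn bp3 0 n + KO * omega (unsE x.+1) (act0 x.+1)); split.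
    by clear - le le2 le3; lia.
  exists bs3, bp3, cf3, sf3, lE3; split=> //.
  by apply: lists_ext ls3 => j _; apply: aE3.
move=> k bg s1 [bs [bp [cf [sf [lE [[[sg1 ob] tp _ wf [cv sz]] st1 ls le]]]]]] _ _ hk F.
(* At least one segment remains, which turns [6 * p + 1] into [6 * p]. *)
have cbp : 0 < cn bp 0 n by case: sg1 => _ _ _ [b0 _] _; rewrite /cn big_ltn // b0.
exists bs; split=> //.
- by clear - sz cbp; lia.
- move=> b /wf /and3P[-> h ->]; rewrite andbT /=.
  by move: h; rewrite leq_min => /andP[].
- move=> x y hx hy; rewrite -cv //; last by apply: leqW.
  (* Past abscissa [n] no rectangle is active, so nothing is pending. *)
  have [t _] := tp y hy; suff -> : cf y = 0 by rewrite andbF addn0.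
  case: t => [[i [/andP[ri hi] _ _ _]]|[]] //.
  by have := xP ri; clear - hi; lia.
have : bg + (30 + 8) * (n.+1 - regs s0 18) + 4 = bg + (30 + 8) * n.+1 + 4.
  by rewrite /s0 /= /upd /= subn0.
move: hk; rewrite /s0 /= /upd /= subn0 /KO /Kc muln1; clear; lia.
Qed.

End Sweep.

(** * Canonical decomposition of an interval of leaves of a heap tree *)

(* The nodes of the heap tree with n leaves are 1, ..., 2n-1, the children of i
   are 2i and 2i+1, and the leaves are n, ..., 2n-1. *)
Fixpoint canon_rec (k l r : nat) : seq nat :=
  if k is k'.+1 then
    if l < r then
      (if odd l then [:: l] else [::]) ++ (if odd r then [:: r - 1] else [::])
        ++ canon_rec k' (l.+1 %/ 2) (r %/ 2)
    else [::]
  else [::].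

Definition canon (l r : nat) : seq nat := canon_rec (lg r) l r.

Lemma canonE l r : l < r -> canon l r =
  (if odd l then [:: l] else [::]) ++ (if odd r then [:: r - 1] else [::])
    ++ canon (l.+1 %/ 2) (r %/ 2).
Proof. by move=> lr; rewrite /canon (@lg_half r) /= ?lr //; lia. Qed.

Lemma canon_nil l r : r <= l -> canon l r = [::].
Proof. by rewrite /canon; case: (lg r) => //= k; rewrite ltnNge => ->. Qed.

Lemma canon_ind (P : nat -> nat -> seq nat -> Prop) :
  (forall l r, r <= l -> P l r [::]) ->
  (forall l r, l < r -> P (l.+1 %/ 2) (r %/ 2) (canon (l.+1 %/ 2) (r %/ 2)) ->
     P l r ((if odd l then [:: l] else [::]) ++
            (if odd r then [:: r - 1] else [::]) ++
            canon (l.+1 %/ 2) (r %/ 2))) ->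
  forall l r, P l r (canon l r).
Proof.
move=> h0 hS l r; have [b] := ubnP r; elim: b l r => // b IH l r rb.
have [rl|lr] := leqP r l; first by rewrite canon_nil //; apply: h0.
by rewrite canonE //; apply: hS => //; apply: IH; lia.
Qed.

Lemma size_canon l r : size (canon l r) <= 2 * lg r.
Proof.
elim/canon_ind: (canon l r) => {l r} [//|l r lr IH].
rewrite !size_cat (@lg_half r); last lia.
by case: (odd l); case: (odd r) => /=; lia.
Qed.

Lemma canon_bound l r : 0 < l -> {in canon l r, forall i, 0 < i < r}.
Proof.
elim/canon_ind: (canon l r) => {l r} [//|l r lr IH] l0 i.
rewrite !mem_cat => /or3P[| |/IH].
- by case: (odd l) => //; rewrite inE => /eqP->; lia.
- by case: ifP => // o; rewrite inE => /eqP->; lia.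
lia.
Qed.

(** The condition [r <= 2 * l] separates the levels: all nodes found higher up are below [r %/ 2],
    hence below [l]. *)
Lemma canon_uniq l r : 0 < l -> r <= 2 * l -> uniq (canon l r).
Proof.
elim/canon_ind: (canon l r) => {l r} [//|l r lr IH] l0 rl.
have h i : i \in canon (l.+1 %/ 2) (r %/ 2) -> i < l.
  by move/canon_bound => /(_ _); lia.
have nl i : l <= i -> i \notin canon (l.+1 %/ 2) (r %/ 2).
  by move=> li; apply/negP => /h; lia.
have u : uniq (canon (l.+1 %/ 2) (r %/ 2)) by apply: IH; lia.
case ol : (odd l); case or : (odd r) => /=; rewrite ?inE ?negb_or ?nl ?u ?andbT //; lia.
Qed.

(** Ancestry in the heap tree. Bounding the exponent by [z] makes it boolean; larger exponents only
    give 0. *)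
Definition hanc (i z : nat) : bool := has (fun k => z %/ 2 ^ k == i) (iota 0 z.+1).

Lemma hancP i z : 0 < i -> reflect (exists k, z %/ 2 ^ k = i) (hanc i z).
Proof.
move=> i0; apply: (iffP hasP) => [[k _ /eqP]|[k e]]; first by exists k.
exists k; last by rewrite e.
rewrite mem_iota add0n /= leqNgt; apply/negP => zk.
by move: i0; rewrite -e divn_small //; apply: (@ltn_trans k) (ltn_expl k _).
Qed.

Lemma hanc_refl i : 0 < i -> hanc i i.
Proof. by move=> i0; apply/hancP => //; exists 0; rewrite divn1. Qed.

Lemma hanc_half i z : 0 < i -> hanc i z = (i == z) || hanc i (z %/ 2).
Proof.
move=> i0; apply/(hancP _ i0)/predU1P => [[[|k] e]|[->|/(hancP _ i0)[k e]]].
- by left; rewrite -e divn1.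
- by right; apply/hancP => //; exists k; rewrite -divnMA -expnS.
- by exists 0; rewrite divn1.
by exists k.+1; rewrite expnS divnMA.
Qed.

Lemma hanc_leq i z : 0 < i -> hanc i z -> i <= z.
Proof. by move=> i0 /(hancP _ i0)[k <-]; apply: leq_div. Qed.

(** The two bounds on [z] replace the statement that [z] is on the level of the range, which makes
    no sense when [n] is not a power of two. They are preserved by halving, and they ensure that the
    only node from [l] on above [z] is [z] itself, while nodes found higher up differ from [z]. *)
Lemma canon_count l r z : 0 < l -> z %/ 2 < l -> r <= 2 * z + 1 ->
  count (fun i => hanc i z) (canon l r) = (l <= z < r).
Proof.
elim/canon_ind: (canon l r) z => {l r} [|l r lr IH] z l0 zl rz.
  by move=> rl; rewrite /=; lia.
have hl i : l <= i -> hanc i z = (i == z).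
  move=> li; rewrite hanc_half; last lia.
  case: (i == z) => //=; apply/negP => /hanc_leq; lia.
have hs : count (fun i => hanc i z) (canon (l.+1 %/ 2) (r %/ 2)) =
          count (fun i => hanc i (z %/ 2)) (canon (l.+1 %/ 2) (r %/ 2)).
  apply: eq_in_count => i ic.
  have hi : 0 < i < r %/ 2 by apply: canon_bound ic; lia.
  rewrite hanc_half; last lia.
  by rewrite neqF //; lia.
rewrite !count_cat hs IH; [|lia|lia|lia].
have -> : count (fun i => hanc i z) (if odd l then [:: l] else [::]) =
          (odd l && (l == z)).
  by case: (odd l) => //=; rewrite hl // addn0.
have -> : count (fun i => hanc i z) (if odd r then [:: r - 1] else [::]) =
          (odd r && (r - 1 == z)).
  by case: ifP => //= o; rewrite hl ?addn0 //; lia.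
lia.
Qed.

Lemma canon_leaf n x0 x1 z : 0 < n -> x1 <= n -> z < n ->
  count (fun i => hanc i (n + z)) (canon (n + x0) (n + x1)) = (x0 <= z < x1).
Proof. by move=> n0 xn zn; rewrite canon_count; lia. Qed.

(** Going to the left child repeatedly ends among the leaves. *)
Lemma hanc_has_leaf n i : 0 < i < 2 * n -> exists2 z, z < n & hanc i (n + z).
Proof.
move=> hi; have [b] := ubnP (2 * n - i); elim: b i hi => // b IH i hi ib.
have [ni|lt] := leqP n i.
  by exists (i - n); [lia|rewrite subnKC // hanc_refl //; lia].
have [||z zn h] := IH (2 * i); [lia|lia|].
have i20 : 0 < 2 * i by lia.
exists z => //; have /(hancP _ i20)[k e] := h; apply/hancP; first lia.
by exists k.+1; rewrite expnSr divnMA e mulKn.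
Qed.

Definition wpairs (s : seq (nat * nat)) : seq nat :=
  flatten [seq [:: x.1; x.2] | x <- s].

Lemma size_wpairs s : size (wpairs s) = 2 * size s.
Proof. by elim: s => //= x s; rewrite /wpairs /= => ->; lia. Qed.

Lemma wpairs_cat s1 s2 : wpairs (s1 ++ s2) = wpairs s1 ++ wpairs s2.
Proof. by rewrite /wpairs map_cat flatten_cat. Qed.

Lemma wpairs_rcons s x : wpairs (rcons s x) = wpairs s ++ [:: x.1; x.2].
Proof. by rewrite -cats1 wpairs_cat. Qed.

Lemma nth_wpairs s i : i < size s ->
  nth 0 (wpairs s) (2 * i) = (nth (0, 0) s i).1 /\
  nth 0 (wpairs s) (2 * i + 1) = (nth (0, 0) s i).2.
Proof.
elim: s i => //= x s IH [|i] // hi.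
have -> : 2 * i.+1 = (2 * i).+2 by lia.
exact: IH.
Qed.

(** * Writing the DAG and the positive tree model *)

(* Register 9 is the offset of the list of arcs in array 2, register 8 the
   number of arcs written so far. *)
Definition outa (base : nat) (ar : seq (nat * nat)) (s : state) : Prop :=
  [/\ regs s 9 = base, regs s 8 = size ar & at_ (arrs s 2) base (wpairs ar)].

Definition put_arc (t : expr) : prog :=
  2 @{'R 9 +! '#2 *! 'R 8} <~ 'R 7 ;;
  2 @{'R 9 +! '#2 *! 'R 8 +! '#1} <~ t ;;
  8 <~ 'R 8 +! '#1.

(** The recursion of [canon] as a loop; register 7 is the common source of the arcs. *)
Definition canon_arcs : prog :=
  PWhile ('R 12 <! 'R 13)
    (PIf ('R 12 %! '#2) (put_arc ('R 12 -: '#1) ;; 12 <~ 'R 12 +! '#1) PSkip ;;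
     PIf ('R 13 %! '#2) (13 <~ 'R 13 -: '#1 ;; put_arc ('R 13 -: '#1)) PSkip ;;
     12 <~ 'R 12 /! '#2 ;; 13 <~ 'R 13 /! '#2).

Lemma put_arcP w base ar s (r d : nat) :
  outa base ar s -> base + 2 * size ar + 10 < 2 ^ w -> d <= regs s r < 2 ^ w ->
  wp w (put_arc ('R r -: '#d)) s (fun k s' => [/\ k <= 30,
    outa base (rcons ar (regs s 7, regs s r - d)) s' &
    forall i, i < base -> arrs s' 2 i = arrs s 2 i]).
Proof.
move=> [h9 h8 hat] W hr; have w1 : 1 < 2 ^ w by lia.
have hd : d < 2 ^ w by lia.
apply: wp_seq; warr; first by rewrite h8 h9; do !split=> //; lia.
apply: wp_seq; warr; first by rewrite h8 h9; do !split=> //; lia.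
wreg; first by rewrite h8; do !split=> //; lia.
rewrite h8 h9; split=> //; last by move=> i hi; rewrite /upd /= !neqF //; lia.
split; rewrite /= /upd /= ?size_rcons ?h8 ?addn1 //.
rewrite wpairs_rcons at_cat size_wpairs; split.
  move=> i hi; rewrite -hat //; rewrite size_wpairs in hi.
  by rewrite !neqF //; lia.
by rewrite /= !at_cons; split; [|split=> //]; repeat (case: eqP => //; try lia).
Qed.

Lemma canon_arcsP w base ar s l r :
  outa base ar s -> regs s 12 = l -> regs s 13 = r -> 0 < l ->
  base + 2 * (size ar + 2 * lg r) + r + 20 < 2 ^ w ->
  wp w canon_arcs s (fun k s' => [/\ k <= 100 * lg r + 10,
    outa base (ar ++ [seq (regs s 7, i - 1) | i <- canon l r]) s' &
    forall i, i < base -> arrs s' 2 i = arrs s 2 i]).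
Proof.
move=> oa h12 h13 l0 W; have w1 : 1 < 2 ^ w by lia.
pose v := regs s 7.
pose I b s' := exists l' r' ar',
  [/\ regs s' 12 = l' /\ regs s' 13 = r', 0 < l' /\ r' < 2 ^ w,
      outa base ar' s' /\ regs s' 7 = v /\ b = 100 * lg r',
      ar ++ [seq (v, i - 1) | i <- canon l r] =
        ar' ++ [seq (v, i - 1) | i <- canon l' r'] /\
      size ar' + 2 * lg r' <= size ar + 2 * lg r &
      forall i, i < base -> arrs s' 2 i = arrs s 2 i].
apply: (@wp_while _ _ _ I (100 * lg r)) => //.
- move=> b s1 [l1 [r1 [ar1 [[e12 e13] [l10 r1w] [oa1 [e7 ->]] [eq1 sz1] fr1]]]] /=.
  rewrite e12 e13 => c; have lr : l1 < r1 by move: c; case: ltnP.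
  have lgr := @lg_half r1 (leq_ltn_trans (leq0n _) lr).
  apply: wp_seq; apply: (@wp_mono _ _ _ (fun k s2 => [/\ k <= 40,
      outa base (ar1 ++ [seq (v, i - 1) | i <- if odd l1 then [:: l1] else [::]]) s2,
      regs s2 12 = l1 + l1 %% 2 & forall i, i < base -> arrs s2 2 i = arrs s 2 i])).
    apply: wp_if => //=; first by rewrite e12; do !split=> //; lia.
      rewrite e12 => o; have ol : odd l1 by lia.
      apply: wp_seq; apply: wp_mono (put_arcP oa1 _ _) _; [lia|lia|].
      move=> k s2 F [hk oa2 fr2]; wreg; first by rewrite F.1 // e12; do !split=> //; lia.
      rewrite F.1 // e12 e7 in oa2 *; split=> //=; [lia| | |].
      + by rewrite ol cats1.
      + by rewrite /upd /=; lia.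
      by move=> i hi; rewrite fr2 // fr1.
    rewrite e12 => o; have ol : odd l1 = false by lia.
    by apply: wp_skip; rewrite ol cats0; split=> //; lia.
  move=> k2 s2 F2 [hk2 oa2 e12' fr2].
  have e13' : regs s2 13 = r1 by rewrite F2.1.
  have e7' : regs s2 7 = v by rewrite F2.1.
  have sz2 : size (ar1 ++ [seq (v, i - 1) | i <- if odd l1 then [:: l1] else [::]]) <=
             size ar1 + 1 by rewrite size_cat size_map; case: (odd l1) => /=; lia.
  apply: wp_seq; apply: (@wp_mono _ _ _ (fun k s3 => [/\ k <= 40,
      outa base ((ar1 ++ [seq (v, i - 1) | i <- if odd l1 then [:: l1] else [::]]) ++
        [seq (v, i - 1) | i <- if odd r1 then [:: r1 - 1] else [::]]) s3,
      regs s3 13 = r1 - r1 %% 2 & forall i, i < base -> arrs s3 2 i = arrs s 2 i])).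
    apply: wp_if => //=; first by rewrite e13'; do !split=> //; lia.
      rewrite e13' => o; have or : odd r1 by lia.
      apply: wp_seq; wreg; first by rewrite e13'; do !split=> //; lia.
      rewrite e13'; set s2' := set_reg _ _ _.
      have oa2' : outa base (ar1 ++ [seq (v, i - 1) | i <- if odd l1 then [:: l1] else [::]]) s2' by [].
      have e13'' : regs s2' 13 = r1 - 1 by [].
      apply: wp_mono (put_arcP (r := 13) (d := 1) oa2' _ _) _.
      + by clear - sz2 sz1 W lgr; lia.
      + by rewrite e13''; lia.
      move=> k s3 F [hk oa3 fr3].
      rewrite e13'' /= /upd /= e7' in oa3; split=> //=; [lia| | |].
      + by rewrite or cats1.
      + by rewrite F.1 //= /upd /=; lia.
      by move=> i hi; rewrite fr3 // fr2.
    rewrite e13' => o; have or : odd r1 = false by lia.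
    by apply: wp_skip; rewrite or cats0; split=> //; lia.
  move=> k3 s3 F3 [hk3 oa3 e13'' fr3].
  have e12'' : regs s3 12 = l1 + l1 %% 2 by rewrite F3.1.
  apply: wp_seq; wreg; first by rewrite e12''; do !split=> //; lia.
  wreg; first by rewrite /= /upd /= e13''; do !split=> //; lia.
  rewrite /= /upd /= e12'' e13''.
  exists (100 * lg (r1 %/ 2)); split; last by rewrite lgr; clear - hk2 hk3; lia.
  exists (l1.+1 %/ 2), (r1 %/ 2),
    ((ar1 ++ [seq (v, i - 1) | i <- if odd l1 then [:: l1] else [::]]) ++
        [seq (v, i - 1) | i <- if odd r1 then [:: r1 - 1] else [::]]); split; first by split=> /=; rewrite /upd /=; lia.
  + by lia.
  + by split; [exact: oa3|split=> //=; rewrite /upd /= F3.1].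
  + split; last first.
      move: sz1; rewrite lgr !size_cat !size_map.
      by case: (odd l1); case: (odd r1) => /=; clear; lia.
    by rewrite eq1 (canonE lr) !map_cat !catA.
  by move=> i hi; rewrite /= fr3.
- exists l, r, ar; split=> //; first by split=> //; lia.
move=> k b s1 [l1 [r1 [ar1 [[e12 e13] [l10 r1w] [oa1 [e7 ->]] [eq1 sz1] fr1]]]] /=.
rewrite e12 e13 => c le F; have lr : r1 <= l1 by move: c; case: ltnP.
split=> //; first by clear - le; lia.
by rewrite -/v eq1 (canon_nil lr) cats0.
Qed.

Definition b0 : box := ((0, 0), (0, 0)).

Definition canonX (n : nat) (b : box) : seq nat := canon (n + b.1.1) (n + b.1.2).
Definition canonY (n : nat) (b : box) : seq nat := canon (n + b.2.1) (n + b.2.2).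

(* From here on the nodes of the heap tree are renumbered from 0. *)
Definition heap_arcs (n : nat) : seq (nat * nat) :=
  [seq ((v - 1) %/ 2, v) | v <- iota 1 (2 * n - 2)].

(** The heap tree occupies the numbers up to [2 * n - 2]; each box then adds two nodes, one for each
    side. *)
Definition box_arcs (n t : nat) (b : box) : seq (nat * nat) :=
  [seq (2 * n + 2 * t - 1, i - 1) | i <- canonX n b] ++
  [seq (2 * n + 2 * t, i - 1) | i <- canonY n b].

Definition arcs (n : nat) (bs : seq box) (t : nat) : seq (nat * nat) :=
  heap_arcs n ++ flatten (mkseq (fun u => box_arcs n u (nth b0 bs u)) t).

Definition box_pairs (n q : nat) : seq (nat * nat) :=
  mkseq (fun t => (2 * n + 2 * t - 1, 2 * n + 2 * t)) q.

Definition tree_pairs (n : nat) (b : box) : seq (nat * nat) :=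
  [seq (i - 1, j - 1) | i <- canonX n b, j <- canonY n b].

(** Boxes are half-open, whereas the output names the last vertex of each side: hence the [- 1]. *)
Definition wquad (o : seq nat) (b : box) : seq nat :=
  [:: nth 0 o b.1.1; nth 0 o (b.1.2 - 1); nth 0 o b.2.1; nth 0 o (b.2.2 - 1)].

Lemma size_wquads o bs :
  size (flatten [seq wquad o b | b <- bs]) = 4 * size bs.
Proof. by elim: bs => //= b bs ->; lia. Qed.

Lemma arcsS n bs t :
  arcs n bs t.+1 = arcs n bs t ++ box_arcs n t (nth b0 bs t).
Proof. by rewrite /arcs mkseqS flatten_rcons catA. Qed.

(** One loop writes the heap tree twice: as arcs in array 2, behind 3 header words and [n] sinks,
    and as parents in array 3, behind 4 header words. Cell 4 of array 3 makes the root its own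
    parent. *)
Definition post_tree : prog :=
  9 <~ 'R 0 +! '#3 ;; 8 <~ '#0 ;; 5 <~ '#1 ;; 6 <~ 'R 0 +! 'R 0 -: '#1 ;;
  3 @{'#4} <~ '#0 ;;
  PFor 5 6
    (7 <~ ('R 5 -: '#1) /! '#2 ;; put_arc ('R 5 -: '#0) ;;
     3 @{'R 5 +! '#4} <~ 'R 7).

Lemma post_treeP w n s :
  regs s 0 = n -> 0 < n -> 10 * n + 100 < 2 ^ w ->
  wp w post_tree s (fun k s' => [/\ k <= 200 * n + 100,
    outa (n + 3) (heap_arcs n) s',
    (forall i, i < n + 3 -> arrs s' 2 i = arrs s 2 i),
    (forall v, v < 2 * n - 1 -> arrs s' 3 (4 + v) = (v - 1) %/ 2) &
    (forall i, 2 * n + 3 <= i -> arrs s' 3 i = arrs s 3 i)]).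
Proof.
move=> h0 n0 W; have w1 : 1 < 2 ^ w by lia.
apply: wp_seq; wreg; first by rewrite h0; do !split=> //; lia.
apply: wp_seq; wreg; first lia.
apply: wp_seq; wreg.
apply: wp_seq; wreg; first by rewrite /= /upd /= h0; do !split=> //; lia.
rewrite /= /upd /= h0; apply: wp_seq; warr; try lia.
set s0 := set_arr _ _ _ _.
pose I v (b : nat) s' := [/\
  outa (n + 3) [seq ((v - 1) %/ 2, v) | v <- iota 1 (v - 1)] s',
  (forall i, i < n + 3 -> arrs s' 2 i = arrs s 2 i),
  (forall u, u < v -> arrs s' 3 (4 + u) = (u - 1) %/ 2) &
  (forall i, 2 * n + 3 <= i -> arrs s' 3 i = arrs s 3 i)].
apply: (@wp_for _ _ _ _ I 60 (2 * n - 1) 0) => //.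
- by rewrite /s0 /= /upd /=; lia.
- by rewrite /s0 /= /upd /=; lia.
- rewrite /s0 /I /= /upd /=; split=> //.
  + by move=> u; case: u.
  by move=> i hi; rewrite neqF //; lia.
- rewrite /s0 /= /upd /= => v bg s1 hv e5 e6 F [oa fr2 p3 fr3].
  apply: wp_seq; wreg; first by rewrite e5; do !split=> //; lia.
  rewrite e5; set s2 := set_reg _ _ _.
  have oa2 : outa (n + 3) [seq ((v - 1) %/ 2, v) | v <- iota 1 (v - 1)] s2 by [].
  have sz : size [seq ((v - 1) %/ 2, v) | v <- iota 1 (v - 1)] = v - 1.
    by rewrite size_map size_iota.
  apply: wp_seq; apply: wp_mono (put_arcP (r := 5) (d := 0) oa2 _ _) _.
  + by rewrite sz; lia.
  + by rewrite /s2 /= /upd /= e5; lia.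
  move=> k s3 F3 [hk oa3 fr2'].
  warr; first by rewrite F3.1 //= /upd /= e5; do !split=> //; lia.
  exists 0; split; first lia.
  rewrite F3.1 //= F3.1 //= /upd /= e5; split=> //=.
  + have -> : iota 1 (v.+1 - 1) = rcons (iota 1 (v - 1)) v.
      have -> : v.+1 - 1 = (v - 1) + 1 by lia.
      by rewrite iotaD cats1; congr rcons; lia.
    by move: oa3; rewrite /s2 /= /upd /= e5 subn0 map_rcons.
  + by move=> i hi; rewrite /upd /= fr2' //= fr2.
  + move=> u uv; rewrite /upd /=; case: eqP => [e|ne]; first by have -> : u = v by lia.
    by rewrite F3.2 //= p3 //; lia.
  by move=> i hi; rewrite /upd /= neqF ?F3.2 //= ?fr3 //; lia.
move=> k bg s1 [oa fr2 p3 fr3] _ _ le F; split=> //.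
  by move: le; rewrite /s0 /= /upd /=; lia.
by move: oa; rewrite /heap_arcs (_ : 2 * n - 1 - 1 = 2 * n - 2) //; lia.
Qed.

(** Array 1 lists the order from cell 1 on, so the vertex before an exclusive right end is found at
    the cell of that end itself, while left ends need [+ 1]. Array 26 remembers where the arcs of
    each side begin, for later rereading by [alg3]. *)
Definition post_boxes : prog :=
  26 @{'#0} <~ 'R 8 ;; 5 <~ '#0 ;;
  PFor 5 20
    (10 <~ 27 @['#4 *! 'R 5] ;; 11 <~ 27 @['#4 *! 'R 5 +! '#1] ;;
     14 <~ 27 @['#4 *! 'R 5 +! '#2] ;; 15 <~ 27 @['#4 *! 'R 5 +! '#3] ;;
     6 <~ 'R 0 +! '#4 *! 'R 5 ;;
     1 @{'R 6 +! '#1} <~ 1 @['R 10 +! '#1] ;; 1 @{'R 6 +! '#2} <~ 1 @['R 11] ;;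
     1 @{'R 6 +! '#3} <~ 1 @['R 14 +! '#1] ;; 1 @{'R 6 +! '#4} <~ 1 @['R 15] ;;
     7 <~ '#2 *! 'R 0 +! '#2 *! 'R 5 -: '#1 ;;
     12 <~ 'R 0 +! 'R 10 ;; 13 <~ 'R 0 +! 'R 11 ;; canon_arcs ;;
     26 @{'#2 *! 'R 5 +! '#1} <~ 'R 8 ;;
     7 <~ 'R 7 +! '#1 ;;
     12 <~ 'R 0 +! 'R 14 ;; 13 <~ 'R 0 +! 'R 15 ;; canon_arcs ;;
     26 @{'#2 *! 'R 5 +! '#2} <~ 'R 8).

(* Offsets in the list of arcs, kept in array 26. *)
Definition offs n bs t (s : state) : Prop :=
  (forall u, u <= t -> arrs s 26 (2 * u) = size (arcs n bs u)) /\
  (forall u, u < t -> arrs s 26 (2 * u + 1) =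
     size (arcs n bs u) + size (canonX n (nth b0 bs u))).

Definition box_in (n : nat) (b : box) : bool :=
  [&& b.1.1 < b.1.2, b.1.2 <= n & b.2.1 < b.2.2 <= n].

Lemma size_canon_box n b : box_in n b ->
  size (canonX n b) <= 2 * lg (2 * n) /\ size (canonY n b) <= 2 * lg (2 * n).
Proof.
move=> /and3P[h1 h2 h3]; split; apply: leq_trans (size_canon _ _) _;
  rewrite leq_mul2l /=; apply: leq_lg; lia.
Qed.

Lemma size_arcs n (bs : seq box) t : {in bs, forall b, box_in n b} -> t <= size bs ->
  size (arcs n bs t) <= 2 * n + 4 * (lg (2 * n) * t).
Proof.
move=> wf; elim: t => [|t IH] ht.
  by rewrite /arcs cats0 size_map size_iota; lia.
rewrite arcsS size_cat /box_arcs size_cat !size_map.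
have [h1 h2] := size_canon_box (wf _ (mem_nth b0 ht)).
apply: leq_trans (leq_add (IH (ltnW ht)) (leq_add h1 h2)) _.
by rewrite mulnS; clear; lia.
Qed.

Lemma at_wboxes (f : nat -> nat) (bs : seq box) t :
  at_ f 0 (flatten (map wbox bs)) -> t < size bs ->
  let b := nth b0 bs t in
  [/\ f (4 * t) = b.1.1, f (4 * t + 1) = b.1.2,
      f (4 * t + 2) = b.2.1 & f (4 * t + 3) = b.2.2].
Proof.
elim: bs f t => // b bs IH f t /=.
rewrite -[_ :: _]/(wbox b ++ _) at_cat => -[hb hs].
case: t => [_|t ht] /=.
  by move: hb; rewrite /wbox !at_cons => -[-> [-> [-> [-> _]]]].
have [|h1 h2 h3 h4] := IH (fun i => f (4 + i)) t _ ht.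
  by move=> i hi; rewrite add0n hs.
by rewrite -h1 -h2 -h3 -h4; split; congr f; lia.
Qed.

Lemma post_boxesP w n (bs : seq box) o s :
  regs s 0 = n -> 0 < n -> outb bs s -> {in bs, forall b, box_in n b} ->
  size o = n -> at_ (arrs s 1) 1 o -> outa (n + 3) (heap_arcs n) s ->
  10 * n + 8 * (lg (2 * n) * size bs) + 20 * lg (2 * n) + 20 * size bs + 100
    < 2 ^ w ->
  wp w post_boxes s (fun k s' => [/\
    k <= (200 * lg (2 * n) + 300) * size bs + 30,
    at_ (arrs s' 1) 1 (o ++ flatten [seq wquad o b | b <- bs]),
    outa (n + 3) (arcs n bs (size bs)) s', offs n bs (size bs) s' &
    (forall i, i < n + 3 -> arrs s' 2 i = arrs s 2 i)]).
Proof.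
move=> h0 n0 [h20 hbs] wf so ho oa W; have w1 : 1 < 2 ^ w by lia.
case: (oa) => h9 h8 _.
apply: wp_seq; warr; first lia.
apply: wp_seq; wreg; first lia.
set s0 := set_reg _ _ _.
pose I t (b : nat) s' := [/\
  at_ (arrs s' 1) 1 (o ++ flatten [seq wquad o b | b <- take t bs]),
  outa (n + 3) (arcs n bs t) s', offs n bs t s' &
  (forall i, i < n + 3 -> arrs s' 2 i = arrs s 2 i)].
apply: (@wp_for _ _ _ _ I (200 * lg (2 * n) + 200) (size bs) 0) => //.
- by rewrite /s0 /= /upd /=; lia.
- rewrite /s0 /I /= /upd /= take0 cats0; split=> //.
    by rewrite /arcs /= cats0.
  rewrite /offs /= /upd /=; split=> // u; rewrite leqn0 => /eqP->.
  by rewrite muln0 h8 /arcs /= cats0.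
- rewrite /s0 /= /upd /= => t bg s1 ht e5 e20 F [o1 oa1 [of1 of2] fr1].
  have e0 : regs s1 0 = n by rewrite F.1.
  have a27 : arrs s1 27 = arrs s 27 by rewrite F.2.
  have [b1 b2 b3 b4] := at_wboxes hbs ht.
  set b := nth b0 bs t in b1 b2 b3 b4.
  have /and3P[wb1 wb2 wb3] : box_in n b by apply: wf; apply: mem_nth.
  have lt4 : 4 * t + 10 < 2 ^ w by clear - W ht; lia.
  have nw : 4 * n + 10 < 2 ^ w by clear - W; lia.
  do 4 (apply: wp_seq; wreg; first by
    rewrite /= /upd /= e5; clear - lt4; do !split=> //; lia).
  rewrite /= /upd /= e5 a27 b1 b2 b3 b4.
  apply: wp_seq; wreg; first by
    rewrite /= /upd /= e5 e0; clear - W ht; do !split=> //; lia.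
  rewrite /= /upd /= e0 e5.
  do 4 (apply: wp_seq; warr; try (by rewrite /= /upd /=; clear - W ht wb1 wb2 wb3;
    do !split=> //; lia)).
  rewrite /= /upd /=.
  have or i : i < n -> arrs s1 1 (i + 1) = nth 0 o i.
    move=> hi; move: o1; rewrite at_cat => -[/(_ i) h _].
    by rewrite addnC h // so.
  have orp i : 0 < i <= n -> arrs s1 1 i = nth 0 o (i - 1).
    by move=> hi; rewrite -or; [congr (arrs s1 1 _)|]; lia.
  set s2 := set_arr _ _ _ _.
  have q1 : at_ (arrs s2 1) 1 (o ++ flatten [seq wquad o b | b <- take t.+1 bs]).
    rewrite (take_nth b0) // map_rcons flatten_rcons catA at_cat; split.
      move: o1; apply: eq_at => i; rewrite /s2 /= /upd /=.
      rewrite size_cat so size_wquads (size_takel (ltnW ht)).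
      by move=> hi; rewrite !neqF //; lia.
    rewrite size_cat so size_wquads (size_takel (ltnW ht)).
    rewrite /wquad !at_cons /s2 /= /upd /=.
    rewrite -/b; clear - or orp wb1 wb2 wb3 so.
    by split; [|split; [|split; [|split=> //]]];
      do ?(case: eqP => ?; try lia); rewrite ?(or, orp) //; lia.
  have oa2 : outa (n + 3) (arcs n bs t) s2 by [].
  have sza : size (arcs n bs t) <= 2 * n + 4 * (lg (2 * n) * size bs).
    apply: leq_trans (size_arcs wf (ltnW ht)) _.
    by rewrite leq_add2l leq_mul2l /= leq_mul2l ltnW ?orbT.
  have [sX sY] : size (canonX n b) <= 2 * lg (2 * n) /\ size (canonY n b) <= 2 * lg (2 * n).
    by apply: size_canon_box; apply: wf; apply: mem_nth.
  have lgX : lg (n + b.1.2) <= lg (2 * n) by apply: leq_lg; lia.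
  have lgY : lg (n + b.2.2) <= lg (2 * n) by apply: leq_lg; lia.
  apply: wp_seq; wreg; first by
    rewrite /= /upd /= e0 e5; clear - W ht n0; do !split=> //; lia.
  apply: wp_seq; wreg; first by
    rewrite /= /upd /= e0; clear - nw wb1 wb2; do !split=> //; lia.
  apply: wp_seq; wreg; first by
    rewrite /= /upd /= e0; clear - nw wb1 wb2; do !split=> //; lia.
  rewrite /= /upd /= e0 e5.
  set s3 := set_reg _ _ _.
  have oa3 : outa (n + 3) (arcs n bs t) s3 by [].
  apply: wp_seq; apply: wp_mono (@canon_arcsP _ _ _ _ (n + b.1.1) (n + b.1.2) oa3 _ _ _ _) _ => //.
  + by clear - n0; lia.
  + by clear - sza W lgX wb2; lia.
  rewrite -/(canonX n b) {3}/s3 /= /upd /= => k4 s4 F4 [hk4 oa4 fr4].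
  have G4 r : r \notin [:: 8; 12; 13] -> regs s4 r = regs s3 r.
    by move=> hr; rewrite F4.1 //; move: hr; rewrite !inE !negb_or => /and3P[h1 h2 h3];
      rewrite ?h1 ?h2 ?h3.
  have sz4 : size (arcs n bs t ++ [seq (2 * n + 2 * t - 1, i - 1) | i <- canonX n b])
     = size (arcs n bs t) + size (canonX n b) by rewrite size_cat size_map.
  case: (oa4) => _ e8 _; rewrite sz4 in e8.
  have g7 : regs s4 7 = 2 * n + 2 * t - 1 by rewrite G4.
  have g0 : regs s4 0 = n by rewrite G4.
  have g5 : regs s4 5 = t by rewrite G4.
  have g14 : regs s4 14 = b.2.1 by rewrite G4.
  have g15 : regs s4 15 = b.2.2 by rewrite G4.
  apply: wp_seq; warr; first by rewrite g5; clear - W ht; do !split=> //; lia.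
  apply: wp_seq; wreg; first by rewrite g7; clear - W ht; do !split=> //; lia.
  apply: wp_seq; wreg; first by
    rewrite /= /upd /= g0 g14; clear - nw wb3; do !split=> //; lia.
  apply: wp_seq; wreg; first by
    rewrite /= /upd /= g0 g15; clear - nw wb3; do !split=> //; lia.
  rewrite /= /upd /= g7 g0 g5 g14 g15 e8.
  have -> : 2 * n + 2 * t - 1 + 1 = 2 * n + 2 * t by clear - n0; lia.
  set s5 := set_reg _ _ _.
  have oa5 : outa (n + 3) (arcs n bs t ++ [seq (2 * n + 2 * t - 1, i - 1) | i <- canonX n b]) s5.
    by [].
  apply: wp_seq; apply: wp_mono (@canon_arcsP _ _ _ _ (n + b.2.1) (n + b.2.2) oa5 _ _ _ _) _ => //.
  + by clear - n0; lia.
  + by rewrite sz4; clear - sza W lgX lgY wb3 sX; lia.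
  rewrite -/(canonY n b) {3}/s5 /= /upd /= => k6 s6 F6 [hk6 oa6 fr6].
  have e5' : regs s6 5 = t by rewrite F6.1 // /s5 /= /upd /= G4 // /s3 /= /upd /=.
  have oa6' : outa (n + 3) (arcs n bs t.+1) s6 by rewrite arcsS /box_arcs catA.
  case: (oa6') => _ e8' _.
  warr; first by rewrite e5'; clear - W ht; do !split=> //; lia.
  have a26 : arrs s6 26 = upd (arrs s1 26) (2 * t + 1) (size (arcs n bs t) + size (canonX n b)).
    rewrite F6.2 // /s5 /=.
    by rewrite {1}/upd /= F4.2.
  have a1 : arrs s6 1 = arrs s2 1 by rewrite F6.2 // /s5 /= /upd /= F4.2.
  exists 0; split.
    by clear - hk4 hk6 lgX lgY; lia.
  rewrite /= e5' e8'; split=> //=.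
  + by rewrite /upd /= a1.
  + rewrite /offs /= /upd /= a26; split=> u hu; rewrite /upd.
      case: eqP => [e|ne]; first by have -> : u = t.+1 by clear - e; lia.
      rewrite neqF; first by apply: of1; clear - hu ne; lia.
      by clear; lia.
    rewrite neqF; last by clear; lia.
    case: eqP => [e|ne]; first by have -> : u = t by clear - e; lia.
    by apply: of2; clear - hu ne; lia.
  move=> i hi; rewrite /upd /= fr6 // /s5 /= /upd /= fr4 // /s3 /=.
  exact: fr1.
move=> k bg s1 [o1 oa1 of1 fr1] _ _ le F; split=> //.
  by move: le; rewrite /s0 /= /upd /= subn0; clear; lia.
by rewrite take_size in o1.
Qed.

(** The header of array 2 comes last because the numbers of nodes and arcs are known only after all
    boxes; the compressed edges follow the arcs directly. *)
Definition post_dag : prog :=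
  2 @{'#0} <~ '#2 *! 'R 0 +! '#2 *! 'R 20 -: '#1 ;;
  2 @{'#1} <~ 'R 8 ;; 2 @{'#2} <~ 'R 20 ;;
  6 <~ 'R 9 +! '#2 *! 'R 8 ;; 5 <~ '#0 ;;
  PFor 5 20
    (2 @{'R 6 +! '#2 *! 'R 5} <~ '#2 *! 'R 0 +! '#2 *! 'R 5 -: '#1 ;;
     2 @{'R 6 +! '#2 *! 'R 5 +! '#1} <~ '#2 *! 'R 0 +! '#2 *! 'R 5) ;;
  1 @{'#0} <~ 'R 20 ;; 3 @{'#0} <~ 'R 0 ;; 3 @{'#1} <~ '#2 *! 'R 0 -: '#1 ;;
  3 @{'#2} <~ '#0.

Lemma post_dagP w n q ar sk s :
  regs s 0 = n -> 0 < n -> regs s 20 = q -> outa (n + 3) ar s ->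
  size sk = n -> at_ (arrs s 2) 3 sk ->
  10 * n + 10 * q + 2 * size ar + 100 < 2 ^ w ->
  wp w post_dag s (fun k s' => [/\ k <= 100 * q + 100,
    at_ (arrs s' 2) 0 ([:: 2 * n + 2 * q - 1; size ar; q] ++ sk ++ wpairs ar
                        ++ wpairs (box_pairs n q)),
    arrs s' 1 = upd (arrs s 1) 0 q,
    at_ (arrs s' 3) 0 [:: n; 2 * n - 1; 0] &
    forall i, 2 < i -> arrs s' 3 i = arrs s 3 i]).
Proof.
move=> h0 n0 h20 [h9 h8 har] ssk hsk W; have w1 : 1 < 2 ^ w by lia.
apply: wp_seq; warr; try (by rewrite ?h0 ?h20; do ?split=> //; lia).
do 2 (apply: wp_seq; warr; try lia).
apply: wp_seq; wreg; first by rewrite h9 h8; do ?split=> //; lia.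
apply: wp_seq; wreg; first lia.
rewrite /= /upd /= h0 h20 h9 h8; set s0 := set_reg _ _ _.
have [hd hdE] : {hd | hd = [:: 2 * n + 2 * q - 1; size ar; q] ++ sk ++ wpairs ar}.
  by eexists.
have sh : size hd = n + 3 + 2 * size ar by rewrite hdE !size_cat size_wpairs ssk /=; lia.
pose I t (b : nat) s' := at_ (arrs s' 2) 0 (hd ++ wpairs (box_pairs n t)).
apply: wp_seq; apply: (@wp_for _ _ _ _ I 60 q 0) => //.
- by rewrite /s0 /= /upd /=; lia.
- rewrite /I /= cats0 /s0 /= hdE /= !at_cons at_cat /= /upd /=.
  do 3 (split=> //); split.
    by move: hsk; apply: eq_at => i hi; rewrite !neqF //; lia.
  rewrite ssk (addnC 3 n); move: har; apply: eq_at => i hi; rewrite !neqF //; lia.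
- rewrite /s0 /= /upd /= => t bg s1 ht e5 e20 F h1.
  have e0 : regs s1 0 = n by rewrite F.1.
  have e6 : regs s1 6 = n + 3 + 2 * size ar by rewrite F.1.
  apply: wp_seq; warr; try (by rewrite ?e0 ?e5 ?e6; do ?split=> //; lia).
  warr; try (by rewrite ?e0 ?e5 ?e6; do ?split=> //; lia).
  rewrite e0 e5 e6; exists 0; split; first lia.
  have sb : size (box_pairs n t) = t by rewrite size_mkseq.
  rewrite /I /= /upd /= /box_pairs mkseqS wpairs_rcons catA at_cat; split.
    move: h1; apply: eq_at => i; rewrite size_cat sh size_wpairs sb => hi.
    by rewrite !neqF //; lia.
  rewrite size_cat sh size_wpairs size_mkseq /= !at_cons /=.
  by split; [|split=> //]; do ?(case: eqP => ?; try lia).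
move=> k bg s1 h1 e5 e20 le F.
have e0 : regs s1 0 = n by rewrite F.1.
do 3 (apply: wp_seq; warr; try (by rewrite ?e0; do ?split=> //; lia)); warr; try lia.
rewrite /= /upd /= e0 e20.
have a1 : arrs s1 1 = arrs s 1 by rewrite F.2.
have a3 : arrs s1 3 = arrs s 3 by rewrite F.2.
split=> //=.
- by move: le; rewrite /s0 /= /upd /=; lia.
- by rewrite /upd /=; move: h1; rewrite /I hdE /= -catA.
- by rewrite /upd /= a1.
- by rewrite !at_cons /= /upd /=.
move=> i hi; rewrite /upd /= a3 !neqF //; lia.
Qed.

(** The canonical nodes need not be recomputed: they are the heads of the arcs in array 2, at the
    offsets kept in array 26. The program forms the products of these lists box by box. *)
Definition alg3 : prog :=
  10 <~ '#0 ;; 5 <~ '#0 ;; 13 <~ '#3 *! 'R 0 +! '#3 ;;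
  PFor 5 20
    (6 <~ 26 @['#2 *! 'R 5] ;; 7 <~ 26 @['#2 *! 'R 5 +! '#1] ;;
     8 <~ 26 @['#2 *! 'R 5 +! '#2] ;;
     PFor 6 7
       (12 <~ 'R 7 ;;
        PFor 12 8
          (3 @{'R 13 +! '#2 *! 'R 10} <~ 2 @['R 9 +! '#2 *! 'R 6 +! '#1] ;;
           3 @{'R 13 +! '#2 *! 'R 10 +! '#1} <~ 2 @['R 9 +! '#2 *! 'R 12 +! '#1] ;;
           10 <~ 'R 10 +! '#1))) ;;
  3 @{'#3} <~ 'R 10.

Lemma nth_cat_r (T : Type) (x : T) s1 s2 i :
  nth x (s1 ++ s2) (size s1 + i) = nth x s2 i.
Proof. by rewrite nth_cat ltnNge leq_addr /= addKn. Qed.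

Lemma nth_arcs n bs q t : t < q ->
  (forall i, i < size (canonX n (nth b0 bs t)) ->
    size (arcs n bs t) + i < size (arcs n bs q) /\
    (nth (0, 0) (arcs n bs q) (size (arcs n bs t) + i)).2 =
      nth 0 (canonX n (nth b0 bs t)) i - 1) /\
  (forall i, i < size (canonY n (nth b0 bs t)) ->
    size (arcs n bs t) + size (canonX n (nth b0 bs t)) + i < size (arcs n bs q) /\
    (nth (0, 0) (arcs n bs q)
       (size (arcs n bs t) + size (canonX n (nth b0 bs t)) + i)).2 =
      nth 0 (canonY n (nth b0 bs t)) i - 1).
Proof.
move=> tq; have [rest ->] : exists rest, arcs n bs q =
    (arcs n bs t ++ box_arcs n t (nth b0 bs t)) ++ rest.
  elim: q tq => // q IH; rewrite ltnS leq_eqVlt => /predU1P[->|/IH[r e]].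
    by exists [::]; rewrite cats0 arcsS.
  by exists (r ++ box_arcs n q (nth b0 bs q)); rewrite arcsS e catA.
rewrite /box_arcs; set X := canonX _ _; set Y := canonY _ _.
split=> i hi; (split; first by rewrite !size_cat !size_map; lia).
  rewrite -(catA (arcs n bs t)) nth_cat_r -catA nth_cat size_map hi.
  by rewrite (nth_map 0).
rewrite -(catA (arcs n bs t)) -addnA nth_cat_r -catA.
rewrite -(size_map (fun i => (2 * n + 2 * t - 1, i - 1)) X) nth_cat_r.
by rewrite nth_cat size_map hi (nth_map 0).
Qed.

(** The offset [3 * n + 3] is made of 4 header words, [2 * n - 1] parents and [n] leaves. *)
Definition outp (n : nat) (pl : seq (nat * nat)) (s0 s : state) : Prop :=
  [/\ regs s 13 = 3 * n + 3, regs s 10 = size pl,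
      at_ (arrs s 3) (3 * n + 3) (wpairs pl) &
      forall i, i < 3 * n + 3 -> arrs s 3 i = arrs s0 3 i].

Lemma size_tree_pairs n b :
  size (tree_pairs n b) = size (canonX n b) * size (canonY n b).
Proof. by rewrite size_allpairs. Qed.

Lemma alg3P w n (bs : seq box) z s :
  regs s 0 = n -> regs s 20 = size bs -> regs s 9 = n + 3 ->
  {in bs, forall b, box_in n b} -> offs n bs (size bs) s ->
  at_ (arrs s 2) (n + 3) (wpairs (arcs n bs (size bs))) ->
  at_ (arrs s 3) 0 [:: n; 2 * n - 1; 0] -> size z = 3 * n - 1 -> 0 < n ->
  at_ (arrs s 3) 4 z ->
  let pl := flatten [seq tree_pairs n b | b <- bs] in
  10 * n + 10 * size bs + 2 * size (arcs n bs (size bs)) + 2 * size pl + 100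
    < 2 ^ w ->
  wp w alg3 s (fun k s' =>
    k <= (200 * (lg (2 * n) * lg (2 * n)) + 60 * lg (2 * n) + 100) * size bs + 30 /\
    at_ (arrs s' 3) 0 ([:: n; 2 * n - 1; 0; size pl] ++ z ++ wpairs pl)).
Proof.
move=> h0 h20 h9 wf [of1 of2] har h3 sz n0 hz pl W; have w1 : 1 < 2 ^ w by lia.
set A := arcs n bs (size bs) in har W; set q := size bs in h20 of1 of2 W *.
apply: wp_seq; wreg; first lia.
apply: wp_seq; wreg; first lia.
apply: wp_seq; wreg; first by rewrite /= /upd /= h0; do ?split=> //; lia.
rewrite /= /upd /= h0; set s0 := set_reg _ _ _.
pose P t := flatten [seq tree_pairs n b | b <- take t bs].
have PS t : t < q -> P t.+1 = P t ++ tree_pairs n (nth b0 bs t).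
  by move=> tq; rewrite /P (take_nth b0) // map_rcons flatten_rcons.
have Ppl t : t <= q -> size (P t) <= size pl.
  by move=> tq; rewrite /pl -[X in map _ X](cat_take_drop t bs) map_cat flatten_cat size_cat leq_addr.
pose I t (b : nat) s' := outp n (P t) s s'.
pose L := lg (2 * n).
have rdA i : i < size A -> arrs s 2 (n + 3 + 2 * i + 1) = (nth (0, 0) A i).2.
  move=> hi; have [_ <-] := nth_wpairs hi.
  by rewrite -har ?size_wpairs; [congr (arrs s 2 _)|]; clear - hi; lia.
apply: wp_seq; apply: (@wp_for _ _ _ _ I (200 * (L * L) + 60 * L + 80) q 0) => //.
- by rewrite /s0 /= /upd /=; clear - W; lia.
- by rewrite /I /P take0 /outp /s0 /= /upd /=; split=> //; clear; lia.
- rewrite /s0 /= /upd /= => t bg s1 ht e5 e20 F oI.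
  have e0 : regs s1 0 = n by rewrite F.1.
  have e9 : regs s1 9 = n + 3 by rewrite F.1.
  have a2 : arrs s1 2 = arrs s 2 by rewrite F.2.
  have a26 : arrs s1 26 = arrs s 26 by rewrite F.2.
  set b := nth b0 bs t; set X := canonX n b; set Y := canonY n b.
  have [sX sY] : size X <= 2 * L /\ size Y <= 2 * L.
    by apply: size_canon_box; apply: wf; apply: mem_nth.
  have [nX nY] := @nth_arcs n bs q t ht; rewrite -/b -/X -/Y -/A in nX nY.
  set o0 := size (arcs n bs t) in nX nY.
  have o2E : size (arcs n bs t.+1) = o0 + size X + size Y.
    by rewrite arcsS size_cat /box_arcs size_cat !size_map addnA.
  have o2A : o0 + size X + size Y <= size A.
    have [y0|y0] := posnP (size Y); last first.
      by have [|] := nY (size Y).-1; [rewrite prednK|clear - y0; lia].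
    have [x0|x0] := posnP (size X); last first.
      by have [|] := nX (size X).-1; [rewrite prednK|clear - x0 y0; lia].
    rewrite x0 y0 !addn0 /A /o0 /arcs !size_cat leq_add2l.
    rewrite -/q -(subnKC (ltnW ht)) /mkseq iotaD map_cat flatten_cat size_cat.
    exact: leq_addr.
  have szP : size (P t) + size X * size Y <= size pl.
    by have := Ppl t.+1 ht; rewrite PS // size_cat size_tree_pairs.
  do 3 (apply: wp_seq; wreg; first by
    rewrite /= /upd /= ?e5; clear - W ht; do ?split=> //; lia).
  rewrite /= /upd /= e5 a26 of1 ?(ltnW ht) // of2 // -/b -/X -/o0.
  have -> : 2 * t + 2 = 2 * t.+1 by clear; lia.
  rewrite of1 // o2E; set s2 := set_reg _ _ _.
  (* Complete rows only: a prefix of [X] times all of [Y]. The invariant [K] of the inner loop adds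
     a prefix of the current row. *)
  pose J i (bg : nat) s' := outp n
     (P t ++ [seq (x - 1, y - 1) | x <- take (i - o0) X, y <- Y]) s s'.
  apply: (@wp_for _ _ _ _ J (48 * size Y + 20) (o0 + size X) 0) => //.
  + by rewrite /s2 /= /upd /=; clear - o2A W; lia.
  + by rewrite /J /s2 /= /upd /= subnn take0 /= cats0.
  + rewrite /s2 /= /upd /= => i bg2 s3 hi e6 e7 F3 oJ.
    have e8 : regs s3 8 = o0 + size X + size Y by rewrite F3.1.
    have e9' : regs s3 9 = n + 3 by rewrite F3.1.
    have a2' : arrs s3 2 = arrs s 2 by rewrite F3.2.
    have iX : i - o0 < size X by clear - hi; lia.
    have [iA vX] := nX _ iX.
    rewrite subnKC in iA vX; last by case/andP: hi.
    apply: wp_seq; wreg; rewrite e7; set s4 := set_reg _ _ _.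
    pose K j (bg : nat) s' := outp n
     ((P t ++ [seq (x - 1, y - 1) | x <- take (i - o0) X, y <- Y]) ++
       [seq (nth 0 X (i - o0) - 1, y - 1) | y <- take (j - (o0 + size X)) Y]) s s'.
    apply: (@wp_for _ _ _ _ K 40 (o0 + size X + size Y) 0) => //.
    * by rewrite /s4 /= /upd /=; clear - o2A W; lia.
    * by rewrite /K /s4 /= /upd /= subnn take0 /= cats0.
    * rewrite /s4 /= /upd /= => j bg3 s5 hj e12 e8' F5 oK.
      have e6' : regs s5 6 = i by rewrite F5.1.
      have e9'' : regs s5 9 = n + 3 by rewrite F5.1.
      have a2'' : arrs s5 2 = arrs s 2 by rewrite F5.2.
      have jY : j - (o0 + size X) < size Y by clear - hj; lia.
      have [jA vY] := nY _ jY.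
      rewrite subnKC in jA vY; last by case/andP: hj.
      case: oK; set R := _ ++ _ => e13 e10 at5 fr5.
      have szR : size R < size pl.
        apply: leq_trans szP; rewrite /R !size_cat size_allpairs size_map !size_takel;
          [|exact: ltnW|exact: ltnW].
        rewrite -addnA -addnS leq_add2l -addnS.
        apply: leq_trans (_ : (i - o0) * size Y + size Y <= _); first by rewrite leq_add2l.
        by rewrite addnC -mulSn leq_mul2r iX orbT.
      apply: wp_seq; warr.
      - by rewrite e13 e10; clear - W szR; do ?split=> //; lia.
      - by rewrite e9'' e6'; clear - W iA; do ?split=> //; lia.
      apply: wp_seq; warr.
      - by rewrite e13 e10; clear - W szR; do ?split=> //; lia.
      - by rewrite e9'' e12; clear - W jA; do ?split=> //; lia.
      wreg; first by rewrite e10; clear - W szR; do ?split=> //; lia.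
      rewrite /= /upd /= e13 e10 e9'' e6' e12 a2'' !rdA // vX vY.
      exists 0; split; first by clear; lia.
      rewrite /K (_ : j.+1 - (o0 + size X) = (j - (o0 + size X)).+1); last first.
        by clear - hj; lia.
      rewrite (take_nth 0) // map_rcons -rcons_cat -/R /outp /= /upd /= size_rcons.
      rewrite ?e13 ?e10 ?addn1; split=> //.
      + rewrite wpairs_rcons at_cat size_wpairs; split.
          move: at5; apply: eq_at => u; rewrite size_wpairs => hu.
          by rewrite !neqF //; clear - hu; lia.
        rewrite /= !at_cons /=; split; [|split=> //].
          by rewrite neqF ?eqxx //; clear; lia.
        by rewrite eqxx.
      by move=> u hu; rewrite !neqF ?fr5 //; clear - hu; lia.
    move=> k5 bg5 s5 oK e12 e8' le5 F5; exists 0; split.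
      by move: le5; rewrite /s4 /= /upd /=; clear; lia.
    move: oK; rewrite /K (_ : o0 + size X + size Y - (o0 + size X) = size Y); last first.
      by clear; lia.
    rewrite take_size /J.
    have -> : i.+1 - o0 = (i - o0).+1 by clear - hi; lia.
    by rewrite (take_nth 0) // allpairs_rcons catA.
  move=> k3 bg3 s3 oJ e6 e7 le3 F3; exists 0; split.
    move: le3; rewrite /s2 /= /upd /= (_ : o0 + size X - o0 = size X); last by clear; lia.
    have h1 : size Y * size X <= 4 * (L * L).
      by apply: leq_trans (leq_mul sY sX) _; clear; rewrite mulnACA.
    clear - h1 sX sY; rewrite mulnDl mulnDl; lia.
  move: oJ; rewrite /J (_ : o0 + size X - o0 = size X); last by clear; lia.
  by rewrite take_size /I PS.
move=> k bg s1 oI e5 e20 le F; case: oI => e13 e10 at1 fr1.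
rewrite /P take_size -/pl in e10 at1.
warr; first by clear - W; lia.
rewrite e10; split.
  by move: le; rewrite /s0 /= /upd /= subn0 -/L; clear; lia.
rewrite /= !at_cons at_cat /upd /=; split; [|split; [|split; [|split=> //]]].
- by rewrite fr1; [move: h3; rewrite !at_cons => -[]|clear - n0; lia].
- by rewrite fr1; [move: h3; rewrite !at_cons => -[_ []]|clear - n0; lia].
- by rewrite fr1; [move: h3; rewrite !at_cons => -[_ [_ []]]|clear - n0; lia].
split.
  move: hz; apply: eq_at => i hi; rewrite sz in hi.
  by rewrite neqF ?fr1 //; clear - hi; lia.
rewrite sz (_ : 4 + (3 * n - 1) = 3 * n + 3); last by clear - n0; lia.
by move: at1; apply: eq_at => i hi; rewrite neqF //; clear - hi n0; lia.
Qed.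

(** * Computing the leaf intervals of the tree *)

Definition cl (par : nat -> nat) (k u : nat) : seq nat :=
  [seq v <- iota 0 k | (par v == u) && (v != u)].

Lemma clS par k u : cl par k.+1 u =
  if (par k == u) && (k != u) then rcons (cl par k u) k else cl par k u.
Proof.
rewrite /cl -addn1 iotaD filter_cat /= add0n.
by case: ifP => _; rewrite ?cats1 ?cats0.
Qed.

Lemma mem_cl par k u v : (v \in cl par k u) = [&& v < k, par v == u & v != u].
Proof. by rewrite mem_filter mem_iota add0n leq0n andbC. Qed.

Definition load : prog :=
  0 <~ 0 @['#0] ;; 1 <~ 0 @['#1] ;; 3 <~ 0 @['#2] ;; 2 <~ 'R 3 +! 0 @['#3].

(** Arrays 4 and 5 hold the two children increased by one, so that 0 means none; register 4 receives
    the node that is its own parent. *)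
Definition get_children : prog :=
  5 <~ '#0 ;;
  PFor 5 1
    (6 <~ 0 @['R 5 +! '#4] ;;
     PIf ('R 6 =! 'R 5) (4 <~ 'R 5)
       (PIf (4 @['R 6]) (5 @{'R 6} <~ 'R 5 +! '#1) (4 @{'R 6} <~ 'R 5 +! '#1))).

(** The search only serves to list parents before children: sizes are then summed backwards along
    the queue and interval starts handed down forwards, without recursion. *)
Definition bfs : prog :=
  6 @{'#0} <~ 'R 4 ;; 7 <~ '#0 ;; 8 <~ '#1 ;;
  PWhile ('R 7 <! 'R 8)
    (6 <~ 6 @['R 7] ;; 7 <~ 'R 7 +! '#1 ;;
     PIf (4 @['R 6])
       (6 @{'R 8} <~ 4 @['R 6] -: '#1 ;; 6 @{'R 8 +! '#1} <~ 5 @['R 6] -: '#1 ;;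
        8 <~ 'R 8 +! '#2)
       PSkip).

Definition get_sizes : prog :=
  5 <~ 'R 1 ;;
  PWhile ('R 5)
    (5 <~ 'R 5 -: '#1 ;; 6 <~ 6 @['R 5] ;;
     PIf (4 @['R 6])
       (7 @{'R 6} <~ 7 @[4 @['R 6] -: '#1] +! 7 @[5 @['R 6] -: '#1])
       (7 @{'R 6} <~ '#1)).

Definition get_starts : prog :=
  8 @{'R 4} <~ '#0 ;; 5 <~ '#0 ;;
  PFor 5 1
    (6 <~ 6 @['R 5] ;;
     PIf (4 @['R 6])
       (8 @{4 @['R 6] -: '#1} <~ 8 @['R 6] ;;
        8 @{5 @['R 6] -: '#1} <~ 8 @['R 6] +! 7 @[4 @['R 6] -: '#1])
       PSkip).

Section TreePhases.

Variables (w n m r : nat) (par sz : nat -> nat).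
Let ch := cl par m.

Hypothesis par_lt : forall v, v < m -> par v < m.
Hypothesis rm : r < m.
Hypothesis par_r : par r = r.
Hypothesis par_fix : forall v, v < m -> par v = v -> v = r.
Hypothesis chP : forall u, u < m -> size (ch u) = 0 \/ size (ch u) = 2.
Hypothesis reach : forall P : nat -> Prop, P r ->
  (forall v, v < m -> v != r -> P (par v) -> P v) -> forall v, v < m -> P v.
Hypothesis sz_leaf : forall u, u < m -> size (ch u) = 0 -> sz u = 1.
Hypothesis sz_node : forall u, u < m -> size (ch u) = 2 ->
  sz u = sz (nth 0 (ch u) 0) + sz (nth 0 (ch u) 1).
Hypothesis sz_le : forall u, u < m -> sz u <= n.
Hypothesis wP : 2 * n + 2 * m + 20 < 2 ^ w.

Let w1 : 1 < 2 ^ w. Proof. by lia. Qed.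

Definition child_arrays k (s : state) : Prop :=
  forall u, u < m ->
    arrs s 4 u = nth 0 (map S (cl par k u)) 0 /\
    arrs s 5 u = nth 0 (map S (cl par k u)) 1.

Lemma leq_size_cl k u : k <= m -> size (cl par k u) <= size (ch u).
Proof.
by move=> km; rewrite /ch /cl -[X in _ <= size (filter _ (iota 0 X))](subnKC km) iotaD filter_cat size_cat leq_addr.
Qed.

Lemma get_childrenP s :
  regs s 1 = m -> (forall v, v < m -> arrs s 0 (4 + v) = par v) ->
  (forall u, arrs s 4 u = 0) -> (forall u, arrs s 5 u = 0) ->
  wp w get_children s (fun k s' =>
    [/\ k <= 50 * m + 20, regs s' 4 = r & child_arrays m s']).
Proof.
move=> h1 hp h4 h5.
apply: wp_seq; wreg; first lia.
set s0 := set_reg _ _ _.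
pose I k (b : nat) s' := child_arrays k s' /\ (r < k -> regs s' 4 = r).
apply: (@wp_for _ _ _ _ I 30 m 0) => //.
- by rewrite /s0 /= /upd /=; lia.
- by split=> // u um; rewrite /s0 /= h4 h5.
- rewrite /s0 /= /upd /= => v bg s1 hv e5 e1 F [ca h4'].
  have a0 : arrs s1 0 = arrs s 0 by rewrite F.2.
  apply: wp_seq; wreg; first by rewrite e5; do ?split=> //; lia.
  rewrite e5 a0 addnC hp //.
  have pm := par_lt hv.
  apply: wp_if => //=; rewrite /upd /= e5.
  + move=> c; have pv : par v = v by move: c; rewrite eqb0 negbK => /eqP.
    have vr := par_fix hv pv.
    wreg; rewrite /= /upd /= e5; exists 0; split; first lia.
    split=> // u um; have [c4 c5] := ca u um; rewrite /= clS pv.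
    by rewrite (_ : (v == u) && (v != u) = false) // andbN.
  move=> c; have pv : par v <> v by move/eqP: c; rewrite eqb0 => /eqP.
  have nvr : v != r by apply/eqP => e; apply: pv; rewrite e.
  have [c4 c5] := ca _ pm.
  have vin : v != par v by apply/eqP => e; apply: pv.
  (* A parent has at most two children and [v] is one of them, so one of the two cells is still
     free. *)
  have sz2 : size (cl par v (par v)) < 2.
    have := @leq_size_cl v.+1 (par v) hv; rewrite clS eqxx vin size_rcons /=.
    by case: (chP pm) => ->; lia.
  have up (f : nat) : f = v.+1 -> forall u, u < m -> u != par v ->
      cl par v.+1 u = cl par v u.
    by move=> _ u _ uv; rewrite clS eq_sym (negbTE uv).
  apply: wp_if => //=; rewrite /upd /= => d.
  + warr; first by rewrite /= /upd /= e5; do ?split=> //; lia.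
    rewrite /= /upd /= e5 addn1; exists 0; split; first lia.
    split; last by rewrite /= => h; apply: h4'; move: nvr; lia.
    move=> u um; have [d4 d5] := ca u um; rewrite /= /upd /=.
    have [->|nu] := eqVneq u (par v); last by rewrite (up v.+1).
    rewrite clS eqxx vin /= c4 map_rcons !nth_rcons size_map; move: sz2 d.
    by rewrite c4 ?addn1; case: (cl par v (par v)) => [|x [|y l]] //.
  warr; first by rewrite /= /upd /= e5; do ?split=> //; lia.
  rewrite /= /upd /= e5 addn1; exists 0; split; first lia.
  split; last by rewrite /= => h; apply: h4'; move: nvr; lia.
  move=> u um; have [d4 d5] := ca u um; rewrite /= /upd /=.
  have [->|nu] := eqVneq u (par v); last by rewrite (up v.+1).
  rewrite clS eqxx vin /= c5 map_rcons !nth_rcons size_map; move: sz2 d.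
  by rewrite c4 ?addn1; case: (cl par v (par v)) => [|x [|y l]] //.
move=> k bg s1 [ca h] _ _ le F; split=> //; last exact: h.
by move: le; rewrite /s0 /= /upd /=; lia.
Qed.

Definition topo (ql : seq nat) : Prop :=
  [/\ uniq ql, size ql = m, forall v, (v \in ql) = (v < m) &
      forall x, x < m -> x != r -> index (par x) ql < index x ql].

Lemma child_arraysE s u : child_arrays m s -> u < m ->
  (arrs s 4 u = 0 /\ size (ch u) = 0) \/
  [/\ arrs s 4 u != 0, size (ch u) = 2, arrs s 4 u = (nth 0 (ch u) 0).+1 &
      arrs s 5 u = (nth 0 (ch u) 1).+1].
Proof.
move=> ca um; have [-> ->] := ca u um; rewrite -/(ch u).
case: (chP um) => e; [left|right].
  by rewrite (size0nil e).
by case: (ch u) e => [|x [|y [|z l]]].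
Qed.

Lemma chE u v : (v \in ch u) = [&& v < m, par v == u & v != u].
Proof. exact: mem_cl. Qed.

Lemma bfsP s :
  child_arrays m s -> regs s 4 = r ->
  wp w bfs s (fun k s' => k <= 60 * m + 30 /\
    exists ql, topo ql /\ at_ (arrs s' 6) 0 ql).
Proof.
move=> ca h4; apply: wp_seq; warr; first lia.
apply: wp_seq; wreg; first lia.
apply: wp_seq; wreg; rewrite h4; set s0 := set_reg _ _ _.
pose I b s' := exists ql h,
  [/\ [/\ regs s' 7 = h, regs s' 8 = size ql, at_ (arrs s' 6) 0 ql,
          h <= size ql & b = 60 * (m - h)],
      arrs s' 4 = arrs s 4 /\ arrs s' 5 = arrs s 5,
      [/\ uniq ql, {subset ql <= gtn m} & r \in ql],
      (forall i, i < h -> {subset ch (nth 0 ql i) <= ql}) &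
      (forall x, x \in ql -> x != r ->
         par x \in take h ql /\ index (par x) ql < index x ql)].
have szm (ql : seq nat) : uniq ql -> {subset ql <= gtn m} -> size ql <= m.
  move=> u sb; rewrite -[X in _ <= X](size_iota 0); apply: uniq_leq_size => // x /sb.
  by rewrite mem_iota inE add0n.
apply: (@wp_while _ _ _ I (60 * m)) => //.
- move=> b s1 [ql [h [[e7 e8 at1 hq ->] [a4 a5] [un sb rq] cl1 pr]]] /=.
  rewrite e7 e8 => c; have lt : h < size ql by move: c; case: ltnP.
  have qm := szm _ un sb.
  set u := nth 0 ql h.
  have uq : u \in ql by apply: mem_nth.
  have um : u < m by apply: sb.
  have ca1 : child_arrays m s1 by move=> x xm; rewrite a4 a5; apply: ca.
  have rd : arrs s1 6 h = u by have := at1 h lt; rewrite add0n.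
  apply: wp_seq; wreg; rewrite e7 rd.
  apply: wp_seq; wreg; first by rewrite /= /upd /= e7; do ?split=> //; lia.
  rewrite /= /upd /= e7 addn1.
  have tk : take h.+1 ql = rcons (take h ql) u by rewrite (take_nth 0).
  have pr' x : x \in ql -> x != r -> par x \in take h.+1 ql /\ index (par x) ql < index x ql.
    by move=> xq xr; have [p1 p2] := pr x xq xr; rewrite tk mem_rcons inE p1 orbT.
  apply: wp_if => //=.
  + rewrite /= /upd /= => c4.
    have [[e0 _]|[_ s2 e4 e5']] := child_arraysE ca1 um; first by rewrite e0 in c4.
    set c1 := nth 0 (ch u) 0 in e4; set c2 := nth 0 (ch u) 1 in e5'.
    have chu : ch u = [:: c1; c2] by rewrite /c1 /c2; case: (ch u) s2 => [|x [|y [|z l]]].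
    have c1u : c1 \in ch u by rewrite chu inE eqxx.
    have c2u : c2 \in ch u by rewrite chu !inE eqxx orbT.
    have c12 : c1 != c2.
      have : uniq (ch u) by rewrite filter_uniq // iota_uniq.
      by rewrite chu /= inE andbT.
    (* A child enters the queue only after its parent has been expanded, and [u], just being
       expanded, does not occur earlier in the duplicate-free queue. *)
    have new x : x \in ch u -> x \notin ql.
      rewrite chE => /and3P[xm /eqP px xu]; apply/negP => xq.
      have xr : x != r by apply: contra_neq xu => e; rewrite -px e par_r.
      have [] := pr x xq xr; rewrite px => ut _.
      move: un; rewrite -(cat_take_drop h ql) cat_uniq (drop_nth 0) // -/u /=.
      by rewrite ut andbF.
    have cm x : x \in ch u -> x < m by rewrite chE => /and3P[].
    apply: wp_seq; warr.
    + by rewrite /= /upd /= e4; have := cm _ c1u; do ?split=> //; lia.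
    apply: wp_seq; warr.
    + by rewrite /= /upd /= e8; do ?split=> //; lia.
    + by rewrite /= /upd /= e5'; have := cm _ c2u; do ?split=> //; lia.
    wreg; first by rewrite /= /upd /= e8; do ?split=> //; lia.
    rewrite /= /upd /= e8 e4 e5' !subn1 /=.
    exists (60 * (m - h.+1)); split; last by clear - lt qm; lia.
    have xr x : x \in ch u -> par x = u by rewrite chE => /and3P[_ /eqP].
    exists (ql ++ [:: c1; c2]), h.+1; rewrite /= /upd /= size_cat /=; split=> //.
    - split=> //; try lia.
      rewrite at_cat; split.
        by move: at1; apply: eq_at => i hi; rewrite !neqF //; lia.
      rewrite !at_cons add0n; split; [|split=> //].
        by rewrite neqF ?eqxx //; lia.
      by rewrite addn1 eqxx.
    - split; last by rewrite mem_cat rq.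
        rewrite cat_uniq un /= !inE c12 orbF !andbT negb_or !new //.
      by move=> x; rewrite mem_cat !inE => /or3P[/sb //|/eqP->|/eqP->]; apply: cm.
    - move=> i hi x; rewrite nth_cat (leq_trans hi lt) mem_cat.
      move: hi; rewrite ltnS leq_eqVlt => /predU1P[->|hi] xc; last by rewrite (cl1 i).
      by move: xc; rewrite -/u chu => ->; rewrite orbT.
    move=> x; rewrite mem_cat => /orP[xq|xc] nr.
      have [p1 p2] := pr' x xq nr; rewrite takel_cat // !index_cat xq (mem_take p1).
      by split.
    have {}xc : x \in ch u by rewrite chu.
    rewrite (xr x xc) takel_cat // tk mem_rcons inE eqxx; split=> //.
    rewrite !index_cat uq (negbTE (new x xc)).
    by apply: leq_trans (leq_addr _ _); rewrite index_mem.
  rewrite /= /upd /= => c4.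
  have [[_ s2]|[e0 _ _ _]] := child_arraysE ca1 um; last by rewrite c4 in e0.
  apply: wp_skip; exists (60 * (m - h.+1)); split; last by clear - lt qm; lia.
  exists ql, h.+1; rewrite /= /upd /=; split=> //.
  move=> i; rewrite ltnS leq_eqVlt => /predU1P[->|hi]; last exact: cl1.
  by rewrite -/u (size0nil s2).
- exists [:: r], 0; rewrite /s0 /= /upd /=; split=> //.
  + by split=> //; try lia; case=> //= _; rewrite addn0.
  + split; rewrite ?inE //.
    by move=> x; rewrite inE => /eqP->.
  by move=> x; rewrite inE => ->.
move=> k b s1 [ql [h [[e7 e8 at1 hq ->] [a4 a5] [un sb rq] cl1 pr]]] /=.
rewrite e7 e8 => c le F; have hE : h = size ql by move: c; case: ltnP => //; lia.
split; first by clear - le; lia.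
(* All members have been expanded, so the queue contains the root and is closed under children. *)
have all v : v < m -> v \in ql.
  apply: (@reach (fun v => v \in ql)) => // {}v vm vr pq.
  have := cl1 (index (par v) ql); rewrite hE index_mem pq nth_index // => /(_ isT v).
  apply; rewrite chE vm eqxx /=; apply: contra_neq vr => e.
  by apply: par_fix.
exists ql; split=> //; split=> //.
- apply/eqP; rewrite eqn_leq szm //= -{1}(size_iota 0 m).
  by apply: uniq_leq_size (iota_uniq _ _) _ => x; rewrite mem_iota add0n => /all.
- by move=> v; apply/idP/idP => [/sb|/all].
by move=> x xm xr; have [] := pr x (all x xm) xr.
Qed.

Lemma topo_child ql u x : topo ql -> u < m -> x \in ch u ->
  [/\ x < m, x != r, par x = u, x != u & index u ql < index x ql].
Proof.
move=> [_ _ _ tp] um; rewrite chE => /and3P[xm /eqP px xu].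
have xr : x != r by apply: contra_neq xu => e; rewrite -px e par_r.
by split=> //; rewrite -px tp.
Qed.

Lemma get_sizesP s ql :
  child_arrays m s -> regs s 1 = m -> topo ql -> at_ (arrs s 6) 0 ql ->
  wp w get_sizes s (fun k s' => k <= 60 * m + 20 /\
    forall u, u < m -> arrs s' 7 u = sz u).
Proof.
move=> ca h1 tpo hq; case: (tpo) => un sq mq tp.
apply: wp_seq; wreg; rewrite h1; set s0 := set_reg _ _ _.
pose I b s' := exists i,
  [/\ regs s' 5 = i, i <= m, b = 60 * i,
      [/\ arrs s' 4 = arrs s 4, arrs s' 5 = arrs s 5 & arrs s' 6 = arrs s 6] &
      forall j, i <= j < m -> arrs s' 7 (nth 0 ql j) = sz (nth 0 ql j)].
apply: (@wp_while _ _ _ I (60 * m)) => //.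
- move=> b s1 [i [e5 im -> [a4 a5 a6] hs]] /=; rewrite e5 -lt0n => i0.
  have im' : i - 1 < m by lia.
  apply: wp_seq; wreg; first by rewrite e5; do ?split=> //; lia.
  apply: wp_seq; wreg; rewrite /= /upd /= e5 a6.
  set u := nth 0 ql (i - 1).
  have -> : arrs s 6 (i - 1) = u by have := hq (i - 1); rewrite sq add0n => ->.
  have um : u < m by rewrite -mq mem_nth // sq.
  have ca1 : child_arrays m s1 by move=> x xm; rewrite a4 a5; apply: ca.
  have iu : index u ql = i - 1 by rewrite index_uniq ?sq.
  have fin (v : nat) : v = sz u -> forall j, i - 1 <= j < m ->
     (if nth 0 ql j == u then v else arrs s1 7 (nth 0 ql j)) = sz (nth 0 ql j).
    move=> vE j hj; case: eqP => [->//|ne]; apply: hs.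
    have : j <> i - 1 by move=> e; apply: ne; rewrite e.
    lia.
  apply: wp_if => //=; rewrite /= /upd /=.
  + move=> c4.
    have [[e0 _]|[_ s2 e4 e5']] := child_arraysE ca1 um; first by rewrite e0 in c4.
    set c1 := nth 0 (ch u) 0 in e4; set c2 := nth 0 (ch u) 1 in e5'.
    have c1u : c1 \in ch u by rewrite mem_nth // s2.
    have c2u : c2 \in ch u by rewrite mem_nth // s2.
    have [c1m _ _ _ i1] := topo_child tpo um c1u.
    have [c2m _ _ _ i2] := topo_child tpo um c2u.
    have ix1 : index c1 ql < m by rewrite -sq index_mem mq.
    have sz1 : arrs s1 7 c1 = sz c1.
      by rewrite -[c1](nth_index 0 (_ : c1 \in ql)) ?mq // hs //; lia.
    have ix2 : index c2 ql < m by rewrite -sq index_mem mq.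
    have sz2 : arrs s1 7 c2 = sz c2.
      by rewrite -[c2](nth_index 0 (_ : c2 \in ql)) ?mq // hs //; lia.
    have szu := sz_node um s2; have szl := sz_le um.
    rewrite -/c1 -/c2 in szu.
    warr.
    + rewrite /= /upd /= e4 e5' !subn1 /= sz1 sz2; do ?split=> //; lia.
    rewrite /= /upd /= e4 e5' !subn1 /= sz1 sz2.
    exists (60 * (i - 1)); split; last lia.
    exists (i - 1); rewrite /= /upd /=; split=> //; try lia; by apply: fin.
  move=> c4; have [[_ s2]|[e0 _ _ _]] := child_arraysE ca1 um; last by rewrite c4 in e0.
  warr; rewrite /= /upd /=.
  exists (60 * (i - 1)); split; last lia.
  exists (i - 1); rewrite /= /upd /=; split=> //; try lia; by apply: fin; rewrite sz_leaf.
- exists m; split=> // j; lia.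
move=> k b s1 [i [e5 im -> _ hs]] /=; rewrite e5 => i0 le F.
split; first by clear - le i0; lia.
move=> u um; rewrite -[u](nth_index 0 (_ : u \in ql)) ?mq // hs // i0 /=.
by rewrite -sq index_mem mq.
Qed.

Lemma get_startsP s ql :
  child_arrays m s -> regs s 1 = m -> regs s 4 = r -> topo ql ->
  at_ (arrs s 6) 0 ql -> (forall u, u < m -> arrs s 7 u = sz u) ->
  wp w get_starts s (fun k s' => [/\ k <= 60 * m + 20, arrs s' 8 r = 0 &
    forall u, u < m -> size (ch u) = 2 ->
      arrs s' 8 (nth 0 (ch u) 0) = arrs s' 8 u /\
      arrs s' 8 (nth 0 (ch u) 1) = arrs s' 8 u + sz (nth 0 (ch u) 0)]).
Proof.
move=> ca h1 h4 tpo hq hs; case: (tpo) => un sq mq tp.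
apply: wp_seq; warr; first lia.
apply: wp_seq; wreg; first lia.
rewrite /= h4; set s0 := set_reg _ _ _.
(* The last clause keeps every interval assigned so far within [n], which excludes overflow in the
   next addition. *)
pose I i (b : nat) s' := [/\ arrs s' 8 r = 0,
  forall j, j < i -> forall u, u = nth 0 ql j -> size (ch u) = 2 ->
      arrs s' 8 (nth 0 (ch u) 0) = arrs s' 8 u /\
      arrs s' 8 (nth 0 (ch u) 1) = arrs s' 8 u + sz (nth 0 (ch u) 0) &
  forall x, x < m -> (x == r) || (index (par x) ql < i) -> arrs s' 8 x + sz x <= n].
apply: (@wp_for _ _ _ _ I 50 m 0) => //.
- by rewrite /s0 /= /upd /=; lia.
- rewrite /s0 /I /= /upd /= eqxx; split=> // x xm; rewrite orbF => /eqP->.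
  by rewrite eqxx; apply: sz_le.
- rewrite /s0 /= /upd /= => i bg s1 im e5 e1 F [hr hj hx].
  have a4 : arrs s1 4 = arrs s 4 by rewrite F.2.
  have a5 : arrs s1 5 = arrs s 5 by rewrite F.2.
  have a6 : arrs s1 6 = arrs s 6 by rewrite F.2.
  have a7 : arrs s1 7 = arrs s 7 by rewrite F.2.
  apply: wp_seq; wreg; rewrite e5 a6.
  set u := nth 0 ql i.
  have -> : arrs s 6 i = u by have := hq i; rewrite sq add0n => ->.
  have um : u < m by rewrite -mq mem_nth // sq.
  have ca1 : child_arrays m s1 by move=> x xm; rewrite a4 a5; apply: ca.
  have iu : index u ql = i by rewrite index_uniq ?sq.
  have inj x y : x < m -> y < m -> index x ql = index y ql -> x = y.
    by move=> xm ym e; rewrite -[x](nth_index 0 (_ : x \in ql)) ?mq // e nth_index ?mq.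
  apply: wp_if => //=; rewrite /= /upd /=.
  + move=> c4.
    have [[e0 _]|[_ s2 e4 e5']] := child_arraysE ca1 um; first by rewrite e0 in c4.
    set c1 := nth 0 (ch u) 0 in e4; set c2 := nth 0 (ch u) 1 in e5'.
    have c1u : c1 \in ch u by rewrite mem_nth // s2.
    have c2u : c2 \in ch u by rewrite mem_nth // s2.
    have [c1m c1r p1 n1 i1] := topo_child tpo um c1u.
    have [c2m c2r p2 n2 i2] := topo_child tpo um c2u.
    have chu : ch u = [:: c1; c2] by rewrite /c1 /c2; case: (ch u) s2 => [|x [|y [|z l]]].
    have c12 : c1 != c2.
      have : uniq (ch u) by rewrite filter_uniq // iota_uniq.
      by rewrite chu /= inE andbT.
    have Lu : arrs s1 8 u + sz u <= n.
      apply: hx => //; case: (eqVneq u r) => //= ur; rewrite -iu; exact: tp.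
    have szu := sz_node um s2; rewrite -/c1 -/c2 in szu.
    apply: wp_seq; warr.
    + by rewrite /= /upd /= e4; do ?split=> //; lia.
    rewrite /= /upd /= e4 subn1 /=.
    warr.
    + by rewrite /= /upd /= e5'; do ?split=> //; lia.
    + rewrite /= /upd /= e4 subn1 /= a7 hs // (eq_sym u) (negbTE n1).
      by do ?split=> //; lia.
    rewrite /= /upd /= e4 e5' !subn1 /= a7 hs // !(eq_sym u) (negbTE n1).
    exists 0; split; first lia.
    rewrite /I /= /upd /=; split.
    - by rewrite !(eq_sym r) (negbTE c1r) (negbTE c2r).
    - move=> j; rewrite ltnS leq_eqVlt => /predU1P[->|ji] v.
        rewrite -/u => -> _; rewrite -/c1 -/c2 eqxx (negbTE c12) !(eq_sym u).
        by rewrite (negbTE n1) (negbTE n2) eqxx.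
      (* The two writes do not disturb an earlier [v]: it precedes [u] and thus the children of [u],
         and its own children have another parent. *)
      move=> vE s2v; have [l1 l2] := hj j ji v vE s2v.
      have vm : v < m by rewrite vE -mq mem_nth // sq (ltn_trans ji).
      have iv : index v ql = j by rewrite vE index_uniq // sq (ltn_trans ji).
      have dv c : c \in ch u -> (v == c) = false.
        move=> cu; have [_ _ _ _ ic] := topo_child tpo um cu.
        by apply: neqF => e; rewrite -e iv iu in ic; lia.
      have dc k c : k < 2 -> c \in ch u -> (nth 0 (ch v) k == c) = false.
        move=> k2 cu; have [_ _ pc _ _] := topo_child tpo um cu.
        have [|_ _ pv _ _] := @topo_child ql v (nth 0 (ch v) k) tpo vm.
          by rewrite mem_nth // s2v.
        apply: neqF => e; rewrite e pc in pv; rewrite -pv iu in iv.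
        by rewrite iv ltnn in ji.
      by rewrite !dv // !dc.
    move=> x xm hc; case: (eqVneq x c2) => [->|x2]; first by lia.
    case: (eqVneq x c1) => [->|x1]; first by lia.
    apply: hx => //; case/orP: hc => [->//|]; rewrite ltnS leq_eqVlt => /predU1P[e|->].
      have [->//|xr] := eqVneq x r.
      have px : par x = u by apply: inj => //; [apply: par_lt|rewrite e iu].
      have : x \in ch u.
        rewrite chE xm px eqxx /=; apply: contra_neq xr => e'.
        by apply: par_fix => //; rewrite px -e'.
      by rewrite chu !inE (negbTE x1) (negbTE x2).
    by rewrite orbT.
  move=> c4; have [[_ s2]|[e0 _ _ _]] := child_arraysE ca1 um; last by rewrite c4 in e0.
  apply: wp_skip; exists 0; split; first lia.
  rewrite /I /= /upd /=; split=> //.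
    move=> j; rewrite ltnS leq_eqVlt => /predU1P[->|ji] v; last exact: hj.
    by rewrite -/u => ->; rewrite s2.
  move=> x xm hc; apply: hx => //; case/orP: hc => [->//|].
  rewrite ltnS leq_eqVlt => /predU1P[e|->]; last by rewrite orbT.
  have [->//|xr] := eqVneq x r.
  have px : par x = u by apply: inj => //; [apply: par_lt|rewrite e iu].
  have : x \in ch u.
    rewrite chE xm px eqxx /=; apply: contra_neq xr => e'.
    by apply: par_fix => //; rewrite px -e'.
  by rewrite (size0nil s2).
move=> k bg s1 [hr hj hx] _ _ le F; split=> //.
  by move: le; rewrite /s0 /= /upd /=; lia.
move=> u um; apply: (hj (index u ql)); rewrite ?nth_index ?mq //.
by rewrite -sq index_mem mq.
Qed.

End TreePhases.

(** * Ancestors and leaf intervals *)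

Section TreeMath.

Variables (T V : finType) (par : T -> T) (lf : V -> T).
Hypothesis fbt : full_binary_tree par.
Hypothesis lf_inj : injective lf.
Hypothesis lfP : forall u, is_leaf par u <-> exists x, u = lf x.

Lemma ancP u v : reflect (exists k, iter k par v = u) (anc par u v).
Proof.
apply: (iffP idP) => [h|[k <-]]; last exact: fconnect_iter.
by exists (findex par v u); apply: iter_findex.
Qed.

Lemma anc_refl u : anc par u u. Proof. exact: connect0. Qed.

Lemma anc_trans u v x : anc par u v -> anc par v x -> anc par u x.
Proof. by move=> uv vx; apply: connect_trans vx uv. Qed.

Lemma tree_ind (P : T -> Prop) : (forall v, par v = v -> P v) ->
  (forall v, par v != v -> P (par v) -> P v) -> forall v, P v.
Proof.
move=> h0 hS v; have [[r pr hr] _] := fbt.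
have /ancP[k] := hr v; elim: k v => [|k IH] v; first by move=> /= ->; apply: h0.
rewrite iterSr => /IH h; have [e|ne] := eqVneq (par v) v; first exact: h0.
exact: hS.
Qed.

(** Two nodes above each other would lie on a cycle of [par]; but iterating [par] ends at the root,
    which is fixed, so the cycle is trivial. *)
Lemma anc_antisym u v : anc par u v -> anc par v u -> u = v.
Proof.
move=> /ancP[a ea] /ancP[b eb]; have [[r pr hr] _] := fbt.
have fr k : iter k par r = r by elim: k => //= k ->.
have /ancP[j ej] := hr v.
have per k : iter (k * (b + a)) par v = v.
  by elim: k => //= k IH; rewrite mulSn iterD IH iterD ea eb.
have [/eqP|pos] := posnP (b + a).
  by rewrite addn_eq0 => /andP[_ /eqP a0]; rewrite -ea a0.
have vr : v = r.
  rewrite -(per j) -(subnK (_ : j <= j * (b + a))) ?iterD ?ej ?fr //.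
  by rewrite leq_pmulr.
by rewrite -ea vr fr.
Qed.

Lemma anc_child w u : anc par w u -> u != w ->
  exists2 v, v \in children par w & anc par v u.
Proof.
move=> /ancP[k]; elim: k => [/= ->|k IH]; first by rewrite eqxx.
rewrite iterS => e uw; have [/IH/(_ uw)//|ne] := eqVneq (iter k par u) w.
exists (iter k par u); last by apply/ancP; exists k.
by rewrite inE e eqxx.
Qed.

Lemma anc_leaf w u : is_leaf par w -> anc par w u -> u = w.
Proof.
move=> /eqP l a; have [//|ne] := eqVneq u w.
by have [v] := anc_child a ne; rewrite l inE.
Qed.

Lemma leaf_lf x : is_leaf par (lf x). Proof. by apply/lfP; exists x. Qed.

Lemma childrenP u v : reflect (par v = u /\ v != u) (v \in children par u).
Proof. by rewrite inE; apply: (iffP andP) => [[/eqP]|[->]]. Qed.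

Lemma anc_par u v : v \in children par u -> anc par u v.
Proof. by move=> /childrenP[<- _]; apply: fconnect1. Qed.

Lemma children_disj u v1 v2 y : v1 \in children par u -> v2 \in children par u ->
  anc par v1 y -> anc par v2 y -> v1 = v2.
Proof.
have key a b : a \in children par u -> b \in children par u -> anc par b a -> a = b.
  move=> /childrenP[pa na] /childrenP[pb nb] /ancP[[|k]] //=; rewrite -iterS iterSr pa => e.
  have bu : anc par b u by apply/ancP; exists k.
  have ub : anc par u b by apply: anc_par; apply/childrenP.
  by rewrite (anc_antisym bu ub) eqxx in nb.
move=> c1 c2 /ancP[a ea] /ancP[b eb]; case: (leqP a b) => ab.
  by apply: key => //; apply/ancP; exists (b - a); rewrite -ea -iterD subnK.
by apply/esym/key => //; apply/ancP; exists (a - b); rewrite -eb -iterD subnK // ltnW.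
Qed.

Definition leaves (u : T) : {set V} := [set x | anc par u (lf x)].
Definition sz (u : T) : nat := #|leaves u|.

Lemma sz_leaf u : is_leaf par u -> sz u = 1.
Proof.
move=> l; have /lfP[x ux] := l.
rewrite /sz (_ : leaves u = [set x]) ?cards1 //; apply/setP => y; rewrite !inE.
apply/idP/eqP => [/(anc_leaf l)|->]; last by rewrite ux anc_refl.
by rewrite ux => /lf_inj.
Qed.

Lemma sz_node u v1 v2 : children par u = [set v1; v2] -> v1 != v2 ->
  sz u = sz v1 + sz v2.
Proof.
move=> c n12; have c1 : v1 \in children par u by rewrite c !inE eqxx.
have c2 : v2 \in children par u by rewrite c !inE eqxx orbT.
rewrite /sz (_ : leaves u = leaves v1 :|: leaves v2).
  rewrite cardsU (_ : leaves v1 :&: leaves v2 = set0) ?cards0 ?subn0 //.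
  apply/setP => y; rewrite !inE; apply/negP => /andP[a1 a2].
  by rewrite (children_disj c1 c2 a1 a2) eqxx in n12.
apply/setP => y; rewrite !inE; apply/idP/orP => [a|[a|a]].
- have ne : lf y != u.
    by apply: contraTneq (leaf_lf y) => ->; apply/set0Pn; exists v1.
  have [v] := anc_child a ne; rewrite c !inE => /orP[]/eqP-> h; by [left|right].
- exact: anc_trans (anc_par c1) a.
exact: anc_trans (anc_par c2) a.
Qed.

Lemma node_children u : ~~ is_leaf par u ->
  exists v1 v2, children par u = [set v1; v2] /\ v1 != v2.
Proof.
move=> nl; have [_ /(_ u)[l|]] := fbt; first by rewrite l in nl.
by move/eqP/cards2P => [v1 [v2 [n12 e]]]; exists v1, v2.
Qed.

Lemma sz_gt0 u : 0 < sz u.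
Proof.
have [b] := ubnP #|[set v | anc par u v]|; elim: b u => // b IH u hb.
have [l|/node_children[v1 [v2 [c n12]]]] := boolP (is_leaf par u).
  by rewrite sz_leaf.
have c1 : v1 \in children par u by rewrite c !inE eqxx.
rewrite (sz_node c n12) addn_gt0 IH //.
have /childrenP[p1 n1] := c1.
apply: leq_trans (_ : #|[set v | anc par u v]| <= b); last by rewrite -ltnS.
apply: proper_card; apply/properP; split.
  by apply/subsetP => v; rewrite !inE; apply: anc_trans (anc_par c1).
exists u; rewrite inE ?anc_refl //; apply/negP => a.
by rewrite (anc_antisym a (anc_par c1)) eqxx in n1.
Qed.

Lemma sz_le u : sz u <= #|V|. Proof. exact: max_card. Qed.

Lemma sz_root r : (forall v, anc par r v) -> sz r = #|V|.
Proof.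
by move=> hr; rewrite /sz -cardsT; congr #|pred_of_set _|; apply/setP => x; rewrite !inE hr.
Qed.

Lemma card_leaves : #|[set u | is_leaf par u]| = #|V|.
Proof.
rewrite -(card_imset _ lf_inj); apply: eq_card => u; rewrite inE.
by apply/idP/imsetP => [/lfP[x ->]|[x _ ->]]; [exists x|apply: leaf_lf].
Qed.

(** Double counting of children: each node is the child of at most one node, and each internal node
    has two. *)
Lemma card_tree : #|T| <= 2 * #|V|.
Proof.
have h1 : \sum_u #|children par u| <= #|T|.
  rewrite (eq_bigr (fun u => \sum_v ((par v == u) && (v != u) : nat))) => [|u _].
    rewrite exchange_big /= -sum1_card; apply: leq_sum => v _.
    rewrite (bigD1 (par v)) //= big1 ?addn0 ?leq_b1 // => u ne.
    by rewrite eq_sym (negbTE ne).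
  rewrite -sum1_card big_mkcond /=; apply: eq_bigr => v _; rewrite inE.
  by case: (_ && _).
have h2 : \sum_u #|children par u| = 2 * #|[set u | ~~ is_leaf par u]|.
  rewrite -sum1_card big_distrr /= [RHS]big_mkcond /=; apply: eq_bigr => u _.
  rewrite inE; have [l|nl] /= := boolP (is_leaf par u).
    by move/eqP: l => ->; rewrite cards0.
  by have [v1 [v2 [-> n12]]] := node_children nl; rewrite cards2 n12.
have h3 : #|[set u | is_leaf par u]| + #|[set u | ~~ is_leaf par u]| = #|T|.
  rewrite -cardsUI (_ : _ :&: _ = set0) ?cards0 ?addn0; last first.
    by apply/setP => u; rewrite !inE andbN.
  by rewrite (_ : _ :|: _ = setT) ?cardsT //; apply/setP => u; rewrite !inE orbN.
by move: h1; rewrite h2; move: h3; rewrite card_leaves; lia.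
Qed.

Variable L : T -> nat.
Hypothesis L_root : forall r, par r = r -> L r = 0.
Hypothesis L_children : forall u, ~~ is_leaf par u ->
  exists v1 v2, [/\ children par u = [set v1; v2], v1 != v2, L v1 = L u &
                    L v2 = L u + sz v1].

Lemma child_int u v : v \in children par u ->
  [/\ L u <= L v, L v + sz v <= L u + sz u & sz v < sz u].
Proof.
move=> vu; have nl : ~~ is_leaf par u by apply/set0Pn; exists v.
have [v1 [v2 [c n12 l1 l2]]] := L_children nl.
have := sz_node c n12; have := sz_gt0 v1; have := sz_gt0 v2.
by move: vu; rewrite c !inE => /orP[]/eqP->; rewrite ?l1 ?l2; split; lia.
Qed.

Lemma anc_int u v : anc par u v -> L u <= L v /\ L v + sz v <= L u + sz u.
Proof.
move=> /ancP[k]; elim: k u => [u /= ->|k IH u /= e]; first by [].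
have [h1 h2] := IH _ erefl.
have [e'|ne] := eqVneq (iter k par v) u; first by rewrite -e'.
have [|h3 h4 _] := @child_int u (iter k par v); first by apply/childrenP.
by lia.
Qed.

Lemma sanc_sz u v : anc par u v -> u != v -> sz v < sz u.
Proof.
move=> a; rewrite eq_sym => /(anc_child a)[x xu xv].
by have [_ _ h] := child_int xu; have [h1 h2] := anc_int xv; lia.
Qed.

(** Induction from the root down to [v]. The new case is [u] strictly below [par v]: then it is
    below [v] or below its sibling, and siblings have adjacent disjoint intervals. *)
Lemma int_tricho u v : [\/ anc par u v, anc par v u |
  L u + sz u <= L v \/ L v + sz v <= L u].
Proof.
elim/tree_ind: v => [v pv|v pv [a|a|d]].
- constructor 2; have [[r pr hr] _] := fbt.
  have -> : v = r; last exact: hr.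
  have /ancP[k <-] := hr v; elim: k => //= k <-.
  by [].
- have vc : v \in children par (par v) by apply/childrenP; rewrite eq_sym.
  by constructor 1; apply: anc_trans a (anc_par vc).
- have vc : v \in children par (par v) by apply/childrenP; rewrite eq_sym.
  have [e|ne] := eqVneq u (par v).
    by constructor 1; rewrite e; apply: anc_par.
  have [x xc xu] := anc_child a ne.
  have [e|nx] := eqVneq x v; first by constructor 2; rewrite -e.
  constructor 3; have [h1 h2] := anc_int xu.
  have nl : ~~ is_leaf par (par v) by apply/set0Pn; exists v.
  have [v1 [v2 [c n12 l1 l2]]] := L_children nl.
  move: vc xc nx; rewrite c !inE => /orP[]/eqP-> /orP[]/eqP ex; subst x;
    rewrite ?eqxx //; lia.
have vc : v \in children par (par v) by apply/childrenP; rewrite eq_sym.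
by have [h1 h2 _] := child_int vc; constructor 3; lia.
Qed.

(** Intervals determine nodes because every internal node has two children, so that a strict
    ancestor has strictly more leaves. *)
Lemma anc_intE u v : anc par u v = (L u <= L v) && (L v + sz v <= L u + sz u).
Proof.
apply/idP/andP => [/anc_int //|[h1 h2]].
have p1 := sz_gt0 u; have p2 := sz_gt0 v.
have [//|a|d] := int_tricho u v; last by lia.
have [->|ne] := eqVneq u v; first exact: anc_refl.
by have := sanc_sz a; rewrite eq_sym => /(_ ne); lia.
Qed.

Lemma sz_lf x : sz (lf x) = 1. Proof. exact: sz_leaf (leaf_lf x). Qed.

Lemma anc_lf u x : anc par u (lf x) = (L u <= L (lf x) < L u + sz u).
Proof. by rewrite anc_intE sz_lf addn1. Qed.

Lemma L_bound u : L u + sz u <= #|V|.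
Proof.
have [[r pr hr] _] := fbt; have [_] := anc_int (hr u).
by rewrite (L_root pr) (sz_root hr).
Qed.

Lemma L_lf_inj x y : L (lf x) = L (lf y) -> x = y.
Proof.
move=> e; apply: lf_inj; apply: anc_antisym; rewrite anc_lf e leqnn sz_lf; lia.
Qed.

Lemma L_lf_lt x : L (lf x) < #|V|.
Proof. by have := L_bound (lf x); rewrite sz_lf addn1. Qed.

End TreeMath.

(** * Sorting the rectangles *)

(** Pairs start behind 4 header words, [m] parents and [n] leaves. The swap makes the side with the
    smaller start the first coordinate. Arrays 15 and 16 are the buckets of the sort by half
    perimeter. *)
Definition get_rects : prog :=
  5 <~ '#0 ;;
  PFor 5 2
    (10 <~ 'R 5 +! '#1 ;;
     6 <~ 0 @['R 0 +! 'R 1 +! '#2 *! 'R 5 +! '#4] ;;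
     7 <~ 0 @['R 0 +! 'R 1 +! '#2 *! 'R 5 +! '#5] ;;
     PIf (8 @['R 7] <! 8 @['R 6]) (9 <~ 'R 6 ;; 6 <~ 'R 7 ;; 7 <~ 'R 9) PSkip ;;
     11 @{'R 10} <~ 8 @['R 6] ;; 12 @{'R 10} <~ 8 @['R 6] +! 7 @['R 6] ;;
     13 @{'R 10} <~ 8 @['R 7] ;; 14 @{'R 10} <~ 8 @['R 7] +! 7 @['R 7] ;;
     11 <~ 7 @['R 6] +! 7 @['R 7] ;;
     16 @{'R 10} <~ 15 @['R 11] ;; 15 @{'R 11} <~ 'R 10).

(** Scanning the buckets by increasing key and pushing in front leaves every start list with
    decreasing keys, hence outer rectangles first. *)
Definition sort_rects : prog :=
  5 <~ '#0 ;; 6 <~ '#2 *! 'R 0 +! '#1 ;;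
  PFor 5 6
    (10 <~ 15 @['R 5] ;;
     PWhile ('R 10)
       (11 <~ 11 @['R 10] ;; 18 @{'R 10} <~ 17 @['R 11] ;;
        17 @{'R 11} <~ 'R 10 ;; 10 <~ 16 @['R 10])).

Section RectPhases.

Variables (w n m p : nat) (U V L sz : nat -> nat).
Hypothesis U_lt : forall i, i < p -> U i < m.
Hypothesis V_lt : forall i, i < p -> V i < m.
Hypothesis L_le : forall u, u < m -> L u + sz u <= n.
Hypothesis sz0 : forall u, u < m -> 0 < sz u.
Hypothesis wP : 10 * n + 10 * m + 10 * p + 100 < 2 ^ w.

Let w1 : 1 < 2 ^ w. Proof. by lia. Qed.
Let isr i := 0 < i <= p.

(** Rectangles are numbered from 1 and the pairs of the input from 0: hence [i.-1]. *)
Definition lo i := if L (V i.-1) < L (U i.-1) then V i.-1 else U i.-1.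
Definition hi i := if L (V i.-1) < L (U i.-1) then U i.-1 else V i.-1.
Definition key i := sz (lo i) + sz (hi i).

Lemma lo_lt i : isr i -> lo i < m.
Proof. by move=> /andP[i0 ip]; rewrite /lo; case: ifP => _; [apply: V_lt|apply: U_lt]; lia. Qed.

Lemma hi_lt i : isr i -> hi i < m.
Proof. by move=> /andP[i0 ip]; rewrite /hi; case: ifP => _; [apply: U_lt|apply: V_lt]; lia. Qed.

Definition rect_arrays k (s : state) : Prop :=
  forall i, 0 < i <= k ->
    [/\ arrs s 11 i = L (lo i), arrs s 12 i = L (lo i) + sz (lo i),
        arrs s 13 i = L (hi i) & arrs s 14 i = L (hi i) + sz (hi i)].

Definition key_lists k (lK : nat -> seq nat) (s : state) : Prop :=
  forall c, [/\ chain (arrs s 16) (arrs s 15 c) (lK c), uniq (lK c) &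
                forall i, (i \in lK c) = (0 < i <= k) && (key i == c)].

Lemma get_rectsP s :
  regs s 0 = n -> regs s 1 = m -> regs s 2 = p ->
  (forall i, i < p -> arrs s 0 (n + m + 2 * i + 4) = U i) ->
  (forall i, i < p -> arrs s 0 (n + m + 2 * i + 5) = V i) ->
  (forall u, u < m -> arrs s 8 u = L u) ->
  (forall u, u < m -> arrs s 7 u = sz u) ->
  (forall c, arrs s 15 c = 0) ->
  wp w get_rects s (fun k s' => [/\ k <= 200 * p + 20, rect_arrays p s' &
    exists lK, key_lists p lK s']).
Proof.
move=> h0 h1 h2 hU hV h8 h7 h15.
apply: wp_seq; wreg; first lia.
set s0 := set_reg _ _ _.
pose I k (b : nat) s' := rect_arrays k s' /\ exists lK, key_lists k lK s'.
apply: (@wp_for _ _ _ _ I 150 p 0) => //.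
- by rewrite /s0 /= /upd /=; lia.
- split=> [i|]; first by rewrite /s0 /= /upd /=; lia.
  exists (fun=> [::]) => c; split=> //; first exact: h15.
  move=> i; by rewrite /s0 /= /upd /= in_nil (_ : 0 < i <= 0 = false) //; lia.
- rewrite /s0 /= /upd /= => k bg s1 kp e5 e2 F [ra [lK kl]].
  have e0 : regs s1 0 = n by rewrite F.1.
  have e1 : regs s1 1 = m by rewrite F.1.
  have a0 : arrs s1 0 = arrs s 0 by rewrite F.2.
  have a7 : arrs s1 7 = arrs s 7 by rewrite F.2.
  have a8 : arrs s1 8 = arrs s 8 by rewrite F.2.
  apply: wp_seq; wreg; first by rewrite e5; do ?split=> //; lia.
  apply: wp_seq; wreg; first by rewrite /= /upd /= e0 e1 e5; do ?split=> //; lia.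
  apply: wp_seq; wreg; first by rewrite /= /upd /= e0 e1 e5; do ?split=> //; lia.
  rewrite /= /upd /= e0 e1 e5 a0 hU // hV //; set s2 := set_reg _ _ _.
  have Uk := U_lt kp; have Vk := V_lt kp.
  apply: wp_seq; apply: (@wp_mono _ _ _ (fun k' s3 => [/\ k' <= 20,
     regs s3 6 = lo k.+1 & regs s3 7 = hi k.+1])).
    apply: wp_if => //; rewrite /s2 /= /upd /= a8 !h8 // => c.
    + have lt : L (V k) < L (U k) by move: c; case: ltnP.
      do 2 (apply: wp_seq; wreg); wreg; rewrite /= /upd /=.
      by rewrite /lo /hi /= lt.
    have le : (L (V k) < L (U k)) = false by move: c; case: ltnP.
    by apply: wp_skip; rewrite /= /upd /= /lo /hi /= le.
  move=> k3 s3 F3 [hk3 e6 e7].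
  have rk : isr k.+1 by rewrite /isr.
  have ll := lo_lt rk; have hl := hi_lt rk.
  have Ll := L_le ll; have Lh := L_le hl.
  have b7 : arrs s3 7 = arrs s 7 by rewrite F3.2 // /s2 /= a7.
  have b8 : arrs s3 8 = arrs s 8 by rewrite F3.2 // /s2 /= a8.
  have e10 : regs s3 10 = k + 1 by rewrite F3.1 // /s2 /= /upd /=.
  apply: wp_seq; warr; apply: wp_seq; warr.
    by rewrite /= /upd /= e6 b7 b8 h7 // h8 //; do ?split=> //; lia.
  apply: wp_seq; warr; apply: wp_seq; warr.
    by rewrite /= /upd /= e7 b7 b8 h7 // h8 //; do ?split=> //; lia.
  apply: wp_seq; wreg.
    by rewrite /= /upd /= e6 e7 b7 !h7 //; do ?split=> //; lia.
  apply: wp_seq; warr; warr.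
  rewrite /= /upd /= e6 e7 e10 b7 b8 !h7 // !h8 //.
  have -> : sz (lo k.+1) + sz (hi k.+1) = key k.+1 by [].
  have c11 : arrs s3 11 = arrs s1 11 by rewrite F3.2.
  have c12 : arrs s3 12 = arrs s1 12 by rewrite F3.2.
  have c13 : arrs s3 13 = arrs s1 13 by rewrite F3.2.
  have c14 : arrs s3 14 = arrs s1 14 by rewrite F3.2.
  have c15 : arrs s3 15 = arrs s1 15 by rewrite F3.2.
  have c16 : arrs s3 16 = arrs s1 16 by rewrite F3.2.
  exists 0; split; first lia.
  split.
    move=> i hi'; rewrite /= /upd /= c11 c12 c13 c14 addn1.
    have [->|ne] := eqVneq i k.+1; first by [].
    by apply: ra; lia.
  exists (fun c => if c == key k.+1 then k.+1 :: lK c else lK c) => c.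
  have [ch un me] := kl c.
  have ni : k.+1 \notin lK c by rewrite me (_ : 0 < k.+1 <= k = false) //; lia.
  rewrite /= /upd /= c15 c16 addn1.
  have ch' := chain_upd (arrs s1 15 (key k.+1)) ni ch.
  have [ec|nc] := eqVneq c (key k.+1); last first.
    split=> // i; rewrite me; have [->|ne] := eqVneq i k.+1.
      by rewrite eq_sym (negbTE nc) !andbF.
    by congr (_ && _); lia.
  split=> /=.
  - by split=> //; rewrite eqxx; move: ch'; rewrite (congr1 (arrs s1 15) ec).
  - by rewrite ni un.
  move=> i; rewrite inE me; have [->|ne] := eqVneq i k.+1.
    by rewrite ec eqxx leqnn.
  by rewrite /=; congr (_ && _); lia.
move=> k bg s1 [ra kl] _ _ le F; split=> //.
by move: le; rewrite /s0 /= /upd /=; lia.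
Qed.

Definition start_lists (lS : nat -> seq nat) (P : pred nat) (s : state) : Prop :=
  forall x, [/\ chain (arrs s 18) (arrs s 17 x) (lS x), uniq (lS x),
    pairwise (fun i j => key j <= key i) (lS x) &
    forall i, (i \in lS x) = P i && (L (lo i) == x)].

Lemma start_lists_ext lS P P' s : P =1 P' -> start_lists lS P s -> start_lists lS P' s.
Proof. by move=> e h x; have [h1 h2 h3 h4] := h x; split=> // i; rewrite h4 e. Qed.

Lemma sort_rectsP s lK :
  regs s 0 = n -> rect_arrays p s -> key_lists p lK s ->
  (forall c, arrs s 17 c = 0) ->
  wp w sort_rects s (fun k s' => k <= 60 * p + 80 * n + 80 /\
    exists lS, start_lists lS isr s').
Proof.
move=> h0 ra kl h17.
apply: wp_seq; wreg; first lia.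
apply: wp_seq; wreg; first by rewrite /= /upd /= h0; do ?split=> //; lia.
rewrite /= /upd /= h0; set s0 := set_reg _ _ _.
pose P c (rem : seq nat) i := isr i && ((key i < c) || ((key i == c) && (i \notin rem))).
pose un c (rem : seq nat) i := isr i && ((c < key i) || (i \in rem)).
pose I c b s' := (exists lS, start_lists lS (P c (lK c)) s') /\
  b = 40 * cn (un c (lK c)) 1 p.+1.
have kl' c := kl c.
apply: (@wp_for _ _ _ _ I 30 (2 * n + 1) (40 * cn (un 0 (lK 0)) 1 p.+1)) => //.
- by rewrite /s0 /= /upd /=; lia.
- split=> //; exists (fun=> [::]) => x; split=> //; first exact: h17.
  move=> i.
  rewrite in_nil /P; have [_ _ ->] := kl 0; rewrite /isr.
  by case: (0 < i <= p); case: (key i == 0).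
- rewrite /s0 /= /upd /= => c bg s1 hc e5 e6 F [[lS sl] ->].
  have a11 : arrs s1 11 = arrs s 11 by rewrite F.2.
  have a15 : arrs s1 15 = arrs s 15 by rewrite F.2.
  have a16 : arrs s1 16 = arrs s 16 by rewrite F.2.
  have [chc unc mec] := kl c.
  apply: wp_seq; wreg; rewrite e5 a15; set s2 := set_reg _ _ _.
  pose J b s' := exists rem lS',
    [/\ [/\ chain (arrs s 16) (regs s' 10) rem, uniq rem &
          {in rem, forall i, isr i /\ key i = c}],
        arrs s' 11 = arrs s 11 /\ arrs s' 16 = arrs s 16,
        start_lists lS' (P c rem) s' &
        b = 40 * cn (un c rem) 1 p.+1].
  apply: (@wp_while _ _ _ J (40 * cn (un c (lK c)) 1 p.+1)) => //.
  + move=> b s3 [rem [lS' [[ch3 un3 rm3] [b11 b16] sl3 ->]]] /=.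
    case: rem ch3 un3 rm3 sl3 => [|i rem] /=; first by move=> ->.
    move=> [e10 i0 ch3] /andP[nir un3] rm3 sl3 _.
    have [ri ki] := rm3 i (mem_head _ _).
    have [r11 _ _ _] := ra i ri.
    apply: wp_seq; wreg; rewrite e10 b11 r11.
    apply: wp_seq; warr; apply: wp_seq; warr; wreg.
    rewrite /= /upd /= e10 b16; set x0 := L (lo i).
    have PE j : P c rem j = P c (i :: rem) j || (j == i).
      rewrite /P inE; have [->|ji] := eqVneq j i; last by rewrite orbF.
      by rewrite ri ki eqxx nir /= !orbT.
    have nPi : P c (i :: rem) i = false.
      by rewrite /P ki ltnn mem_head !andbF.
    exists (40 * cn (un c rem) 1 p.+1); split; last first.
      rewrite -(@cn_rem (un c (i :: rem)) i) //; last by rewrite /un ri mem_head orbT.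
      have -> : cn (fun j => un c (i :: rem) j && (j != i)) 1 p.+1 =
                cn (un c rem) 1 p.+1.
        apply: eq_cn => j _; rewrite /un inE; have [->|ji] := eqVneq j i.
          by rewrite ki ltnn (negbTE nir) !andbF.
        by rewrite andbT.
      lia.
    exists rem, (fun x => if x == x0 then i :: lS' x else lS' x); split=> //.
    * split=> //; last by move=> j jr; apply: rm3; rewrite inE jr orbT.
    move=> x; have [k1 k2 k3 k4] := sl3 x; rewrite /= /upd /=.
    have ni : i \notin lS' x by rewrite k4 nPi.
    have ch' := chain_upd (arrs s3 17 x0) ni k1.
    have [ex|nx] := eqVneq x x0; last first.
      split=> // j; rewrite k4 PE; have [->|_] := eqVneq j i; last by rewrite orbF.
      by rewrite nPi /= eq_sym (negbTE nx).
    split=> /=.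
    * by split=> //; rewrite eqxx; move: ch'; rewrite (congr1 (arrs s3 17) ex).
    * by rewrite ni k2.
    * rewrite k3 andbT; apply/allP => j; rewrite k4 => /andP[/andP[_ h] _].
      by rewrite ki; case/orP: h => [|/andP[/eqP->]] //; apply: ltnW.
    move=> j; rewrite inE k4 PE; have [->|_] := eqVneq j i; last by rewrite orbF.
    by rewrite orbT ex eqxx.
  + exists (lK c), lS; split=> //; split=> //.
    by move=> i; rewrite mec => /andP[? /eqP].
  move=> k3 b3 s3 [rem [lS' [[ch3 un3 rm3] _ sl3 ->]]] e10 le3 F3.
  case: rem ch3 un3 rm3 sl3 le3 => [|i rem] /= => [_|[ei i0 _]] un3 rm3 sl3 le3; last first.
    by move: e10; rewrite /= ei => e; rewrite e in i0.
  have E1 : P c [::] =1 P c.+1 (lK c.+1).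
    move=> i; rewrite /P; have [_ _ ->] := kl c.+1; rewrite /isr in_nil.
    by case: (0 < i <= p) => //=; lia.
  have E2 : cn (un c [::]) 1 p.+1 = cn (un c.+1 (lK c.+1)) 1 p.+1.
    apply: eq_cn => i _; rewrite /un; have [_ _ ->] := kl c.+1; rewrite /isr in_nil.
    by case: (0 < i <= p) => //=; lia.
  exists (40 * cn (un c.+1 (lK c.+1)) 1 p.+1); split; first by rewrite -E2; lia.
  split=> //; exists lS'; apply: start_lists_ext E1 _.
  exact: sl3.
move=> k bg s1 [[lS sl] ->] _ _ le F; split.
  have : cn (un 0 (lK 0)) 1 p.+1 <= p.
    rewrite /cn -[X in _ <= X](muln1 p) -[X in _ <= X * _](subn1 p.+1).
    rewrite -sum_nat_const_nat; apply: leq_sum => i _; exact: leq_b1.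
  by move: le; rewrite /s0 /= /upd /=; lia.
(* A key is a sum of two sizes of at most [n], so [2 * n + 1] buckets contain everything. *)
exists lS; apply: start_lists_ext sl => i; rewrite /P andb_idr // => ri.
have h1 := L_le (lo_lt ri); have h2 := L_le (hi_lt ri).
by rewrite /key; lia.
Qed.

End RectPhases.

(** * Adjacency and innermost rectangles *)

Lemma set2_eq (T : finType) (a b c d : T) :
  [set a; b] = [set c; d] -> (a = c /\ b = d) \/ (a = d /\ b = c).
Proof.
move=> E; have ha : a \in [set c; d] by rewrite -E !inE eqxx.
have hb : b \in [set c; d] by rewrite -E !inE eqxx orbT.
have hc : c \in [set a; b] by rewrite E !inE eqxx.
have hd : d \in [set a; b] by rewrite E !inE eqxx orbT.
move: ha hb hc hd; rewrite !inE.
move=> /orP[]/eqP-> /orP[]/eqP-> /orP[]/eqP h1 /orP[]/eqP h2; by [left|right|subst; left].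
Qed.

Section Adjacency.

Variables (T V : finType) (par : T -> T) (lf : V -> T) (e : rel V).
Variables (A B : {set {set T}}) (L : T -> nat) (p a : nat) (lo hi : nat -> T).
Let sz := sz par lf.
Let isr i := 0 < i <= p.

Hypothesis model : signed_tree_model_of e par A B lf.
Hypothesis L_root : forall r, par r = r -> L r = 0.
Hypothesis L_children : forall u, ~~ is_leaf par u ->
  exists v1 v2, [/\ children par u = [set v1; v2], v1 != v2, L v1 = L u &
                    L v2 = L u + sz v1].
Hypothesis lohi : forall i, isr i -> L (lo i) <= L (hi i).
Hypothesis pairA : forall i, isr i -> i <= a -> [set lo i; hi i] \in A.
Hypothesis pairB : forall i, isr i -> a < i -> [set lo i; hi i] \in B.
Hypothesis pairs : forall P, P \in A :|: B ->
  exists2 i, isr i & P = [set lo i; hi i].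

Let XL i := L (lo i).
Let XR i := L (lo i) + sz (lo i).
Let YL i := L (hi i).
Let YR i := L (hi i) + sz (hi i).

Let fbt : full_binary_tree par. Proof. by case: model => -[]. Qed.
Let lf_inj : injective lf. Proof. by case: model. Qed.
Let lfP : forall u, is_leaf par u <-> exists x, u = lf x.
Proof. by case: model. Qed.
Let AB_disj : [disjoint A & B]. Proof. by case: model => -[]. Qed.

Let ancE := anc_intE fbt lf_inj lfP L_children.
Let anclf := anc_lf fbt lf_inj lfP L_children.
Let tricho := int_tricho fbt lf_inj lfP L_children.
Let szp := sz_gt0 fbt lf_inj lfP.

Lemma pair_mem i : isr i -> [set lo i; hi i] \in A :|: B.
Proof.
move=> ri; rewrite inE; case: (leqP i a) => h; first by rewrite pairA.
by rewrite pairB ?orbT.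
Qed.

Lemma lohi_inc i : isr i -> ~~ anc par (lo i) (hi i) /\ ~~ anc par (hi i) (lo i).
Proof.
move=> ri; case: model => -[_ _ tr _] _ _ _.
have [u [v [e1 n1 n2]]] := tr _ (pair_mem ri).
by have [[-> ->]|[-> ->]] := set2_eq e1.
Qed.

(** The sides of a transversal pair are incomparable, hence disjoint as intervals: the rectangle
    lies strictly above the diagonal. *)
Lemma lohi_disj i : isr i -> L (lo i) + sz (lo i) <= L (hi i).
Proof.
move=> ri; have [n1 n2] := lohi_inc ri; have := lohi ri.
have p1 := szp (lo i); have p2 := szp (hi i).
have [a1|a1|[//|d]] := tricho (lo i) (hi i); first by rewrite a1 in n1.
  by rewrite a1 in n2.
by rewrite -/sz in d p1 p2; lia.
Qed.

Lemma rect_x i : isr i -> XL i < XR i <= #|V|.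
Proof.
move=> ri; rewrite /XL /XR -{1}[L _]addn0 ltn_add2l szp.
exact: (L_bound fbt lf_inj lfP L_root L_children).
Qed.

Lemma rect_y i : isr i -> YL i < YR i <= #|V|.
Proof.
move=> ri; rewrite /YL /YR -{1}[L _]addn0 ltn_add2l szp.
exact: (L_bound fbt lf_inj lfP L_root L_children).
Qed.

(** A common point makes both sides comparable in the tree. Strict comparisons in opposite
    directions would be a crossing, and an equality on one side fits either direction. *)
Lemma rect_laminar i j x y : isr i -> isr j ->
  XL i <= x < XR i -> YL i <= y < YR i -> XL j <= x < XR j -> YL j <= y < YR j ->
  [&& XL j <= XL i, XR i <= XR j, YL j <= YL i & YR i <= YR j] ||
  [&& XL i <= XL j, XR j <= XR i, YL i <= YL j & YR j <= YR i].
Proof.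
move=> ri rj hxi hyi hxj hyj.
rewrite /XL /XR /YL /YR in hxi hyi hxj hyj *.
have t1 : anc par (lo i) (lo j) \/ anc par (lo j) (lo i).
  by have [|| d] := tricho (lo i) (lo j); [left|right|rewrite -/sz in d; lia].
have t2 : anc par (hi i) (hi j) \/ anc par (hi j) (hi i).
  by have [|| d] := tricho (hi i) (hi j); [left|right|rewrite -/sz in d; lia].
have cr : ~~ cross par [set lo i; hi i] [set lo j; hi j].
  by case: model => -[_ _ _ nc] _ _ _; apply: nc; apply: pair_mem.
have cr' : ~~ cross par [set lo j; hi j] [set lo i; hi i].
  by case: model => -[_ _ _ nc] _ _ _; apply: nc; apply: pair_mem.
have mk (i' j' : nat) (lo' hi' : nat -> T) :
    sanc par (lo' i') (lo' j') -> sanc par (hi' j') (hi' i') ->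
    [set lo i; hi i] = [set lo' i'; hi' i'] ->
    [set lo j; hi j] = [set lo' j'; hi' j'] -> False.
  move=> s1 s2 e1 e2; move/negP: cr; apply; rewrite e1 e2.
  apply/andP; split; apply/existsP.
    exists (lo' i'); rewrite !inE eqxx /=; apply/existsP; exists (lo' j').
    by rewrite !inE eqxx.
  exists (hi' j'); rewrite !inE eqxx orbT /=; apply/existsP; exists (hi' i').
  by rewrite !inE eqxx orbT.
rewrite /sanc in mk.
case: t1 => a1; case: t2 => a2.
- move: a1 a2; rewrite !ancE => /andP[-> ->] /andP[-> ->].
  by rewrite orbT.
- have [el|nl] := eqVneq (lo i) (lo j).
    by move: a2; rewrite el ancE => /andP[-> ->]; rewrite !leqnn.
  have [eh|nh] := eqVneq (hi j) (hi i).
    by move: a1; rewrite -eh ancE => /andP[-> ->]; rewrite !leqnn orbT.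
  by case: (mk i j lo hi); rewrite ?a1 ?a2 ?nl ?nh.
- have [el|nl] := eqVneq (lo j) (lo i).
    by move: a2; rewrite el ancE => /andP[-> ->]; rewrite !leqnn orbT.
  have [eh|nh] := eqVneq (hi i) (hi j).
    by move: a1; rewrite eh ancE => /andP[-> ->]; rewrite !leqnn.
  by case: (mk i j hi lo); rewrite ?a1 ?a2 ?nl ?nh // setUC.
move: a1 a2; rewrite !ancE => /andP[-> ->] /andP[-> ->].
by [].
Qed.

(** A pair covers two leaves when no other pair lies between it and them, that is, when its
    rectangle is the innermost one over their point. The factor [x < y] is there because a pair
    taken in the reverse order would put a point below the diagonal. *)
Lemma top_adj (X Y : V) c :
  let x := L (lf X) in let y := L (lf Y) in
  top a XL XR YL YR (fun i => isr i && (XL i <= x < XR i)) y c ->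
  (c == 1) = (x < y) && e X Y.
Proof.
move=> x y t.
have inP i : XL i <= x < XR i = anc par (lo i) (lf X) by rewrite anclf.
have inQ i : YL i <= y < YR i = anc par (hi i) (lf Y) by rewrite anclf.
have swp j : isr j -> anc par (hi j) (lf X) -> anc par (lo j) (lf Y) -> x < y -> False.
  move=> rj; rewrite !anclf -/x -/y => h1 h2 xy; have := lohi_disj rj.
  by rewrite /sz; lia.
have eE : e X Y <-> stm_graph par A B (lf X) (lf Y) by case: model.
case: t => [[i [/andP[ri hx] hy <- mn]]|[-> no]]; last first.
  apply/esym/negbTE/negP => /andP[xy /eE[u [v [uvB [au av _]]]]].
  have [|j rj ej] := @pairs [set u; v]; first by rewrite inE uvB orbT.
  have [[eu ev]|[eu ev]] := set2_eq ej; subst u v; last exact: swp au av xy.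
  by have := no j; rewrite inP au rj inQ av => /(_ isT).
have xy : x < y by have := lohi_disj ri; move: hx hy; rewrite /XR /YL; lia.
rewrite xy /= eqb1.
have ai : anc par (lo i) (lf X) by rewrite -inP.
have bi : anc par (hi i) (lf Y) by rewrite -inQ.
apply/idP/idP => [ia|/eE[u [v [uvB [au av cov]]]]].
  apply/eE; exists (lo i), (hi i); split; first exact: pairB.
  split=> // -[u [v [uvAB ne /andP[u1 u2] /andP[v1 v2]]]].
  have [j rj ej] := pairs uvAB.
  have [[eu ev]|[eu ev]] := set2_eq ej; subst u v; last first.
    move: u1 v1; rewrite !ancE => /andP[h1 h2] /andP[h3 h4].
    have := lohi_disj ri; have := lohi_disj rj; have := szp (hi j).
    have := szp (lo j).
    by rewrite /sz; lia.
  have := mn j; rewrite inQ rj inP u2 v2 => /(_ isT isT) /and4P[s1 s2 s3 s4].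
  move/negP: ne; apply.
  have -> : lo j = lo i.
    by apply: (anc_antisym fbt) => //; rewrite ancE; apply/andP.
  have -> : hi j = hi i; last by [].
  by apply: (anc_antisym fbt) => //; rewrite ancE; apply/andP.
have [|j rj ej] := @pairs [set u; v]; first by rewrite inE uvB orbT.
have [[eu ev]|[eu ev]] := set2_eq ej; subst u v; last by case: (swp j).
have := mn j; rewrite inQ rj inP au av => /(_ isT isT) /and4P[s1 s2 s3 s4].
have [eq|ne] := eqVneq [set lo i; hi i] [set lo j; hi j].
  rewrite ltnNge; apply/negP => ia; have iA := pairA ri ia.
  by move/pred0P: AB_disj => /(_ [set lo i; hi i]) /=; rewrite iA eq uvB.
case: cov; exists (lo i), (hi i); split=> //.
- exact: pair_mem.
- by rewrite ai andbT ancE; apply/andP.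
by rewrite bi andbT ancE; apply/andP.
Qed.

End Adjacency.

(** * The interval biclique partition *)

Lemma count1_eq (T : eqType) (P : pred T) (s : seq T) x y :
  count P s <= 1 -> x \in s -> y \in s -> P x -> P y -> x = y.
Proof.
elim: s => //= z s IH le; rewrite !inE => xs ys px py.
have pos t : t \in s -> P t -> 0 < count P s.
  by move=> ts pt; rewrite -has_count; apply/hasP; exists t.
case/predU1P: xs => [ex|xs]; case/predU1P: ys => [ey|ys].
- by rewrite ex ey.
- by have := pos y ys py; rewrite -ex px in le; lia.
- by have := pos x xs px; rewrite -ey py in le; lia.
by apply: IH => //; lia.
Qed.

Section Boxes.

Variables (n : nat) (e : rel 'I_n) (o : seq 'I_n) (bs : seq box).
Implicit Types b : box.
Hypothesis n_gt0 : 0 < n.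
Hypothesis e_simple : simple_graph e.
Hypothesis o_perm : perm_eq o (enum 'I_n).

Definition ov (x : nat) : 'I_n := nth (Ordinal n_gt0) o x.
Definition pos (v : 'I_n) : nat := index v o.

Hypothesis bs_cover : forall x y, x < n -> y < n ->
  cover_count bs x y = (x < y) && e (ov x) (ov y).
Hypothesis bs_in : {in bs, forall b, box_in n b}.

Lemma size_o : size o = n.
Proof. by rewrite (perm_size o_perm) size_enum_ord. Qed.

Lemma uniq_o : uniq o.
Proof. by rewrite (perm_uniq o_perm) enum_uniq. Qed.

Lemma mem_o v : v \in o.
Proof. by rewrite (perm_mem o_perm) mem_enum. Qed.

Lemma pos_lt v : pos v < n.
Proof. by rewrite -[X in _ < X]size_o index_mem mem_o. Qed.

Lemma posK v : ov (pos v) = v.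
Proof. exact: nth_index (mem_o v). Qed.

Lemma ovK x : x < n -> pos (ov x) = x.
Proof. by move=> xn; rewrite /pos index_uniq ?size_o ?uniq_o. Qed.

Lemma pos_inj : injective pos.
Proof. exact: can_inj posK. Qed.

Lemma cover_pos u v :
  cover_count bs (pos u) (pos v) = (pos u < pos v) && e u v.
Proof. by rewrite bs_cover ?pos_lt // !posK. Qed.

Lemma cover_le1 x y : x < n -> y < n -> cover_count bs x y <= 1.
Proof. by move=> xn yn; rewrite bs_cover // leq_b1. Qed.

Lemma box_edge b u v : b \in bs -> inbox b (pos u) (pos v) ->
  pos u < pos v /\ e u v.
Proof.
move=> bb ib; have : 0 < cover_count bs (pos u) (pos v).
  by rewrite -has_count; apply/hasP; exists b.
by rewrite cover_pos lt0b => /andP.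
Qed.

Lemma edge_box u v : pos u < pos v -> e u v ->
  exists2 b, b \in bs & inbox b (pos u) (pos v).
Proof.
by move=> lt uv; apply/hasP; rewrite has_count -/(cover_count _ _ _) cover_pos lt uv.
Qed.

Lemma edge_pos u v : e u v -> pos u < pos v \/ pos v < pos u.
Proof.
move=> uv; case: (ltngtP (pos u) (pos v)) => [|| /pos_inj ev]; [by left|by right|].
by move: uv; rewrite ev e_simple.2.
Qed.

Definition quad (b : box) : ('I_n * 'I_n) * ('I_n * 'I_n) :=
  ((ov b.1.1, ov (b.1.2 - 1)), (ov b.2.1, ov (b.2.2 - 1))).

Definition olt (u v : 'I_n) : bool := pos u < pos v.

Lemma closed_intervalE x0 x1 z : x0 < x1 <= n ->
  (z \in closed_interval olt (ov x0) (ov (x1 - 1))) = (x0 <= pos z < x1).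
Proof.
move=> h; rewrite inE /olt !ovK; [|lia|lia].
by rewrite -!leqNgt; lia.
Qed.

Lemma quad_inbox b u v : b \in bs ->
  (u \in closed_interval olt (quad b).1.1 (quad b).1.2) &&
  (v \in closed_interval olt (quad b).2.1 (quad b).2.2) =
  inbox b (pos u) (pos v).
Proof.
by move=> /bs_in /and3P[h1 h2 h3]; rewrite !closed_intervalE //; lia.
Qed.

Let K b := biclique_of olt (quad b).

Lemma mem_biclique b P : b \in bs -> P \in K b ->
  exists u v, P = [set u; v] /\ inbox b (pos u) (pos v).
Proof.
move=> bb /imset2P[u v hu hv ->]; exists u, v; split=> //.
by rewrite -quad_inbox // hu hv.
Qed.

Lemma biclique_mem b u v : b \in bs -> inbox b (pos u) (pos v) -> [set u; v] \in K b.
Proof. by move=> bb; rewrite -quad_inbox // => /andP[hu hv]; apply: imset2_f. Qed.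

(** Boxes only contain points above the diagonal, so an unordered pair arises from one point only,
    and a point lies in at most one box. *)
Lemma biclique_share b b' P : b \in bs -> b' \in bs -> P \in K b -> P \in K b' -> b = b'.
Proof.
move=> bb bb' /(mem_biclique bb)[u [v [-> h]]] /(mem_biclique bb')[u' [v' [E h']]].
have [l1 _] := box_edge bb h; have [l2 _] := box_edge bb' h'.
have [[eu ev]|[eu ev]] := set2_eq E; subst u' v'; last first.
  by move: l1 l2; lia.
exact: count1_eq (cover_le1 (pos_lt u) (pos_lt v)) bb bb' h h'.
Qed.

Lemma biclique_n0 b : b \in bs -> exists P, P \in K b.
Proof.
move=> bb; have /and3P[h1 h2 h3] := bs_in bb.
exists [set ov b.1.1; ov b.2.1]; apply: biclique_mem => //.
by rewrite /inbox !ovK; lia.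
Qed.

(** A repeated box would cover its own lower corner twice; boxes are nonempty. *)
Lemma uniq_bs : uniq bs.
Proof.
apply: count_mem_uniq => b.
have [bb|nb] := boolP (b \in bs); last by apply/count_memPn.
have /and3P[h1 h2 h3] := bs_in bb.
have : count_mem b bs <= cover_count bs b.1.1 b.2.1.
  by apply: sub_count => b' /= /eqP->; rewrite /inbox; lia.
have : 0 < count_mem b bs by rewrite -has_count has_pred1.
have := @cover_le1 b.1.1 b.2.1; rewrite /=; lia.
Qed.

Lemma ibp_exists : exists (lt : rel 'I_n) (Bs : {set {set {set 'I_n}}}),
  [/\ interval_biclique_partition e lt Bs, #|Bs| <= size bs &
      encodes_ibp (size bs :: [seq val v | v <- o] ++
        flatten [seq wquad [seq val v | v <- o] b | b <- bs]) lt Bs].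
Proof.
pose Bs := [set P in [seq K b | b <- bs]].
have BsP P : reflect (exists2 b, b \in bs & P = K b) (P \in Bs).
  by rewrite inE; apply: mapP.
exists olt, Bs; split.
- split.
  + split; first by move=> u; rewrite /olt ltnn.
      by move=> u v z; apply: ltn_trans.
    by move=> u v uv; rewrite /olt -neq_ltn; apply: contra_neq uv => /pos_inj.
  + apply/and3P; split.
    * apply/eqP/setP => P; apply/bigcupP/imsetP => [[Q /BsP[b bb ->]]|[[u v]]].
        move=> /(mem_biclique bb)[u [v [-> h]]]; exists (u, v) => //.
        by rewrite inE /=; have [] := box_edge bb h.
      rewrite inE /= => uv ->; case: (edge_pos uv) => lt.
        have [b bb h] := edge_box lt uv; exists (K b); first by apply/BsP; exists b.
        exact: biclique_mem.
      rewrite (e_simple.1 u v) in uv.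
      have [b bb h] := edge_box lt uv; exists (K b); first by apply/BsP; exists b.
      by rewrite setUC; apply: biclique_mem.
    * apply/trivIsetP => P Q /BsP[b bb ->] /BsP[b' bb' ->] ne.
      apply/pred0P => S /=; apply/negP => /andP[h1 h2].
      by move: ne; rewrite (biclique_share bb bb' h1 h2) eqxx.
    by apply/BsP => -[b bb e0]; have [P] := biclique_n0 bb; rewrite -e0 inE.
  move=> P /BsP[b bb ->].
  exists (closed_interval olt (quad b).1.1 (quad b).1.2),
         (closed_interval olt (quad b).2.1 (quad b).2.2).
  have /and3P[h1 h2 h3] := bs_in bb.
  split=> //.
  + move=> u v z; rewrite !closed_intervalE; try lia.
    by rewrite /olt; lia.
  + move=> u v z; rewrite !closed_intervalE; try lia.
    by rewrite /olt; lia.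
  apply/pred0P => z /=; rewrite quad_inbox //; apply/negP => h.
  by have [] := box_edge bb h; rewrite ltnn.
- rewrite -(size_map K bs); apply: leq_trans (card_size _).
  by apply: subset_leq_card; apply/subsetP => P; rewrite inE.
exists o, [seq quad b | b <- bs]; split=> //.
- rewrite -map_comp (map_inj_in_uniq _) ?uniq_bs // => b b' bb bb' /= E.
  have [P h] := biclique_n0 bb; apply: (biclique_share bb bb' h).
  by move: h; rewrite /K E.
- by move=> P; rewrite -map_comp inE.
rewrite size_map; congr (_ :: _ ++ flatten _); rewrite -map_comp.
apply/eq_in_map => b /bs_in /and3P[h1 h2 h3] /=; rewrite /wquad /words_pairs /=.
by rewrite !(nth_map (Ordinal n_gt0)) ?size_o //; lia.
Qed.

(** * The DAG compression *)

Lemma lift_pairs d (s : seq (nat * nat)) :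
  (forall x, x \in s -> x.1 < d /\ x.2 < d) ->
  exists s' : seq ('I_d * 'I_d), s = [seq (nat_of_ord x.1, nat_of_ord x.2) | x <- s'].
Proof.
elim: s => [|[x y] s IH] h; first by exists [::].
have [s' es] : exists s' : seq ('I_d * 'I_d), s = [seq (nat_of_ord x.1, nat_of_ord x.2) | x <- s'].
  by apply: IH => z zs; apply: h; rewrite inE zs orbT.
have [/= hx hy] := h (x, y) (mem_head _ _).
by exists ((Ordinal hx, Ordinal hy) :: s'); rewrite es.
Qed.

Lemma words_lift d (s : seq ('I_d * 'I_d)) :
  words_pairs s = wpairs [seq (nat_of_ord x.1, nat_of_ord x.2) | x <- s].
Proof. by rewrite /words_pairs /wpairs -map_comp. Qed.

Lemma mem_lift d (s : seq ('I_d * 'I_d)) (x : 'I_d * 'I_d) :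
  (x \in s) = ((nat_of_ord x.1, nat_of_ord x.2) \in [seq (nat_of_ord x.1, nat_of_ord x.2) | x <- s]).
Proof.
rewrite (mem_map (f := fun x : 'I_d * 'I_d => (nat_of_ord x.1, nat_of_ord x.2))) //.
by move=> [a b] [c d'] /= [/val_inj-> /val_inj->].
Qed.

Lemma hanc_trans i j k : 0 < i -> 0 < j -> hanc i j -> hanc j k -> hanc i k.
Proof.
move=> i0 j0 /(hancP _ i0)[x ex] /(hancP _ j0)[y ey].
by apply/hancP => //; exists (y + x); rewrite expnD divnMA ey.
Qed.

(** Leaf number [pos v] of the heap tree, shifted by one since nodes are now counted from 0. *)
Definition snkn (v : 'I_n) : nat := n - 1 + pos v.

Lemma snkn_lt v : snkn v < 2 * n - 1.
Proof. by have := pos_lt v; rewrite /snkn; lia. Qed.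

Let q := size bs.
Let d := 2 * n + 2 * q - 1.
Let A := arcs n bs q.

Lemma mem_arcs x y : ((x, y) \in A) <->
  ((0 < y < 2 * n - 1) && (x == (y - 1) %/ 2)) \/
  exists2 t, t < q &
    (x = 2 * n + 2 * t - 1 /\ y.+1 \in canonX n (nth b0 bs t)) \/
    (x = 2 * n + 2 * t /\ y.+1 \in canonY n (nth b0 bs t)).
Proof.
rewrite /A /arcs mem_cat; split.
  case/orP => [/mapP[v]|/flattenP[s /mapP[t]]].
    by rewrite mem_iota => hv [-> ->]; left; rewrite eqxx; lia.
  rewrite mem_iota add0n /= => tq -> h; right; exists t => //; move: h.
  rewrite /box_arcs mem_cat => /orP[]/mapP[i ic [-> ->]]; [left|right]; split=> //.
    have : 0 < i < n + (nth b0 bs t).1.2 by apply: canon_bound ic; lia.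
    by move=> hi; rewrite subn1 prednK //; lia.
  have : 0 < i < n + (nth b0 bs t).2.2 by apply: canon_bound ic; lia.
  by move=> hi; rewrite subn1 prednK //; lia.
case=> [/andP[hy /eqP->]|[t tq h]]; apply/orP; [left|right].
  by apply/mapP; exists y => //; rewrite mem_iota; lia.
apply/flattenP; exists (box_arcs n t (nth b0 bs t)).
  by apply/mapP; exists t => //; rewrite mem_iota.
rewrite /box_arcs mem_cat; apply/orP; case: h => -[-> h]; [left|right];
  by apply/mapP; exists y.+1 => //; rewrite subSS subn0.
Qed.

Lemma box_nth t : t < q -> box_in n (nth b0 bs t).
Proof. by move=> tq; apply: bs_in; apply: mem_nth. Qed.

Lemma canon_box_lt t i : t < q ->
  (i \in canonX n (nth b0 bs t)) || (i \in canonY n (nth b0 bs t)) -> 0 < i < 2 * n.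
Proof.
move=> tq; have /and3P[h1 h2 h3] := box_nth tq.
case/orP => ic.
  have : 0 < i < n + (nth b0 bs t).1.2 by apply: canon_bound ic; lia.
  lia.
have : 0 < i < n + (nth b0 bs t).2.2 by apply: canon_bound ic; lia.
lia.
Qed.

Lemma arcs_lt z : z \in A -> z.1 < d /\ z.2 < d.
Proof.
case: z => x y /mem_arcs[/andP[h /eqP->]|[t tq [[-> ic]|[-> ic]]]] /=; rewrite /d.
- lia.
- by have := @canon_box_lt t y.+1 tq; rewrite ic => /(_ isT); lia.
by have := @canon_box_lt t y.+1 tq; rewrite ic orbT => /(_ isT); lia.
Qed.

Lemma arcs_src t x y : t <= q -> (x, y) \in arcs n bs t -> x < 2 * n + 2 * t - 1.
Proof.
elim: t => [|t IH] tq.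
  rewrite /arcs cats0 => /mapP[v]; rewrite mem_iota => hv [-> _].
  by clear - hv; lia.
rewrite arcsS mem_cat => /orP[/(IH (ltnW tq))|]; first by clear; lia.
by rewrite /box_arcs mem_cat => /orP[]/mapP[i _ [-> _]]; clear - n_gt0; lia.
Qed.

Lemma uniq_arcs : uniq A.
Proof.
rewrite /A; elim: {-2}q (leqnn q) => [|t IH] tq.
  by rewrite /arcs cats0 map_inj_uniq ?iota_uniq // => v v' [].
rewrite arcsS cat_uniq IH ?(ltnW tq) //=; apply/andP; split.
  apply/hasPn => -[x y]; rewrite /box_arcs mem_cat => h.
  have hx : 2 * n + 2 * t - 1 <= x.
    by case/orP: h => /mapP[i _ [-> _]]; clear; lia.
  by apply/negP => /(arcs_src (ltnW tq)); rewrite ltnNge hx.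
have /and3P[h1 h2 h3] := box_nth tq.
have inj (a : nat) (s : seq nat) : uniq s -> (forall i, i \in s -> 0 < i) ->
    uniq [seq (a, i - 1) | i <- s].
  move=> us h; rewrite map_inj_in_uniq // => i j /h i0 /h j0 [].
  by clear - i0 j0; lia.
rewrite /box_arcs cat_uniq; apply/and3P; split.
- apply: inj; first by apply: canon_uniq; clear - n_gt0 h2; lia.
  by move=> i ic; have := @canon_box_lt t i tq; rewrite ic => /(_ isT) /andP[].
- apply/hasPn => z /mapP[i _ ->]; apply/negP => /mapP[j _ [h _]].
  by clear - h n_gt0; lia.
apply: inj; first by apply: canon_uniq; clear - n_gt0 h3; lia.
by move=> i ic; have := @canon_box_lt t i tq; rewrite ic orbT => /(_ isT) /andP[].
Qed.

Definition darc (x y : 'I_d) : bool := (nat_of_ord x, nat_of_ord y) \in A.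

Lemma darc_heap (x y : 'I_d) : x < 2 * n - 1 -> darc x y ->
  y < 2 * n - 1 /\ hanc x.+1 y.+1.
Proof.
move=> hx /mem_arcs[/andP[hy /eqP e1]|[t tq [[e1 _]|[e1 _]]]]; try (simpl in *; lia).
split; first by simpl in *; lia.
apply/hancP => //; exists 1; rewrite expn1 /= e1; simpl in *; lia.
Qed.

Lemma connect_heap (x y : 'I_d) : x < 2 * n - 1 -> y < 2 * n - 1 ->
  connect darc x y = hanc x.+1 y.+1.
Proof.
move=> hx hy; apply/idP/idP => [/connectP[p]|].
  elim: p x hx => [|z p IH] x hx /=; first by move=> _ ->; apply: hanc_refl.
  move=> /andP[a pth] e1; have [hz h] := darc_heap hx a.
  by apply: hanc_trans h (IH z hz pth e1).
move=> /(hancP _ (ltn0Sn x))[k]; elim: k y hy => [|k IH] y hy ek.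
  suff -> : y = x by apply: connect0.
  by apply: val_inj; move: ek; rewrite divn1 => -[].
have y0 : 0 < y.
  by case: posnP ek => // ->; rewrite divn_small // -[1]/(2 ^ 0) ltn_exp2l.
have hz : (y - 1) %/ 2 < d.
  by apply: leq_ltn_trans (leq_div _ _) _; apply: leq_ltn_trans (leq_subr _ _) (ltn_ord y).
apply: (@connect_trans _ _ (Ordinal hz)).
  apply: IH => /=; first lia.
  by move: ek; rewrite expnS divnMA => <-; congr (_ %/ _); lia.
by apply: connect1; apply/mem_arcs; left; rewrite eqxx andbT /=; lia.
Qed.

(** A path from a box node first enters a canonical node and then stays in the heap tree, so the
    reachable leaves are those below a canonical node; [canon_leaf] identifies them. *)
Lemma connect_box (x : 'I_d) (y : 'I_d) v x0 x1 :
  2 * n - 1 <= x -> y = snkn v :> nat -> x0 < x1 <= n ->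
  (forall z : 'I_d, darc x z = (z.+1 \in canon (n + x0) (n + x1))) ->
  connect darc x y = (x0 <= pos v < x1).
Proof.
move=> hx ey hxx hd; have vn := pos_lt v; have sv := snkn_lt v.
have yE : y.+1 = n + pos v by rewrite ey /snkn; lia.
have cE := @canon_leaf n x0 x1 (pos v) n_gt0 (proj2 (andP hxx)) vn.
apply/idP/idP => [/connectP[[|z p] /= ]|h].
- by move=> _ e1; move: hx; rewrite -e1 ey; lia.
- move=> /andP[a pth] e1.
  have : 0 < nat_of_bool (x0 <= pos v < x1); last by rewrite lt0b.
  rewrite -cE -has_count; apply/hasP.
  have zc : z.+1 \in canon (n + x0) (n + x1) by rewrite -hd.
  have zb : 0 < z.+1 < n + x1 by apply: canon_bound zc; lia.
  have zl : z < 2 * n - 1 by clear - zb hxx; lia.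
  have yl : y < 2 * n - 1 by rewrite ey.
  exists z.+1 => //; rewrite -yE -connect_heap //.
  by apply/connectP; exists p.
have : 0 < count (fun i => hanc i (n + pos v)) (canon (n + x0) (n + x1)).
  by rewrite cE h.
rewrite -has_count => /hasP[i ic hi].
have ib : 0 < i < n + x1 by apply: canon_bound ic; lia.
have hz : i - 1 < d by rewrite /d; lia.
apply: (@connect_trans _ _ (Ordinal hz)).
  by apply: connect1; rewrite hd /= subn1 prednK //; lia.
by rewrite connect_heap /= ?yE ?subn1 ?prednK //; lia.
Qed.

Lemma darc_X t (z x : 'I_d) : t < q -> x = 2 * n + 2 * t - 1 :> nat ->
  darc x z = (z.+1 \in canonX n (nth b0 bs t)).
Proof.
move=> tq ex; apply/idP/idP => [/mem_arcs[|[t' tq' [[e1 h]|[e1 h]]]]|h].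
- by rewrite ex; lia.
- by have -> : t = t' by rewrite ex in e1; lia.
- by rewrite ex in e1; lia.
by apply/mem_arcs; right; exists t => //; left.
Qed.

Lemma darc_Y t (z x : 'I_d) : t < q -> x = 2 * n + 2 * t :> nat ->
  darc x z = (z.+1 \in canonY n (nth b0 bs t)).
Proof.
move=> tq ex; apply/idP/idP => [/mem_arcs[|[t' tq' [[e1 h]|[e1 h]]]]|h].
- by rewrite ex; lia.
- by rewrite ex in e1; lia.
- by have -> : t = t' by rewrite ex in e1; lia.
by apply/mem_arcs; right; exists t => //; right.
Qed.

Lemma connect_X t (x y : 'I_d) v : t < q -> x = 2 * n + 2 * t - 1 :> nat ->
  y = snkn v :> nat -> connect darc x y = ((nth b0 bs t).1.1 <= pos v < (nth b0 bs t).1.2).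
Proof.
move=> tq ex ey; have /and3P[h1 h2 h3] := box_nth tq.
apply: connect_box => //; [rewrite ex; lia|by rewrite h1|].
by move=> z; rewrite (darc_X _ tq ex).
Qed.

Lemma connect_Y t (x y : 'I_d) v : t < q -> x = 2 * n + 2 * t :> nat ->
  y = snkn v :> nat -> connect darc x y = ((nth b0 bs t).2.1 <= pos v < (nth b0 bs t).2.2).
Proof.
move=> tq ex ey; have /and3P[h1 h2 h3] := box_nth tq.
apply: connect_box => //; first by rewrite ex; lia.
by move=> z; rewrite (darc_Y _ tq ex).
Qed.

Lemma snk_lt v : snkn v < d.
Proof. by have := snkn_lt v; rewrite /d; lia. Qed.

Definition snk (v : 'I_n) : 'I_d := Ordinal (snk_lt v).

(** The rank is 0 on box nodes and the heap index on tree nodes; it grows along every arc. *)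
Lemma darc_acyclic : acyclic darc.
Proof.
pose f (x : 'I_d) := if x < 2 * n - 1 then x.+1 else 0.
have fa (x y : 'I_d) : darc x y -> f x < f y.
  rewrite /f => /mem_arcs[/andP[hy /eqP e1]|[t tq h]].
    by rewrite !ifT; clear - e1 hy; lia.
  have hx : (x < 2 * n - 1) = false by case: h => -[/= -> _]; lia.
  have := @canon_box_lt t y.+1 tq; rewrite hx.
  case: h => -[_ ->]; rewrite ?orbT => /(_ isT) h; rewrite ifT //; lia.
have fc (x y : 'I_d) : connect darc x y -> f x <= f y.
  move=> /connectP[p]; elim: p x => [|z p IH] x /=; first by move=> _ ->.
  move=> /andP[a pth] e1; apply: leq_trans (IH z pth e1); exact: ltnW (fa _ _ a).
move=> x y a; apply/negP => /fc; rewrite leqNgt; by rewrite fa.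
Qed.

Lemma darc_sinks x : is_sink darc x <-> exists u, x = snk u.
Proof.
split=> [/forallP s|[u ->]].
  have ns y : (nat_of_ord x, y) \in A -> False.
    by move=> h; have [_ /= yd] := arcs_lt h; move: (s (Ordinal yd)); rewrite /darc h.
  have [hx|hx] := ltnP x (2 * n - 1); last first.
    have xd := ltn_ord x.
    have tq : (x - (2 * n - 1)) %/ 2 < q by clear - xd n_gt0 hx; rewrite [in X in _ < X]/d in xd; lia.
    have /and3P[h1 h2 h3] := box_nth tq; set t := _ %/ 2 in tq h1 h2 h3.
    have [ex|ex] : x = 2 * n + 2 * t - 1 :> nat \/ x = 2 * n + 2 * t :> nat.
      by clear - hx n_gt0; rewrite /t; lia.
    (* The side of a box is nonempty, so some canonical node lies above its first leaf and the box
       node is no sink. *)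
    - have := @canon_leaf n (nth b0 bs t).1.1 (nth b0 bs t).1.2 (nth b0 bs t).1.1 n_gt0 h2.
      rewrite leqnn h1 => /(_ (leq_trans h1 h2)).
      case E : (canon _ _) => [|i l] // _.
      case: (ns i.-1); apply/mem_arcs; right; exists t => //; left; split=> //.
      have : i \in canonX n (nth b0 bs t) by rewrite /canonX E mem_head.
      by have := @canon_box_lt t i tq => + ic; rewrite ic => /(_ isT) hi; rewrite prednK //; lia.
    have := @canon_leaf n (nth b0 bs t).2.1 (nth b0 bs t).2.2 (nth b0 bs t).2.1 n_gt0.
    case/andP: h3 => h3 h4; rewrite leqnn h3 => /(_ h4 (leq_trans h3 h4)).
    case E : (canon _ _) => [|i l] // _.
    case: (ns i.-1); apply/mem_arcs; right; exists t => //; right; split=> //.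
    have : i \in canonY n (nth b0 bs t) by rewrite /canonY E mem_head.
    by have := @canon_box_lt t i tq => + ic; rewrite ic orbT => /(_ isT) hi; rewrite prednK //; lia.
  have [lx|gx] := ltnP x (n - 1).
    case: (ns (2 * x + 1)); apply/mem_arcs; left; apply/andP.
    by split; [|apply/eqP]; clear - lx; lia.
  exists (ov (x - (n - 1))); apply: val_inj; rewrite /= /snkn ovK; lia.
apply/forallP => y; apply/negP => /mem_arcs[/andP[hy /eqP /= e1]|[t tq h]].
  by move: e1; rewrite /snkn; have := pos_lt u; lia.
have := snkn_lt u; case: h => -[/= -> _]; lia.
Qed.

Lemma dag_exists : exists (arc : rel 'I_d) (sk : 'I_n -> 'I_d) (BD : {set {set 'I_d}}),
  [/\ dag_compression e arc sk BD, dag_size arc BD <= d + size A + q &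
      encodes_dag ([:: d; size A; q] ++ [seq snkn v | v <- enum 'I_n] ++ wpairs A ++
                   wpairs (box_pairs n q)) arc sk BD].
Proof.
have [sE eE] := lift_pairs arcs_lt.
have bpP z : z \in box_pairs n q -> exists2 t, t < q & z = (2 * n + 2 * t - 1, 2 * n + 2 * t).
  by move=> /mapP[t]; rewrite mem_iota add0n => tq ->; exists t.
have [|sB eB] := @lift_pairs d (box_pairs n q).
  by move=> z /bpP[t tq ->] /=; clear - tq n_gt0; rewrite /d; lia.
have sBP (x : 'I_d * 'I_d) : x \in sB ->
    exists2 t, t < q & x.1 = 2 * n + 2 * t - 1 :> nat /\ x.2 = 2 * n + 2 * t :> nat.
  by rewrite mem_lift -eB => /bpP[t tq [e1 e2]]; exists t.
pose BD := [set P in [seq [set x.1; x.2] | x <- sB]].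
have BDP P : reflect (exists2 x, x \in sB & P = [set x.1; x.2]) (P \in BD).
  by rewrite inE; apply: mapP.
have szE : size sE = size A by rewrite eE size_map.
have szB : size sB = q by rewrite -(size_map (fun x : 'I_d * 'I_d => (nat_of_ord x.1, nat_of_ord x.2))) -eB size_mkseq.
have uE : uniq sE.
  by apply: (@map_uniq _ _ (fun x : 'I_d * 'I_d => (nat_of_ord x.1, nat_of_ord x.2))); rewrite -eE uniq_arcs.
have uB : uniq sB.
  apply: (@map_uniq _ _ (fun x : 'I_d * 'I_d => (nat_of_ord x.1, nat_of_ord x.2))); rewrite -eB.
  by apply: mkseq_uniq => t t' []; clear; lia.
have edge_dir u v : pos u < pos v -> e u v -> exists X Y : 'I_d,
    [/\ [set X; Y] \in BD, connect darc X (snk u) & connect darc Y (snk v)].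
  move=> lt uv; have [b bb ib] := edge_box lt uv.
  have tq : index b bs < q by rewrite index_mem.
  have hX : 2 * n + 2 * index b bs - 1 < d by clear - tq n_gt0; rewrite /d; lia.
  have hY : 2 * n + 2 * index b bs < d by clear - tq n_gt0; rewrite /d; lia.
  exists (Ordinal hX), (Ordinal hY).
  case/andP: ib => iX iY; split.
  - apply/BDP; exists (Ordinal hX, Ordinal hY) => //; rewrite mem_lift -eB /=.
    by apply/mapP; exists (index b bs) => //; rewrite mem_iota.
  - by rewrite (@connect_X (index b bs) _ _ u) // nth_index.
  by rewrite (@connect_Y (index b bs) _ _ v) // nth_index.
exists darc, snk, BD; split.
- split; [exact: darc_acyclic| |exact: darc_sinks| |].
  + by move=> u v [] /addnI /pos_inj.
  + move=> P /BDP[x xs ->]; have [t _ [e1 e2]] := sBP x xs.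
    rewrite cards2 (_ : x.1 != x.2) //; apply/eqP => ex.
    by move: e1; rewrite ex e2; clear - n_gt0; lia.
  move=> u v; split=> [uv|[x [y [/BDP[z zs E] cx cy]]]].
    case: (edge_pos uv) => lt; first exact: edge_dir.
    have vu : e v u by rewrite (e_simple.1 v u).
    have [X [Y [h1 h2 h3]]] := edge_dir v u lt vu.
    by exists Y, X; rewrite setUC.
  have [t tq [e1 e2]] := sBP z zs.
  have bb : nth b0 bs t \in bs by apply: mem_nth.
  have [[ex ey]|[ex ey]] := set2_eq E; subst x y.
    rewrite (@connect_X t _ _ u) // in cx; rewrite (@connect_Y t _ _ v) // in cy.
    by have [] := @box_edge (nth b0 bs t) u v bb; rewrite /inbox ?cx ?cy.
  rewrite (@connect_Y t _ _ u) // in cx; rewrite (@connect_X t _ _ v) // in cy.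
  rewrite (e_simple.1 u v).
  by have [] := @box_edge (nth b0 bs t) v u bb; rewrite /inbox ?cx ?cy.
- rewrite /dag_size card_ord -!addnA leq_add2l leq_add //.
    rewrite -szE; apply: leq_trans (card_size _); apply: subset_leq_card.
    by apply/subsetP => x; rewrite inE /darc mem_lift -eE.
  rewrite -szB -(size_map (fun x : 'I_d * 'I_d => [set x.1; x.2])).
  apply: leq_trans (card_size _); apply: subset_leq_card.
  by apply/subsetP => P; rewrite inE.
exists sE, sB; split=> //.
- by move=> x; rewrite /darc mem_lift -eE.
- split; last by move=> P; rewrite inE.
  rewrite map_inj_in_uniq // => x y xs ys /set2_eq.
  have [t _ [x1 x2]] := sBP x xs; have [t' _ [y1 y2]] := sBP y ys.
  case=> -[h1 h2]; first by case: x y h1 h2 {x1 x2 y1 y2 xs ys} => ? ? [? ?] /= -> ->.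
  by move: x1; rewrite h1 y2; clear - n_gt0; lia.
by rewrite szE szB !words_lift -eE -eB.
Qed.

(** * The positive tree model *)

Let m := 2 * n - 1.

Lemma hpar_lt (j : 'I_m) : (j - 1) %/ 2 < m.
Proof. by apply: leq_ltn_trans (leq_div _ _) _; apply: leq_ltn_trans (leq_subr _ _) (ltn_ord j). Qed.

Definition hpar (j : 'I_m) : 'I_m := Ordinal (hpar_lt j).

Lemma hanc1 z : 0 < z -> hanc 1 z.
Proof.
have [k] := ubnP z; elim: k z => // k IH [|[|z]] // zk _; rewrite hanc_half //.
by rewrite (IH (z.+2 %/ 2)) ?orbT //; lia.
Qed.

Lemma anc_hpar (u v : 'I_m) : anc hpar u v = hanc u.+1 v.+1.
Proof.
apply/ancP/idP => [[k]|/(hancP _ (ltn0Sn u))[k]].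
  elim: k v => [|k IH] v; first by move=> /= ->; apply: hanc_refl.
  rewrite iterSr => /IH h; rewrite hanc_half //.
  have [v0|v0] := posnP v.
    by rewrite v0; move: h; rewrite /= v0 hanc_half.
  by rewrite (_ : v.+1 %/ 2 = (hpar v).+1) ?h ?orbT //=; clear - v0; lia.
elim: k v => [|k IH] v ek.
  by exists 0; apply: val_inj; move: ek; rewrite divn1 => -[].
have v0 : 0 < v.
  by case: posnP ek => // ->; rewrite divn_small // -[1]/(2 ^ 0) ltn_exp2l.
have [|k' ek'] := IH (hpar v); last by exists k'.+1; rewrite iterSr.
by rewrite -ek expnS divnMA; congr (_ %/ _); rewrite /=; clear - v0; lia.
Qed.

Let mE : m = 2 * n - 1. Proof. by []. Qed.

Lemma m_gt0 : 0 < m. Proof. by clear - n_gt0; rewrite /m; lia. Qed.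

Lemma hchildren (u v : 'I_m) :
  (v \in children hpar u) = (v == 2 * u + 1 :> nat) || (v == 2 * u + 2 :> nat).
Proof.
rewrite inE -!val_eqE /=; have [v0|v0] := posnP v.
  by rewrite v0 /=; clear; lia.
by clear - v0; lia.
Qed.

Lemma hleaf (u : 'I_m) : is_leaf hpar u = (n - 1 <= u).
Proof.
apply/eqP/idP => [E|h].
  rewrite leqNgt; apply/negP => h.
  have hc : 2 * u + 1 < m by clear - h mE; lia.
  have : Ordinal hc \in children hpar u by rewrite hchildren eqxx.
  by rewrite E inE.
apply/setP => v; rewrite hchildren inE; apply/negbTE; rewrite negb_or.
by have := ltn_ord v; clear - h mE; lia.
Qed.

Lemma hfull : full_binary_tree hpar.
Proof.
split.
  exists (Ordinal m_gt0); first by apply: val_inj.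
  by move=> v; rewrite -[fconnect _ _ _]/(anc hpar _ _) anc_hpar hanc1.
move=> u; have [l|nl] := boolP (is_leaf hpar u); [by left|right].
move: nl; rewrite hleaf -ltnNge => h.
have h1 : 2 * u + 1 < m by clear - h mE; lia.
have h2 : 2 * u + 2 < m by clear - h mE; lia.
have -> : children hpar u = [set Ordinal h1; Ordinal h2].
  by apply/setP => v; rewrite hchildren !inE -!val_eqE.
rewrite cards2 -val_eqE /= (_ : 2 * u + 1 != 2 * u + 2) //; clear; lia.
Qed.

Definition hlf (v : 'I_n) : 'I_m := Ordinal (snkn_lt v).

Lemma anc_hlf (u : 'I_m) v : anc hpar u (hlf v) = hanc u.+1 (n + pos v).
Proof. by rewrite anc_hpar /= /snkn; congr hanc; clear - n_gt0; lia. Qed.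

Let pl := flatten [seq tree_pairs n b | b <- bs].

Lemma count_allpairs_and (S1 S2 : Type) (f : S1 -> nat) (g : S2 -> nat)
    (P Q : pred nat) s t :
  count (fun z => P z.1 && Q z.2) [seq (f i, g j) | i <- s, j <- t] =
  count (fun i => P (f i)) s * count (fun j => Q (g j)) t.
Proof.
elim: s => //= i s IH; rewrite count_cat IH mulnDl; congr (_ + _).
rewrite count_map; case Pi : (P (f i)); rewrite ?mul1n ?mul0n.
  by apply: eq_count => j /=; rewrite Pi.
by rewrite -[RHS](count_pred0 t); apply: eq_count => j /=; rewrite Pi.
Qed.

(** For one box the count factors over the two sides, and each factor is 0 or 1 because at most one
    canonical node lies above a leaf. *)
Lemma pl_cover x y : x < n -> y < n ->
  count (fun z => hanc z.1.+1 (n + x) && hanc z.2.+1 (n + y)) pl = cover_count bs x y.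
Proof.
move=> xn yn; rewrite /pl /cover_count; elim: bs bs_in => //= b l IH h.
rewrite count_cat IH; last by move=> z zl; apply: h; rewrite inE zl orbT.
congr (_ + _); have /and3P[h1 h2 /andP[h3 h4]] := h b (mem_head _ _).
rewrite /tree_pairs (count_allpairs_and (fun i => i - 1) (fun i => i - 1)
  (fun i => hanc i.+1 (n + x)) (fun i => hanc i.+1 (n + y))).
have red z l0 r0 : 0 < l0 -> count (fun i => hanc (i - 1).+1 z) (canon l0 r0) =
    count (fun i => hanc i z) (canon l0 r0).
  move=> l00; apply: eq_in_count => i ic.
  have := canon_bound l00 ic => /andP[i0 _].
  by rewrite subn1 prednK.
rewrite /canonX /canonY !red ?canon_leaf //; try (by clear - n_gt0; lia).
by rewrite /inbox mulnb.
Qed.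

Lemma pl_lt z : z \in pl -> z.1 < m /\ z.2 < m.
Proof.
move=> /flattenP[s /mapP[b bb ->]] /allpairsP[[i j] /= [ic jc ->]] /=.
have /and3P[h1 h2 /andP[h3 h4]] := bs_in bb.
have l1 : 0 < n + b.1.1 by clear - n_gt0; lia.
have l2 : 0 < n + b.2.1 by clear - n_gt0; lia.
have := canon_bound l1 ic; have := canon_bound l2 jc.
by clear - h2 h4; rewrite /m; lia.
Qed.

(** Everything rests on one fact: an ordered pair of leaves lies below at most one pair of the
    model. Distinct nested pairs, as well as crossing ones, would have leaf pairs in common. *)
Lemma positive_exists :
  exists (par' : 'I_m -> 'I_m) (B' : {set {set 'I_m}}) (lf' : 'I_n -> 'I_m),
  [/\ positive_tree_model_of e par' B' lf', #|B'| <= size pl &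
      encodes_stm ([:: n; m; 0; size pl] ++ [seq (v - 1) %/ 2 | v <- iota 0 m] ++
        [seq snkn v | v <- enum 'I_n] ++ wpairs pl) par' set0 B' lf'].
Proof.
have [sB eB] := lift_pairs pl_lt.
pose B' := [set P in [seq [set x.1; x.2] | x <- sB]].
have BP P : reflect (exists2 x, x \in sB & P = [set x.1; x.2]) (P \in B').
  by rewrite inE; apply: mapP.
pose cov u v (x : 'I_m * 'I_m) := anc hpar x.1 (hlf u) && anc hpar x.2 (hlf v).
have covE u v : count (cov u v) sB = (pos u < pos v) && e u v.
  rewrite -cover_pos -pl_cover ?pos_lt // eB count_map.
  by apply: eq_count => x; rewrite /cov !anc_hlf.
have cov1 u v x y : x \in sB -> y \in sB -> cov u v x -> cov u v y -> x = y.
  by apply: count1_eq; rewrite covE leq_b1.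
have cov_edge u v x : x \in sB -> cov u v x -> pos u < pos v /\ e u v.
  move=> xs cx; have : 0 < count (cov u v) sB by rewrite -has_count; apply/hasP; exists x.
  by rewrite covE lt0b => /andP.
have edge_cov u v : pos u < pos v -> e u v -> exists2 x, x \in sB & cov u v x.
  by move=> lt uv; apply/hasP; rewrite has_count covE lt uv.
have uncov (u' v' : 'I_m) u v : [set u'; v'] \in B' -> anc hpar u' (hlf u) ->
    anc hpar v' (hlf v) -> exists2 x, x \in sB &
    ((u' = x.1 /\ v' = x.2) /\ cov u v x) \/ ((u' = x.2 /\ v' = x.1) /\ cov v u x).
  move=> /BP[x xs E] au av; exists x => //.
  have [[eu ev]|[eu ev]] := set2_eq E; subst u' v'; [left|right]; split=> //.
    by rewrite /cov au av.
  by rewrite /cov au av.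
have to_edge (u' v' : 'I_m) u v : [set u'; v'] \in B' -> anc hpar u' (hlf u) ->
    anc hpar v' (hlf v) -> e u v.
  move=> h1 h2 h3; have [x xs [[_ c]|[_ c]]] := uncov _ _ _ _ h1 h2 h3.
    by have [] := cov_edge _ _ _ xs c.
  by rewrite (e_simple.1 u v); have [] := cov_edge _ _ _ xs c.
have same (u' v' u2 v2 : 'I_m) u v : [set u'; v'] \in B' -> [set u2; v2] \in B' ->
    anc hpar u' (hlf u) -> anc hpar v' (hlf v) ->
    anc hpar u2 (hlf u) -> anc hpar v2 (hlf v) -> u' = u2 /\ v' = v2.
  move=> b1 b2 a1 a2 a3 a4.
  have [x xs c1] := uncov _ _ _ _ b1 a1 a2; have [y ys c2] := uncov _ _ _ _ b2 a3 a4.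
  case: c1 => -[[-> ->] c1]; case: c2 => -[[-> ->] c2].
  - by rewrite (cov1 _ _ _ _ xs ys c1 c2).
  - have [l1 _] := cov_edge _ _ _ xs c1; have [l2 _] := cov_edge _ _ _ ys c2.
    by exfalso; clear - l1 l2; lia.
  - have [l1 _] := cov_edge _ _ _ xs c1; have [l2 _] := cov_edge _ _ _ ys c2.
    by exfalso; clear - l1 l2; lia.
  by rewrite (cov1 _ _ _ _ xs ys c1 c2).
have has_leaf (u : 'I_m) : exists v, anc hpar u (hlf v).
  have [|z zn h] := @hanc_has_leaf n u.+1.
    by have := ltn_ord u; clear - mE; lia.
  by exists (ov z); rewrite anc_hlf ovK.
have trans u v x : anc hpar u v -> anc hpar v x -> anc hpar u x.
  exact: anc_trans.
(* Otherwise a leaf below [v'] would be below both ends and adjacent to itself. *)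
have inc (u' v' : 'I_m) : [set u'; v'] \in B' -> ~~ anc hpar u' v'.
  move=> h; apply/negP => a; have [v av] := has_leaf v'.
  have := to_edge _ _ _ _ h (trans _ _ _ a av) av.
  by rewrite e_simple.2.
have mem2 (P : {set 'I_m}) u v : P \in B' -> u \in P -> v \in P -> u != v ->
    [set u; v] \in B'.
  move=> PB; have /BP[x _ E] := PB; rewrite E !in_set2.
  move=> /orP[]/eqP-> /orP[]/eqP->; rewrite ?eqxx // => _; first by rewrite -E.
  by rewrite setUC -E.
exists hpar, B', hlf; split.
- split.
  + split; first exact: hfull.
    * by apply/pred0P => P /=; rewrite inE.
    * move=> P; rewrite set0U => PB; have /BP[x xs E] := PB.
      exists x.1, x.2; split=> //; apply: inc; rewrite -?E // setUC -E //.
    move=> P Q; rewrite !set0U => PB QB; apply/negP => /andP[].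
    move=> /existsP[u /andP[uP /existsP[v /andP[vQ /andP[a1 n1]]]]].
    move=> /existsP[v' /andP[vQ' /existsP[u' /andP[uP' /andP[a2 n2]]]]].
    have asym := @anc_antisym _ _ hfull.
    have uu : u != u'.
      apply/eqP => E; subst u'.
      have [E|ne] := eqVneq v' v; first by subst v'; rewrite (asym _ _ a1 a2) eqxx in n1.
      by have := inc _ _ (mem2 _ _ _ QB vQ' vQ ne); rewrite (trans _ _ _ a2 a1).
    have vv : v != v'.
      apply/eqP => E; subst v'.
      by have := inc _ _ (mem2 _ _ _ PB uP uP' uu); rewrite (trans _ _ _ a1 a2).
    (* With [u] above [v] and [v'] above [u'], a leaf below [v] and a leaf below [u'] lie under both
       pairs, which forces [u = v]. *)
    have [x ax] := has_leaf v; have [y ay] := has_leaf u'.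
    have [E _] := same _ _ _ _ x y (mem2 _ _ _ PB uP uP' uu) (mem2 _ _ _ QB vQ vQ' vv)
       (trans _ _ _ a1 ax) ay ax (trans _ _ _ a2 ay).
    by rewrite E eqxx in n1.
  + by move=> u v [] /addnI /pos_inj.
  + move=> u; rewrite hleaf; split=> [h|[v ->]]; last by rewrite /= /snkn leq_addr.
    exists (ov (u - (n - 1))); apply: val_inj; rewrite /= /snkn.
    have hu := ltn_ord u.
    by rewrite ovK; clear - h hu n_gt0 mE; lia.
  move=> u v; split=> [uv|[u' [v' [h1 [a1 a2 _]]]]]; last exact: to_edge h1 a1 a2.
  have [u' [v' [h1 a1 a2]]] : exists u' v', [/\ [set u'; v'] \in B',
      anc hpar u' (hlf u) & anc hpar v' (hlf v)].
    case: (edge_pos uv) => lt.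
      have [x xs /andP[c1 c2]] := edge_cov _ _ lt uv.
      by exists x.1, x.2; split=> //; apply/BP; exists x.
    rewrite (e_simple.1 u v) in uv; have [x xs /andP[c1 c2]] := edge_cov _ _ lt uv.
    by exists x.2, x.1; split=> //; apply/BP; exists x => //; rewrite setUC.
  exists u', v'; split=> //; split=> // -[u2 [v2 []]]; rewrite set0U => h2 ne.
  move=> /andP[_ b1] /andP[_ b2]; move/negP: ne; apply.
  by have [-> ->] := same _ _ _ _ _ _ h1 h2 a1 a2 b1 b2.
- rewrite eB size_map -(size_map (fun x : 'I_m * 'I_m => [set x.1; x.2])).
  apply: leq_trans (card_size _); apply: subset_leq_card.
  by apply/subsetP => P; rewrite inE.
exists [::], sB; split.
- by split=> // P; rewrite inE.
- split; last by move=> P; rewrite inE.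
  have usB : uniq sB.
    apply: count_mem_uniq => x; have [xs|nx] := boolP (x \in sB); last exact/count_memPn.
    have [u au] := has_leaf x.1; have [v av] := has_leaf x.2.
    have : count_mem x sB <= count (cov u v) sB.
      by apply: sub_count => y /= /eqP->; rewrite /cov au av.
    have : 0 < count_mem x sB by rewrite -has_count has_pred1.
    by rewrite covE; case: (_ && _) => /=; clear; lia.
  rewrite map_inj_in_uniq // => x y xs ys E.
  have [u au] := has_leaf x.1; have [v av] := has_leaf x.2.
  have hx : [set x.1; x.2] \in B' by apply/BP; exists x.
  have cx : cov u v x by rewrite /cov au av.
  have [[e1 e2]|[e1 e2]] := set2_eq E.
    by case: x y e1 e2 {xs ys E au av hx cx} => ? ? [? ?] /= -> ->.
  have cy : cov v u y by rewrite /cov -e1 -e2 au av.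
  have [l1 _] := cov_edge _ _ _ xs cx; have [l2 _] := cov_edge _ _ _ ys cy.
  by exfalso; clear - l1 l2; lia.
have szB : size sB = size pl by rewrite eB size_map.
have -> : words_fun hpar = [seq (v - 1) %/ 2 | v <- iota 0 m].
  by rewrite /words_fun -val_enum_ord -map_comp; apply: eq_map.
by rewrite szB (words_lift sB) -eB.
Qed.

End Boxes.

(** * The complete algorithm *)

(** Inverts the map from leaves to positions by direct addressing. The place of a leaf in the heap
    tree goes both to the sinks of the DAG and to the leaf table of the positive model. *)
Definition order_out : prog :=
  5 <~ '#0 ;;
  PFor 5 0
    (6 <~ 8 @[0 @['R 1 +! 'R 5 +! '#4]] ;;
     1 @{'R 6 +! '#1} <~ 'R 5 ;;
     2 @{'R 5 +! '#3} <~ 'R 0 +! 'R 6 -: '#1 ;;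
     3 @{'#2 *! 'R 0 +! 'R 5 +! '#3} <~ 'R 0 +! 'R 6 -: '#1).

Lemma order_outP w n m (ps lfn : nat -> nat) s :
  regs s 0 = n -> regs s 1 = m -> 10 * n + 10 * m + 100 < 2 ^ w ->
  (forall x, x < n -> arrs s 0 (m + x + 4) = lfn x) ->
  (forall x, x < n -> arrs s 8 (lfn x) = ps x) ->
  (forall x, x < n -> ps x < n) ->
  (forall x y, x < n -> y < n -> ps x = ps y -> x = y) ->
  wp w order_out s (fun k s' => [/\ k <= 80 * n + 20,
    forall x, x < n -> arrs s' 1 (1 + ps x) = x,
    forall x, x < n -> arrs s' 2 (3 + x) = n - 1 + ps x &
    forall x, x < n -> arrs s' 3 (2 * n + 3 + x) = n - 1 + ps x]).
Proof.
move=> h0 h1 W h4 h8 pl pinj; have w1 : 1 < 2 ^ w by lia.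
apply: wp_seq; wreg; first lia.
set s0 := set_reg _ _ _.
pose I k (b : nat) s' := [/\ forall x, x < k -> arrs s' 1 (1 + ps x) = x,
    forall x, x < k -> arrs s' 2 (3 + x) = n - 1 + ps x &
    forall x, x < k -> arrs s' 3 (2 * n + 3 + x) = n - 1 + ps x].
apply: (@wp_for _ _ _ _ I 60 n 0) => //.
- by rewrite /s0 /= /upd /=; lia.
- rewrite /s0 /= /upd /= => x bg s1 xn e5 e0 F [i1 i2 i3].
  have e1 : regs s1 1 = m by rewrite F.1.
  have a0 : arrs s1 0 = arrs s 0 by rewrite F.2.
  have a8 : arrs s1 8 = arrs s 8 by rewrite F.2.
  have pn := pl x xn.
  apply: wp_seq; wreg; first by rewrite e1 e5; do ?split=> //; lia.
  rewrite e1 e5 a0 a8 h4 // h8 //.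
  apply: wp_seq; warr; first by rewrite /= /upd /=; do ?split=> //; lia.
  apply: wp_seq; warr; try by rewrite /= /upd /= ?e5 ?e0; do ?split=> //; lia.
  warr; try by rewrite /= /upd /= ?e5 ?e0; do ?split=> //; lia.
  rewrite /= /upd /= e5 e0.
  exists 0; split; first lia.
  split=> y; rewrite ltnS leq_eqVlt /= /upd /= => /predU1P[->|yx].
  - by rewrite addnC eqxx.
  - rewrite neqF ?i1 // => e2.
    by have := @pinj y x; lia.
  - by rewrite addnC eqxx; lia.
  - by rewrite neqF ?i2 //; lia.
  - by rewrite (_ : 2 * n + 3 + x = 2 * n + x + 3) ?eqxx; lia.
  by rewrite neqF ?i3 //; lia.
move=> k bg s1 [i1 i2 i3] _ _ le F; split=> //.
by move: le; rewrite /s0 /= /upd /=; lia.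
Qed.

(** A single segment of colour 0. Breakpoint [n] alone has to be entered, since the entry for
    breakpoint 0 is the value 0 already stored. *)
Definition init_seg : prog :=
  21 <~ 'R 0 +! '#1 ;; 10 <~ 'R 0 ;; 11 <~ 'R 0 ;; heap_update ;;
  23 @{'#0} <~ 'R 0 ;; 20 <~ '#0.

Lemma init_segP w n s :
  regs s 0 = n -> 0 < n -> 10 * n + 100 < 2 ^ w ->
  (forall i, arrs s 22 i = 0) -> (forall i, arrs s 24 i = 0) ->
  (forall i, arrs s 25 i = 0) ->
  wp w init_seg s (fun k s' => [/\ k <= 30 * lg (2 * n.+1) + 60,
    seg_ok n (fun z => (z == 0) || (z == n)) (fun=> 0) (fun=> 0) s' &
    regs s' 20 = 0]).
Proof.
move=> h0 n0 W h22 h24 h25; have w1 : 1 < 2 ^ w by lia.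
apply: wp_seq; wreg; first by rewrite h0; do ?split=> //; lia.
apply: wp_seq; wreg; apply: wp_seq; wreg.
rewrite /= /upd /= h0 addn1; set s1 := set_reg _ _ _.
apply: wp_seq; apply: wp_mono (@heap_updateP w s1 n.+1 n n _ _ _ _ _ _) _ => //.
- by lia.
- by move=> i _; rewrite /s1 /= !h22.
move=> k s2 F [hk hp lv].
apply: wp_seq; warr; first lia.
wreg; first lia.
split=> //; first lia.
split=> /=; rewrite /upd /=.
- by rewrite F.1.
- exact: hp.
- move=> z zn; rewrite lv // /s1 /= h22.
  by case: (z =P n) => [->|_]; rewrite ?orbT ?orbF //; case: eqP.
- by rewrite eqxx orbT.
move=> a an; rewrite (neqF (_ : a <> n)) ?orbF; last lia.
move=> /eqP->; rewrite eqxx F.1 // /s1 /= /upd /= h0.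
rewrite !F.2 // /s1 /= h24 h25; split=> //.
- by rewrite n0 leqnn.
- by rewrite eqxx orbT.
by move=> z hz; rewrite negb_or; lia.
Qed.

Definition tree_phase : prog := get_children ;; bfs ;; get_sizes ;; get_starts.

Definition rect_phase : prog := get_rects ;; sort_rects ;; init_seg ;; sweep.

Definition out_phase : prog := post_tree ;; post_boxes ;; post_dag.

Definition alg : prog :=
  load ;; tree_phase ;; order_out ;; rect_phase ;; out_phase.

(** * Reading the input *)

Lemma nth_words_fun (n m : nat) (f : 'I_n -> 'I_m) (i : 'I_n) :
  nth 0 (words_fun f) i = f i.
Proof. by rewrite /words_fun (nth_map i) ?size_enum_ord // nth_ord_enum. Qed.

Lemma size_words_fun (n m : nat) (f : 'I_n -> 'I_m) : size (words_fun f) = n.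
Proof. by rewrite size_map size_enum_ord. Qed.

Lemma card_lists_pairs (T : finType) (s : seq (T * T)) (S : {set {set T}}) :
  lists_pairs s S -> #|S| = size s.
Proof.
move=> [u h]; rewrite -(size_map (fun a => [set a.1; a.2])) -(card_uniqP u).
by apply: eq_card => P; rewrite h.
Qed.

Section Input.

Variables (n m : nat) (par : 'I_m -> 'I_m) (lf : 'I_n -> 'I_m).
Hypothesis fbt : full_binary_tree par.
Hypothesis lf_inj : injective lf.
Hypothesis lfP : forall u, is_leaf par u <-> exists x, u = lf x.

Definition parn (v : nat) : nat := nth 0 (words_fun par) v.
Definition szn (u : nat) : nat := if insub u is Some v then sz par lf v else 0.

Lemma parnE (v : 'I_m) : parn v = par v. Proof. exact: nth_words_fun. Qed.

Lemma sznE (v : 'I_m) : szn v = sz par lf v.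
Proof. by rewrite /szn valK. Qed.

Lemma clE (u : 'I_m) :
  (is_leaf par u /\ cl parn m u = [::]) \/
  (exists v1 v2 : 'I_m, [/\ children par u = [set v1; v2], v1 != v2 &
     cl parn m u = [:: val v1; val v2]]).
Proof.
have mem (v : 'I_m) : (val v \in cl parn m u) = (v \in children par u).
  by rewrite mem_cl ltn_ord inE parnE.
have lt x : x \in cl parn m u -> x < m by rewrite mem_cl => /and3P[].
have un : uniq (cl parn m u) by rewrite filter_uniq // iota_uniq.
have [l|nl] := boolP (is_leaf par u); [left|right].
  split=> //; case E : (cl parn m u) => [//|x l'].
  have xc : x \in cl parn m u by rewrite E mem_head.
  by have := mem (Ordinal (lt x xc)); rewrite xc (eqP l) inE.
have [a [b [c ab]]] := node_children fbt nl.
have : perm_eq (cl parn m u) [:: val a; val b].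
  apply: uniq_perm => //=; first by rewrite inE andbT val_eqE.
  move=> x; apply/idP/idP => [xc|].
    have := mem (Ordinal (lt x xc)); rewrite xc c !inE => /esym.
    by rewrite -!val_eqE.
  by rewrite !inE => /orP[]/eqP->; rewrite mem c !inE eqxx ?orbT.
move=> /perm_size; case E : (cl parn m u) => [|x [|y [|z l]]] // _.
have xc : x \in cl parn m u by rewrite E mem_head.
have yc : y \in cl parn m u by rewrite E !inE eqxx orbT.
exists (Ordinal (lt x xc)), (Ordinal (lt y yc)); split=> //.
  by apply/setP => v; rewrite -mem E !inE -!val_eqE.
by move: un; rewrite E /= inE andbT -val_eqE.
Qed.

Lemma root_exists : exists r : 'I_m, [/\ par r = r, forall v, anc par r v &
  forall v, par v = v -> v = r].
Proof.
have [[r pr hr] _] := fbt; exists r; split=> // v pv.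
by have /ancP[k <-] := hr v; elim: k => //= k <-.
Qed.

End Input.

Lemma pairwise_sub (T : eqType) (r r' : rel T) (s : seq T) :
  {in s &, forall x y, r x y -> r' x y} -> pairwise r s -> pairwise r' s.
Proof.
elim: s => //= x s IH h /andP[/allP a p]; apply/andP; split.
  by apply/allP => y ys; apply: h (a y ys); rewrite ?mem_head // inE ys orbT.
by apply: IH p => y z ys zs; apply: h; rewrite inE ?ys ?zs orbT.
Qed.

Lemma lg_bound n : 0 < n ->
  lg (2 * n) = trunc_log 2 n + 2 /\ lg (2 * n.+1) <= trunc_log 2 n + 3.
Proof.
move=> n0; have e1 : lg n = (trunc_log 2 n).+1 by rewrite /lg; case: eqP => //; lia.
have e2 : lg (2 * n) = trunc_log 2 n + 2 by rewrite lg_double // e1; lia.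
split=> //; apply: leq_trans (_ : lg (2 * (2 * n)) <= _); first by apply: leq_lg; lia.
by rewrite lg_double ?e2; lia.
Qed.

(** * From the listed pairs of the input to numbered rectangles and boxes *)

Section Rectangles.

Variables (n m : nat) (e : rel 'I_n) (par : 'I_m -> 'I_m) (A B : {set {set 'I_m}}).
Variables (lf : 'I_n -> 'I_m) (sA sB : seq ('I_m * 'I_m)) (r : 'I_m).
Variable (L : nat -> nat).
Hypothesis model : signed_tree_model_of e par A B lf.
Hypothesis lA : lists_pairs sA A.
Hypothesis lB : lists_pairs sB B.
Let LT (u : 'I_m) := L u.
Hypothesis L_root : forall u, par u = u -> LT u = 0.
Hypothesis L_children : forall u, ~~ is_leaf par u ->
  exists v1 v2, [/\ children par u = [set v1; v2], v1 != v2, LT v1 = LT u &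
                    LT v2 = LT u + sz par lf v1].

Let s := sA ++ sB.
Let p := size s.
Let a := size sA.
Let isr i := 0 < i <= p.
Let z i := nth (r, r) s i.-1.
Let lz i := if L (z i).2 < L (z i).1 then (z i).2 else (z i).1.
Let hz i := if L (z i).2 < L (z i).1 then (z i).1 else (z i).2.
Let pn := [seq (nat_of_ord x.1, nat_of_ord x.2) | x <- s].
Let U i := (nth (0, 0) pn i).1.
Let V i := (nth (0, 0) pn i).2.

Let fbt : full_binary_tree par. Proof. by case: model => -[]. Qed.
Let lf_inj : injective lf. Proof. by case: model. Qed.
Let lfP : forall u, is_leaf par u <-> exists x, u = lf x.
Proof. by case: model. Qed.

Lemma UV_E i : isr i -> U i.-1 = (z i).1 /\ V i.-1 = (z i).2.
Proof.
by move=> /andP[i0 ip]; rewrite /U /V (nth_map (r, r)) ?prednK.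
Qed.

Lemma lohi_E i : isr i -> lo U V L i = lz i /\ hi U V L i = hz i.
Proof.
by move=> ri; have [eu ev] := UV_E ri; rewrite /lo /hi /lz /hz eu ev; case: ifP.
Qed.

Lemma UV_lt i : i < p -> U i < m /\ V i < m.
Proof.
move=> ip; have [eu ev] := @UV_E i.+1 ip; rewrite /= in eu ev.
by rewrite eu ev !ltn_ord.
Qed.

Lemma z_set i : [set lz i; hz i] = [set (z i).1; (z i).2].
Proof. by rewrite /lz /hz; case: ifP => // _; rewrite setUC. Qed.

Lemma lz_le i : LT (lz i) <= LT (hz i).
Proof. by rewrite /LT /lz /hz; case: ltnP => // /ltnW. Qed.

Lemma zA i : isr i -> i <= a -> [set lz i; hz i] \in A.
Proof.
move=> /andP[i0 ip] ia; have [_ h] := lA; rewrite z_set h.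
have -> : z i = nth (r, r) sA i.-1 by rewrite /z nth_cat prednK // ia.
by apply: (map_f (fun x => [set x.1; x.2])); rewrite mem_nth // prednK.
Qed.

Lemma zB i : isr i -> a < i -> [set lz i; hz i] \in B.
Proof.
move=> /andP[i0 ip] ia; have [_ h] := lB; rewrite z_set h.
have hs : i.-1 - a < size sB by move: ip; rewrite /p size_cat -/a; lia.
have -> : z i = nth (r, r) sB (i.-1 - a).
  by rewrite /z nth_cat -/a ltnNge (_ : a <= i.-1) //; lia.
by apply: (map_f (fun x => [set x.1; x.2])); rewrite mem_nth.
Qed.

Lemma z_all P : P \in A :|: B -> exists2 i, isr i & P = [set lz i; hz i].
Proof.
have [_ hA] := lA; have [_ hB] := lB; rewrite inE hA hB -mem_cat -map_cat.
move=> /mapP[x xs ->]; have ix : index x s < p by rewrite index_mem.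
by exists (index x s).+1 => //; rewrite z_set /z /= nth_index.
Qed.

Lemma z_inj i j : isr i -> isr j -> [set lz i; hz i] = [set lz j; hz j] -> i = j.
Proof.
move=> /andP[i0 ip] /andP[j0 jp]; rewrite !z_set => E.
have us : uniq [seq [set x.1; x.2] | x <- s].
  have [uA hA] := lA; have [uB hB] := lB; rewrite map_cat cat_uniq uA uB andbT /=.
  apply/hasPn => P; rewrite -hB -hA => PB; apply/negP => PA.
  by case: model => -[_ /pred0P/(_ P) + _ _] _ _ _; rewrite /= PA PB.
have nE k : 0 < k <= p -> nth set0 [seq [set x.1; x.2] | x <- s] k.-1 = [set (z k).1; (z k).2].
  by move=> /andP[k0 kp]; rewrite (nth_map (r, r)) // prednK.
move: E; rewrite -!nE ?i0 ?j0 // => /eqP.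
by rewrite nth_uniq ?size_map ?prednK // => /eqP; lia.
Qed.

(** A transversal pair has two disjoint nonempty leaf intervals. This makes the logarithm at least 1
    as soon as [p] is positive, so that terms linear in [p] are absorbed by [p * trunc_log 2 n]. *)
Lemma p_n2 : 0 < p -> 1 < n.
Proof.
move=> p0; have r1 : isr 1 by [].
have := lohi_disj model L_children (fun i _ => lz_le i) zA zB r1.
have := L_bound fbt lf_inj lfP L_root L_children (hz 1).
have := sz_gt0 fbt lf_inj lfP (lz 1); have := sz_gt0 fbt lf_inj lfP (hz 1).
by rewrite card_ord; lia.
Qed.

(** Containment with a key that is not larger forces equal sides, hence the same pair, hence the
    same index. *)
Lemma z_sorted i j : isr i -> isr j ->
  key U V L (szn par lf) j <= key U V L (szn par lf) i ->
  ~~ ([&& LT (lz j) <= LT (lz i),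
         LT (lz i) + sz par lf (lz i) <= LT (lz j) + sz par lf (lz j),
         LT (hz j) <= LT (hz i) &
         LT (hz i) + sz par lf (hz i) <= LT (hz j) + sz par lf (hz j)] && (i != j)).
Proof.
move=> ri rj; have [li hi'] := lohi_E ri; have [lj hj] := lohi_E rj.
rewrite /key li hi' lj hj !sznE => le; apply/negP => /andP[/and4P[h1 h2 h3 h4] ne].
have E := anc_intE fbt lf_inj lfP L_children.
have el : lz i = lz j by apply: (anc_antisym fbt); rewrite E; apply/andP; split; lia.
have eh : hz i = hz j by apply: (anc_antisym fbt); rewrite E; apply/andP; split; lia.
by rewrite (z_inj ri rj) ?eqxx // el eh in ne.
Qed.

(** The starts of the leaves are [n] distinct numbers below [n], thus a bijection; its inverse lists
    the leaves from left to right. *)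
Lemma order_exists : exists o : seq 'I_n,
  perm_eq o (enum 'I_n) /\ forall v, pos o v = L (lf v).
Proof.
have lt v : L (lf v) < n.
  by have := L_lf_lt fbt lf_inj lfP L_root L_children v; rewrite card_ord.
pose f v := Ordinal (lt v).
have fi : injective f.
  by move=> u v /(congr1 val) /= /(L_lf_inj fbt lf_inj lfP L_children).
have [g fK gK] := injF_bij fi.
exists [seq g i | i <- enum 'I_n]; split.
  apply: uniq_perm; rewrite ?enum_uniq // ?(map_inj_uniq (can_inj gK)) ?enum_uniq //.
  move=> v; rewrite mem_enum; apply/mapP; exists (f v); rewrite ?mem_enum // fK.
move=> v; rewrite /pos -{1}(fK v) index_map ?index_enum_ord //.
exact: can_inj gK.
Qed.

Lemma rect_phaseP w o (n0 : 0 < n) st :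
  perm_eq o (enum 'I_n) -> (forall v, pos o v = L (lf v)) ->
  regs st 0 = n -> regs st 1 = m -> regs st 2 = p -> regs st 3 = a ->
  (forall i, i < p -> arrs st 0 (n + m + 2 * i + 4) = U i) ->
  (forall i, i < p -> arrs st 0 (n + m + 2 * i + 5) = V i) ->
  (forall u, u < m -> arrs st 8 u = L u) ->
  (forall u, u < m -> arrs st 7 u = szn par lf u) ->
  (forall b i, b \in [:: 15; 17; 19; 22; 24; 25] -> arrs st b i = 0) ->
  26 * n + 10 * m + 24 * p + 100 < 2 ^ w ->
  wp w rect_phase st (fun k s' => exists bs, [/\ outb bs s', size bs <= 6 * p,
    {in bs, forall b, box_in n b},
    forall x y, x < n -> y < n ->
      cover_count bs x y = (x < y) && e (ov o n0 x) (ov o n0 y) &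
    k <= (600 * lg (2 * n.+1) + 2260) * p + 60 * lg (2 * n.+1) + 130 * n + 460]).
Proof.
move=> po oL h0 h1 h2 h3 hU hV h8 h7 hz0 W.
have Ul i : i < p -> U i < m by move=> /UV_lt[].
have Vl i : i < p -> V i < m by move=> /UV_lt[].
have LB u : u < m -> L u + szn par lf u <= n.
  move=> um; have := L_bound fbt lf_inj lfP L_root L_children (Ordinal um).
  by rewrite -sznE card_ord.
apply: wp_seq.
apply: wp_mono (@get_rectsP w n m p U V L (szn par lf) Ul Vl LB _ st h0 h1 h2 hU hV h8 h7 _) _.
- by clear - W; lia.
- by move=> c; apply: hz0.
move=> k1 s1 F1 [e1 ra [lK kl]].
apply: wp_seq.
apply: wp_mono (@sort_rectsP w n m p U V L (szn par lf) Ul Vl LB _ s1 lK _ ra kl _) _.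
- by clear - W; lia.
- by rewrite F1.1.
- by move=> c; rewrite F1.2 // hz0.
move=> k2 s2 F2 [e2 [lS sl]].
apply: wp_seq; apply: wp_mono (@init_segP w n s2 _ n0 _ _ _ _) _.
- by rewrite F2.1 // F1.1.
- by clear - W; lia.
- by move=> i; rewrite F2.2 // F1.2 // hz0.
- by move=> i; rewrite F2.2 // F1.2 // hz0.
- by move=> i; rewrite F2.2 // F1.2 // hz0.
move=> k3 s3 F3 [e3 sg r20].
apply: wp_mono (@sweepP w n p a (fun i => LT (lz i))
  (fun i => LT (lz i) + sz par lf (lz i)) (fun i => LT (hz i))
  (fun i => LT (hz i) + sz par lf (hz i)) lS
  (fun x y => (x < y) && e (ov o n0 x) (ov o n0 y)) _ _ _ _ _ _ _ n0 _ s3 _ r20 _ sg) _.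
- move=> i ri.
  by have := @rect_x _ _ par lf e A B LT p lz model L_root L_children i ri; rewrite card_ord.
- move=> i ri.
  by have := @rect_y _ _ par lf e A B LT p hz model L_root L_children i ri; rewrite card_ord.
- exact: (@rect_laminar _ _ par lf e A B LT p a lz hz model L_children zA zB).
- move=> x i; have [_ _ _ ->] := sl x; case ri : (0 < i <= p) => //=.
  by have [-> _] := lohi_E ri.
- by move=> x; have [] := sl x.
- move=> x; have [_ _ pw me] := sl x.
  apply: pairwise_sub pw => i j; rewrite !me => /andP[ri _] /andP[rj _].
  exact: z_sorted.
- move=> x y c xn yn t.
  have := @top_adj _ _ par lf e A B LT p a lz hz model L_children
    (fun i _ => lz_le i) zA zB z_all (ov o n0 x) (ov o n0 y) c.
  by rewrite /= /LT -!oL !ovK //; apply.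
- by clear - W; lia.
- split.
  + by rewrite F3.1 // F2.1 // F1.1.
  + move=> i ri; rewrite F3.2 // F2.2 //; have [_ -> _ _] := ra i ri.
    by have [-> _] := lohi_E ri; rewrite sznE.
  + move=> i ri; rewrite F3.2 // F2.2 //; have [_ _ -> _] := ra i ri.
    by have [_ ->] := lohi_E ri.
  + move=> i ri; rewrite F3.2 // F2.2 //; have [_ _ _ ->] := ra i ri.
    by have [_ ->] := lohi_E ri; rewrite sznE.
  by move=> x _; rewrite !F3.2 //; have [] := sl x.
- by move=> b; rewrite F3.2 // F2.2 // F1.2 // hz0.
move=> k4 s4 F4 [bs [ob sb bi cc kk]]; exists bs; split=> //.
by clear - e1 e2 e3 kk; lia.
Qed.

End Rectangles.

Lemma loadP w x : 1 < 2 ^ w -> 3 < 2 ^ w -> nth 0 x 2 + nth 0 x 3 < 2 ^ w ->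
  wp w load (init x) (fun k s => [/\ k <= 20, regs s 0 = nth 0 x 0,
    regs s 1 = nth 0 x 1, regs s 3 = nth 0 x 2 &
    regs s 2 = nth 0 x 2 + nth 0 x 3]).
Proof.
move=> w1 w3 W.
apply: wp_seq; wreg; first lia.
apply: wp_seq; wreg.
apply: wp_seq; wreg; first lia.
by wreg; rewrite /= /upd /=; do ?split=> //; lia.
Qed.

Lemma tree_phaseP (n m w : nat) (par : 'I_m -> 'I_m) (lf : 'I_n -> 'I_m) s :
  full_binary_tree par -> injective lf ->
  (forall u, is_leaf par u <-> exists x, u = lf x) ->
  2 * n + 2 * m + 20 < 2 ^ w -> regs s 1 = m ->
  (forall v, v < m -> arrs s 0 (4 + v) = parn par v) ->
  (forall b i, b \in [:: 4; 5] -> arrs s b i = 0) ->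
  wp w tree_phase s (fun k s' => [/\ k <= 230 * m + 90,
    forall u, u < m -> arrs s' 7 u = szn par lf u,
    forall u : 'I_m, par u = u -> arrs s' 8 u = 0 &
    forall u : 'I_m, ~~ is_leaf par u -> exists v1 v2 : 'I_m,
      [/\ children par u = [set v1; v2], v1 != v2, arrs s' 8 v1 = arrs s' 8 u &
          arrs s' 8 v2 = arrs s' 8 u + sz par lf v1]]).
Proof.
move=> fbt lf_inj lfP W h1 hp hz; have [r [pr ra ru]] := root_exists fbt.
have parL v : v < m -> parn par v < m.
  by move=> vm; have /= -> := parnE par (Ordinal vm).
have prn : parn par r = r by rewrite parnE pr.
have fx v : v < m -> parn par v = v -> v = r.
  move=> vm E; suff /ru/(congr1 val) : par (Ordinal vm) = Ordinal vm by [].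
  by apply: val_inj; rewrite -[LHS]parnE.
have c2 u : u < m -> size (cl (parn par) m u) = 0 \/ size (cl (parn par) m u) = 2.
  move=> um; case: (clE fbt (Ordinal um)) => [[_ /= ->]|[v1 [v2 [_ _ /= ->]]]].
    by left.
  by right.
have reach (P : nat -> Prop) : P r ->
    (forall v, v < m -> v != r -> P (parn par v) -> P v) -> forall v, v < m -> P v.
  move=> P0 PS v vm; apply: (@tree_ind _ par fbt (fun v => P (val v)) _ _ (Ordinal vm)).
    by move=> u /ru->.
  move=> u nu Pu; apply: (PS _ (ltn_ord u)); last by rewrite parnE.
  by apply: contraNneq nu => /val_inj->; rewrite pr.
have s1 u : u < m -> size (cl (parn par) m u) = 0 -> szn par lf u = 1.
  move=> um; case: (clE fbt (Ordinal um)) => [[l _ _]|[v1 [v2 [_ _ /= ->]]] //].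
  by have /= -> := sznE par lf (Ordinal um); rewrite sz_leaf.
have s2 u : u < m -> size (cl (parn par) m u) = 2 -> szn par lf u =
    szn par lf (nth 0 (cl (parn par) m u) 0) + szn par lf (nth 0 (cl (parn par) m u) 1).
  move=> um; case: (clE fbt (Ordinal um)) => [[_ /= ->] //|[v1 [v2 [c ne /= ->]]] _].
  have /= -> := sznE par lf (Ordinal um).
  by rewrite /= (sznE par lf v1) (sznE par lf v2) (sz_node fbt lfP c ne).
have sle u : u < m -> szn par lf u <= n.
  move=> um; have /= -> := sznE par lf (Ordinal um).
  by have := sz_le par lf (Ordinal um); rewrite card_ord.
apply: wp_seq.
apply: wp_mono (@get_childrenP w n m r (parn par) parL (ltn_ord r) prn fx c2 W s h1 hp _ _) _.
- by move=> u; apply: hz.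
- by move=> u; apply: hz.
move=> k1 t1 F1 [e1 r4 ca]; apply: wp_seq.
apply: wp_mono (@bfsP w n m r (parn par) (ltn_ord r) prn fx c2 reach W t1 ca r4) _.
move=> k2 t2 F2 [e2 [ql [tq aq]]]; apply: wp_seq.
have ca2 : child_arrays m (parn par) m t2 by move=> u um; rewrite !F2.2 //; apply: ca.
apply: wp_mono (@get_sizesP w n m r (parn par) (szn par lf) (ltn_ord r) prn c2 s1 s2 sle W
  t2 ql ca2 _ tq aq) _.
  by rewrite F2.1 // F1.1.
move=> k3 t3 F3 [e3 a7].
apply: wp_mono (@get_startsP w n m r (parn par) (szn par lf) parL (ltn_ord r) prn fx c2 s2
  sle W t3 ql _ _ _ tq _ a7) _.
- by move=> u um; rewrite !F3.2 //; apply: ca2.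
- by rewrite F3.1 // F2.1 // F1.1.
- by rewrite F3.1 // F2.1.
- by rewrite F3.2.
move=> k4 t4 F4 [e4 a8 st]; split.
- by clear - e1 e2 e3 e4; lia.
- by move=> u um; rewrite F4.2 // a7.
- by move=> u /ru->.
move=> u nl; case: (clE fbt u) => [[l _]|[v1 [v2 [c ne E]]]]; first by rewrite l in nl.
have [|g1 g2] := st u (ltn_ord u); first by rewrite E.
by exists v1, v2; rewrite E /= in g1 g2; rewrite -sznE.
Qed.

(** Cell 3 of array 3, the number of pairs of the positive model, is left open until [alg3] has run;
    the last group is what [alg3] reads back. *)
Definition out_ok n bs (o sk : seq nat) s :=
  [/\ stored s 1 (size bs :: o ++ flatten [seq wquad o b | b <- bs]),
      stored s 2 ([:: 2 * n + 2 * size bs - 1; size (arcs n bs (size bs)); size bs]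
        ++ sk ++ wpairs (arcs n bs (size bs)) ++ wpairs (box_pairs n (size bs))),
      at_ (arrs s 3) 0 [:: n; 2 * n - 1; 0],
      at_ (arrs s 3) 4 ([seq (v - 1) %/ 2 | v <- iota 0 (2 * n - 1)] ++ sk) &
      [/\ regs s 0 = n, regs s 20 = size bs, regs s 9 = n + 3,
          offs n bs (size bs) s &
          at_ (arrs s 2) (n + 3) (wpairs (arcs n bs (size bs)))]].

Lemma out_phaseP w n bs (o sk : seq nat) s :
  regs s 0 = n -> 0 < n -> outb bs s -> {in bs, forall b, box_in n b} ->
  size o = n -> size sk = n -> at_ (arrs s 1) 1 o -> at_ (arrs s 2) 3 sk ->
  at_ (arrs s 3) (2 * n + 3) sk ->
  14 * n + 16 * (lg (2 * n) * size bs) + 20 * lg (2 * n) + 20 * size bs + 100 < 2 ^ w ->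
  wp w out_phase s (fun k s' =>
    k <= 200 * n + (200 * lg (2 * n) + 400) * size bs + 230 /\
    out_ok n bs o sk s').
Proof.
move=> h0 n0 [r20 a27] bi so ssk a1 a2 a3 W.
apply: wp_seq; apply: wp_mono (@post_treeP w n s h0 n0 _) _; first by clear - W; lia.
move=> k1 s1 F1 [e1 oa1 k2 p3 k3].
apply: wp_seq.
apply: wp_mono (@post_boxesP w n bs o s1 _ n0 _ bi so _ oa1 _) _.
- by rewrite F1.1.
- by split; [rewrite F1.1|rewrite F1.2].
- by rewrite F1.2.
- by clear - W; lia.
move=> k4 s2 F2 [e2 b1 oa2 of2 k5].
have sa := size_arcs bi (leqnn (size bs)).
have r0 : regs s2 0 = n by rewrite F2.1 // F1.1.
have r20' : regs s2 20 = size bs by rewrite F2.1 // F1.1.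
apply: wp_mono (@post_dagP w n (size bs) _ sk s2 r0 n0 r20' oa2 ssk _ _) _.
- by move=> i; rewrite ssk => isk; rewrite k5 ?k2 ?a2 ?ssk; clear - isk; lia.
- by clear - W sa; lia.
move=> k6 s3 F3 [e3 d2 u1 h3 k7]; split; first by clear - e1 e2 e3; lia.
split.
- move=> [|i] /= il; first by rewrite u1 /upd eqxx.
  by rewrite u1 /upd /= -[i.+1]add1n b1.
- by move=> i il; rewrite -[i]add0n d2.
- by [].
- apply/at_cat; split.
    move=> v; rewrite size_map size_iota => vl.
    by rewrite k7 // F2.2 // p3 // (nth_map 0) ?size_iota // nth_iota.
  move=> i; rewrite size_map size_iota ssk => isk.
  rewrite k7; last by clear - n0; lia.
  rewrite F2.2 // k3; last by clear - n0; lia.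
  by rewrite -a3 ?ssk //; congr (arrs s 3 _); clear - n0; lia.
split; rewrite ?F3.1 //.
- by case: oa2.
- by case: of2 => o1 o2; split=> u ul; rewrite F3.2 // ?o1 ?o2.
by move: d2 => /at_cat[_ /at_cat[_ /at_cat[+ _]]]; rewrite ssk /= add0n addnC.
Qed.

(** The base [b] is at least 2, so [b ^ 10] exceeds the constant 1000 and [b ^ 3] the polynomial.
    Its top term [n * n * p] comes from the number of pairs of the positive model, with the
    logarithms bounded by [2 * n]. *)
Lemma word_bound n p w : 0 < n -> (n + p).+1 ^ 20 <= 2 ^ w ->
  1000 * (1 + n + p + n * p + n * n * p) < 2 ^ w.
Proof.
move=> n0; apply: leq_trans; set b := (n + p).+1; have b2 : 2 <= b by rewrite /b; lia.
have -> : b ^ 20 = b ^ 10 * b ^ 7 * b ^ 3 by rewrite -!expnD.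
have h1 : 1 + n + p + n * p + n * n * p <= b ^ 3.
  apply: leq_trans (leq_addr (2 * n + 2 * p + 3 * (n * n) + 5 * (n * p) + 3 * (p * p) +
    n * n * n + 2 * (n * n * p) + 3 * (n * p * p) + p * p * p) _) _.
  by rewrite /b !expnS expn0; lia.
have h2 : 1000 < b ^ 10.
  by apply: leq_trans (_ : 2 ^ 10 <= _) => //; rewrite leq_exp2r.
have h3 : 0 < b ^ 7 by rewrite expn_gt0.
apply: leq_trans (_ : b ^ 10 * b ^ 3 <= _); last first.
  by rewrite leq_mul2r leq_pmulr ?orbT.
apply: leq_trans (_ : 1001 * b ^ 3 <= _); last by rewrite leq_mul2r h2 orbT.
by move: (b ^ 3) h1 => c; clear; lia.
Qed.

(** The summands are the costs of loading, the tree, the order, the rectangles and the output; the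
    linear part in [n] is reading and writing trees. *)
Lemma time_bound n p q m t l l' : 0 < n -> m <= 2 * n -> q <= 6 * p -> l = t + 2 ->
  l' <= t + 3 -> l <= 2 * n -> p <= p * t ->
  20 + (230 * m + 90) + (80 * n + 20) +
    ((600 * l' + 2260) * p + 60 * l' + 130 * n + 460) +
    (200 * n + (200 * l + 400) * q + 230) <= 200 * 100 * (n + p * t).
Proof.
move=> n0 mn qp le l'e ln pt.
have h1 : l' * p <= (t + 3) * p by rewrite leq_mul2r l'e orbT.
have h2 : l * q <= (t + 2) * (6 * p) by rewrite leq_mul // le.
by clear - n0 mn qp le l'e ln pt h1 h2; lia.
Qed.

Lemma size_tree_model n bs : {in bs, forall b, box_in n b} ->
  size (flatten [seq tree_pairs n b | b <- bs]) <=
  4 * (lg (2 * n) * lg (2 * n)) * size bs.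
Proof.
elim: bs => [|b bs IH] bi /=; first by [].
rewrite size_cat size_tree_pairs.
have [hx hy] := size_canon_box (bi b (mem_head _ _)).
have h := leq_mul hx hy.
have {}IH : size (flatten [seq tree_pairs n b | b <- bs]) <=
    4 * (lg (2 * n) * lg (2 * n)) * size bs.
  by apply: IH => c cb; apply: bi; rewrite inE cb orbT.
by rewrite mulnS; apply: leq_add; [clear - h; lia|exact: IH].
Qed.

Lemma pairs_input m (sA sB : seq ('I_m * 'I_m)) f b :
  at_ f b (words_pairs sA ++ words_pairs sB) -> forall i, i < size (sA ++ sB) ->
  let pn := [seq (nat_of_ord x.1, nat_of_ord x.2) | x <- sA ++ sB] in
  f (b + 2 * i) = (nth (0, 0) pn i).1 /\ f (b + 2 * i + 1) = (nth (0, 0) pn i).2.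
Proof.
rewrite !words_lift -wpairs_cat -map_cat => h i il pn.
have ip : i < size pn by rewrite size_map.
have [<- <-] := nth_wpairs ip.
have {}h j : j < 2 * size pn -> f (b + j) = nth 0 (wpairs pn) j.
  by move=> jl; apply: h; rewrite size_wpairs.
by split; rewrite -?addnA h //; clear - ip; lia.
Qed.

Lemma alg_run n m (e : rel 'I_n) (par : 'I_m -> 'I_m) (A B : {set {set 'I_m}})
    (lf : 'I_n -> 'I_m) (sA sB : seq ('I_m * 'I_m)) x w (n0 : 0 < n) :
  let p := size (sA ++ sB) in
  signed_tree_model_of e par A B lf -> lists_pairs sA A -> lists_pairs sB B ->
  x = [:: n; m; size sA; size sB] ++ words_fun par ++ words_fun lf
        ++ words_pairs sA ++ words_pairs sB ->
  1000 * (1 + n + p + n * p + n * n * p) < 2 ^ w ->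
  wp w alg (init x) (fun k s => exists (o : seq 'I_n) bs,
    [/\ perm_eq o (enum 'I_n),
        k <= 200 * 100 * (n + p * trunc_log 2 n) /\ p <= p * trunc_log 2 n,
        size bs <= 6 * p /\ {in bs, forall b, box_in n b},
        forall x y, x < n -> y < n ->
          cover_count bs x y = (x < y) && e (ov o n0 x) (ov o n0 y) &
        out_ok n bs [seq val v | v <- o] [seq snkn o v | v <- enum 'I_n] s]).
Proof.
move=> p model lA lB xE W.
have [[fbt _ _ _] lf_inj lfP _] := model.
have [r [pr ra ru]] := root_exists fbt.
have mn : m <= 2 * n by have := card_tree fbt lf_inj lfP; rewrite !card_ord.
have xat : at_ (arrs (init x) 0) 0 x by move=> i _.
have [x0 x1 x2 x3] : [/\ nth 0 x 0 = n, nth 0 x 1 = m, nth 0 x 2 = size sA &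
  nth 0 x 3 = size sB] by rewrite xE.
rewrite {2}xE in xat; move: xat => /at_cat[_ /at_cat[hp /at_cat[hl hs]]].
have ps : p = size sA + size sB by rewrite /p size_cat.
have inp v : v < m -> arrs (init x) 0 (4 + v) = parn par v.
  by move=> vm; apply: hp; rewrite size_words_fun.
have inl y : y < n -> arrs (init x) 0 (m + y + 4) = nth 0 (words_fun lf) y.
  move=> yn; rewrite -hl ?size_words_fun //; congr (nth 0 x _).
  by rewrite /=; clear; lia.
have inU := pairs_input hs.
have bE : 0 + size [:: n; m; size sA; size sB] + size (words_fun par) +
   size (words_fun lf) = n + m + 4 by rewrite !size_words_fun /=; clear; lia.
rewrite bE in inU; clear hp hl hs bE.
apply: wp_seq; apply: wp_mono (@loadP w x _ _ _) _.
- by clear - W; lia.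
- by clear - W; lia.
- by rewrite x2 x3 -ps; clear - W; lia.
rewrite x0 x1 x2 x3 -ps => k1 s1 F1 [e1 r0 r1 r3 r2].
apply: wp_seq.
apply: wp_mono (@tree_phaseP n m w par lf s1 fbt lf_inj lfP _ r1 _ _) _.
- by clear - W mn; lia.
- by move=> v vm; rewrite F1.2 ?inp.
- by move=> b i; rewrite !inE => /orP[]/eqP->; rewrite F1.2.
move=> k2 s2 F2 [e2 a7 Lr Lc]; set L := arrs s2 8 in Lr Lc.
have [o [po oL]] := order_exists model Lr Lc.
have so : size o = n by rewrite (perm_size po) size_enum_ord.
have posn v : pos o v < n.
  by rewrite -[X in _ < X]so index_mem (perm_mem po) mem_enum.
have psE (v : 'I_n) : L (nth 0 (words_fun lf) v) = pos o v by rewrite nth_words_fun oL.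
apply: wp_seq.
apply: wp_mono (@order_outP w n m (fun y => L (nth 0 (words_fun lf) y))
  (nth 0 (words_fun lf)) s2 _ _ _ _ _ _ _) _.
- by rewrite F2.1.
- by rewrite F2.1.
- by clear - W mn; lia.
- by move=> y yn; rewrite F2.2 // F1.2 ?inl.
- by [].
- by move=> y yn; have /= -> := psE (Ordinal yn).
- move=> y z yn zn; have /= -> := psE (Ordinal yn); have /= -> := psE (Ordinal zn).
  by move=> /(congr1 (ov o n0)); rewrite !posK // => /(congr1 val).
move=> k3 s3 F3 [e3 o1 o2 o3].
have at1 : at_ (arrs s3 1) 1 [seq val v | v <- o].
  move=> i; rewrite size_map so => il; rewrite (nth_map (Ordinal n0)) ?so //.
  by have := o1 (ov o n0 i) (ltn_ord _); rewrite psE ovK.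
have skE f b : (forall y, y < n -> f (b + y) = n - 1 + L (nth 0 (words_fun lf) y)) ->
    at_ f b [seq snkn o v | v <- enum 'I_n].
  move=> h i; rewrite size_map size_enum_ord => il; rewrite h //.
  rewrite (nth_map (Ordinal n0)) ?size_enum_ord // /snkn.
  have -> : nth (Ordinal n0) (enum 'I_n) i = Ordinal il.
    by apply: val_inj; rewrite /= nth_enum_ord.
  by have /= -> := psE (Ordinal il).
have at2 := skE _ _ o2; have at3 := skE _ _ o3.
apply: wp_seq.
apply: wp_mono (@rect_phaseP n m e par A B lf sA sB r L model lA lB Lr Lc w o n0 s3 po oL
  _ _ _ _ _ _ _ _ _ _) _.
- by rewrite F3.1 // F2.1.
- by rewrite F3.1 // F2.1.
- by rewrite F3.1 // F2.1.
- by rewrite F3.1 // F2.1.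
- move=> i ip; rewrite F3.2 // F2.2 // F1.2 //; have [<- _] := inU i ip.
  by congr (arrs _ 0 _); clear; lia.
- move=> i ip; rewrite F3.2 // F2.2 // F1.2 //; have [_ <-] := inU i ip.
  by congr (arrs _ 0 _); clear; lia.
- by move=> u _; rewrite F3.2.
- by move=> u um; rewrite F3.2 // a7.
- move=> b i; rewrite !inE => hb; rewrite F3.2 ?F2.2 ?F1.2 //.
  + by move: hb; do ![case/orP]; move=> /eqP->.
  + by move: hb; do ![case/orP]; move=> /eqP->.
  by move: hb; do ![case/orP]; move=> /eqP->.
- by rewrite -/p; clear - W mn; lia.
rewrite -/p => k4 s4 F4 [bs [ob sb bi cc e4]].
have [lE lE'] := lg_bound n0.
have ln : lg (2 * n) <= 2 * n := lg_leq _.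
have pt : p <= p * trunc_log 2 n.
  case: (posnP p) => [->//|p0]; apply: leq_pmulr; rewrite trunc_log_gt0 /=.
  exact: (p_n2 r model lA lB Lr Lc p0).
have hq : lg (2 * n) * size bs <= 2 * n * (6 * p) by apply: leq_mul.
apply: wp_mono (@out_phaseP w n bs [seq val v | v <- o]
  [seq snkn o v | v <- enum 'I_n] s4 _ n0 ob bi _ _ _ _ _ _) _.
- by rewrite F4.1 // F3.1 // F2.1.
- by rewrite size_map.
- by rewrite size_map size_enum_ord.
- by rewrite F4.2.
- by rewrite F4.2.
- by rewrite F4.2.
- by clear - W hq ln sb; lia.
move=> k5 s5 F5 [e5 ok]; exists o, bs; split=> //; split=> //.
apply: leq_trans (time_bound n0 mn sb lE lE' ln pt).
by clear - e1 e2 e3 e4 e5; lia.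
Qed.

Theorem theorem1p1 :
  exists (alg alg3 : prog) (c C : nat),
  forall (n m : nat) (e : rel 'I_n) (par : 'I_m -> 'I_m)
         (A B : {set {set 'I_m}}) (lf : 'I_n -> 'I_m) (x : seq nat) (w : nat),
  let p := #|A| + #|B| in
  simple_graph e ->
  signed_tree_model_of e par A B lf ->
  encodes_stm x par A B lf ->
  (n + p).+1 ^ c <= 2 ^ w ->
  exists (s s' : state) (k k' : nat),
  [/\ exec w alg (init x) k s /\ k <= C * (n + p * trunc_log 2 n),
      (exists (lt : rel 'I_n) (Bs : {set {set {set 'I_n}}}) (y : seq nat),
        [/\ interval_biclique_partition e lt Bs,
            #|Bs| <= C * p,
            encodes_ibp y lt Bs
          & stored s 1 y]),
      (exists (d : nat) (arc : rel 'I_d) (snk : 'I_n -> 'I_d)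
              (BD : {set {set 'I_d}}) (y : seq nat),
        [/\ dag_compression e arc snk BD,
            dag_size arc BD <= C * (n + p * trunc_log 2 n),
            encodes_dag y arc snk BD
          & stored s 2 y]),
      exec w alg3 s k' s' /\ k' <= C * (p * trunc_log 2 n ^ 2).+1
    & (exists (m' : nat) (par' : 'I_m' -> 'I_m') (B' : {set {set 'I_m'}})
              (lf' : 'I_n -> 'I_m') (y : seq nat),
        [/\ positive_tree_model_of e par' B' lf',
            #|B'| <= C * (p * trunc_log 2 n ^ 2),
            encodes_stm y par' set0 B' lf'
          & stored s' 3 y])].
Proof.
exists alg, alg3, 20, (200 * 100) => n m e par A B lf x w p sg model [sA [sB [lA lB xE]]] W.
have [[fbt _ _ _] lf_inj lfP _] := model.
have [r _] := root_exists fbt.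
(* The root has at least one leaf below it. *)
have n0 : 0 < n.
  by apply: leq_trans (sz_gt0 fbt lf_inj lfP r) _; have := sz_le par lf r; rewrite card_ord.
have pE : p = size (sA ++ sB).
  by rewrite /p (card_lists_pairs lA) (card_lists_pairs lB) size_cat.
clearbody p; subst p; have {}W := word_bound n0 W.
have [k [s [ex [o [bs [po [kT pt] [sb bi] cc ok]]]]]] := alg_run n0 model lA lB xE W.
move: ok => [st1 st2 a3 a4 [r0 r20 r9 of2 aa]].
have [lE _] := lg_bound n0; have ln := lg_leq (2 * n).
set p := size (sA ++ sB) in W sb pt kT *; set t := trunc_log 2 n in lE pt kT *.
have sa := size_arcs bi (leqnn (size bs)).
have spl := size_tree_model bi.
have hq : lg (2 * n) * size bs <= 2 * n * (6 * p) by apply: leq_mul.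
have hll : lg (2 * n) * lg (2 * n) <= 2 * n * (2 * n) by apply: leq_mul.
have hlq : lg (2 * n) * lg (2 * n) * size bs <= 2 * n * (2 * n) * (6 * p).
  by apply: leq_mul.
have W3 : 10 * n + 10 * size bs + 2 * size (arcs n bs (size bs)) +
   2 * size (flatten [seq tree_pairs n b | b <- bs]) + 100 < 2 ^ w.
  by clear - W sa spl hq hlq sb; lia.
have sz4 : size ([seq (v - 1) %/ 2 | v <- iota 0 (2 * n - 1)] ++
    [seq snkn o v | v <- enum 'I_n]) = 3 * n - 1.
  by rewrite size_cat size_map size_iota size_map size_enum_ord; clear - n0; lia.
have [k' [s' [ex' [kT' b3]]]] := alg3P r0 r20 r9 bi of2 aa a3 sz4 n0 a4 W3.
(* [(t + 2) * 6 * p] with [p <= p * t]; in the same way the square below gives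
   [6 + 24 + 24 = 54]. *)
have tq : lg (2 * n) * size bs <= 18 * (p * t).
  have := leq_mul (leqnn (lg (2 * n))) sb; rewrite {2}lE; clear - pt; lia.
have ptt : p * t <= p * t ^ 2 by rewrite expnS expn1 mulnA leq_mul2r pt orbT.
have tqq : lg (2 * n) * lg (2 * n) * size bs <= 54 * (p * t ^ 2).
  have := leq_mul (leqnn (lg (2 * n) * lg (2 * n))) sb.
  by rewrite {3 4}lE expnS expn1; rewrite expnS expn1 in ptt; clear - pt ptt; lia.
have alg3_b : (200 * (lg (2 * n) * lg (2 * n)) + 60 * lg (2 * n) + 100) * size bs + 30 <=
    200 * 100 * (p * t ^ 2).+1 by clear - tq tqq sb pt ptt; lia.
have dag_b : 2 * n + 2 * size bs - 1 + size (arcs n bs (size bs)) + size bs <=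
    200 * 100 * (n + p * t) by clear - sa sb tq pt; lia.
have pl_b : size (flatten [seq tree_pairs n b | b <- bs]) <= 200 * 100 * (p * t ^ 2).
  by clear - spl tqq; lia.
exists s, s', k, k'; split.
- by [].
- have [lt [Bs [h1 h2 h3]]] := ibp_exists sg po cc bi.
  exists lt, Bs; eexists; split; [exact: h1| |exact: h3|exact: st1].
  by apply: leq_trans h2 (leq_trans sb _); rewrite leq_mul2r orbT.
- have [arc [snk [BD [h1 h2 h3]]]] := dag_exists sg po cc bi.
  eexists; exists arc, snk, BD; eexists; split; [exact: h1| |exact: h3|exact: st2].
  exact: leq_trans h2 dag_b.
- by split=> //; exact: leq_trans kT' alg3_b.
have [par' [B' [lf' [h1 h2 h3]]]] := positive_exists sg po cc bi.
eexists; exists par', B', lf'; eexists; split; [exact: h1| |exact: h3|].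
  exact: leq_trans h2 pl_b.
by move=> i il; rewrite -[i]add0n b3 -?catA.
Qed.
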